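(* Let $\mathcal N=(\hat{\mathcal K},\hat{\mathcal B})$ be a model of $T^R$. The following are equivalent: 1. $T$ is $\aleph_0$-categorical; 2. $\mathrm{fdcl}_{\mathbb B}(A)$ is finite for every finite $A\subseteq\hat{\mathcal K}$; 3. $\mathrm{dcl}_{\mathbb B}(A)$ is finite for every finite $A\subseteq\hat{\mathcal K}$; 4. $\mathrm{fdcl}_{\mathbb B}(A)=\mathrm{dcl}_{\mathbb B}(A)$ for every finite $A\subseteq\hat{\mathcal K}$; 5. $\mathrm{fdcl}(A)$ is finite for every finite $A\subseteq\hat{\mathcal K}$; 6. $\mathrm{dcl}(A)$ is finite for every finite $A\subseteq\hat{\mathcal K}$; 7. $\mathrm{fdcl}(A)=\mathrm{dcl}(A)$ for every finite $A\subseteq\hat{\mathcal K}$.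
   Context: $L$ is a finite or countable first-order signature and $T$ is a complete first-order $L$-theory all of whose models have at least two elements. The randomization signature $L^R$ is the two-sorted continuous signature with a sort $\mathbb K$ (random elements) and a sort $\mathbb B$ (events). It has: function symbols $[\![\varphi(\cdot)]\!]:\mathbb K^n\to\mathbb B$ for each first-order $L$-formula $\varphi$ with $n$ free variables; a $[0,1]$-valued predicate $\mu$ on $\mathbb B$; the Boolean operations $\top,\bot,\sqcap,\sqcup,\neg$; and distances $d_{\mathbb B}$ and $d_{\mathbb K}$. A nice randomization of $\mathcal M\models T$ is a pre-structure $(\mathcal K,\mathcal B)$ with an atomless probability space $(\Omega,\mathcal B,\mu)$ satisfying the following. (i) $\mathcal B$ is a $\sigma$-algebra with the Boolean operations interpreted set-theoretically. (ii) $\mathcal K\subseteq M^\Omega$. (iii) $[\![\psi(\vec a)]\!]=\{\omega:\mathcal M\models\psi(\vec a(\omega))\}\in\mathcal B$. (iv) $\mathcal B$ consists exactly of such events. (v) For every $\theta(u,\vec v)$ and $\vec b$, some $a\in\mathcal K$ has $[\![\theta(a,\vec b)]\!]=[\![\exists u\,\theta(u,\vec b)]\!]$. (vi) $d_{\mathbb K}(a,b)=\mu[\![a\ne b]\!]$. (vii) $d_{\mathbb B}(\mathsf B,\mathsf C)=\mu(\mathsf B\triangle\mathsf C)$. In addition, its reduction (identifying points at distance $0$) is already complete. $T^R$ is the set of continuous $L^R$-sentences true in all nice randomizations of models of $T$. A model of $T^R$ is $\mathcal N=(\hat{\mathcal K},\hat{\mathcal B})$, with sort-$\mathbb K$ part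 $\hat{\mathcal K}$ and sort-$\mathbb B$ part $\hat{\mathcal B}$. An element $b$ is definable over $A$ in $\mathcal N$ if there are continuous formulas $\Phi_k(x,\vec a_k)$, with $\vec a_k$ tuples from $A$, whose values converge uniformly in $x$ to $d(x,b)$. For $A\subseteq\hat{\mathcal K}$: - $\mathrm{dcl}(A)$ (respectively $\mathrm{dcl}_{\mathbb B}(A)$) is the set of elements of $\hat{\mathcal K}$ (respectively $\hat{\mathcal B}$) definable over $A$; - $\mathrm{fdcl}_{\mathbb B}(A)$ is the set of events $[\![\varphi(\vec{\mathbf a})]\!]$ with $\varphi$ a first-order formula and $\vec{\mathbf a}$ a tuple from $A$; - a first-order formula $\varphi(u,\vec v)$ is functional if $T\models(\forall\vec v)(\exists^{\le1}u)\varphi(u,\vec v)$; - $\mathrm{fdcl}(A)$ is the set of $\mathbf b\in\hat{\mathcal K}$ such that $[\![\varphi(\mathbf b,\vec{\mathbf a})]\!]=\top$ for some functional $\varphi(u,\vec v)$ and tuple $\vec{\mathbf a}$ from $A$. *)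

(* Defs.v *)
From HB Require Import structures.
From mathcomp Require Import all_boot all_order all_algebra.
From mathcomp Require Import all_classical all_reals all_analysis.

Set Implicit Arguments.
Unset Strict Implicit.
Unset Printing Implicit Defensive.

Import Order.TTheory GRing.Theory Num.Theory.
Import numFieldNormedType.Exports.

Local Open Scope classical_set_scope.
Local Open Scope ring_scope.
Local Open Scope card_scope.

Definition vnil {A : Type} : 'I_0 -> A :=
  fun i => False_rect A (notF (ltn_ord i)).

Definition vcons {A : Type} {n : nat} (a : A) (v : 'I_n -> A) : 'I_n.+1 -> A :=
  fun i => if unlift ord0 i is Some j then v j else a.

(* Symbols are indexed by [countType]s: the signature is finite or countable.
   Constants are function symbols of arity 0. *)
Record signature := Signature {
  fsym : countType;
  farity : fsym -> nat;
  rsym : countType;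
  rarity : rsym -> nat }.

(* Terms and formulas with free variables among the [n] variables ['I_n].
   A quantifier binds the variable 0 of its body; the free variable [i] of the
   quantified formula is the variable [i + 1] of the body. *)
Inductive term (L : signature) (n : nat) : Type :=
| TVar (i : 'I_n)
| TApp (f : fsym L) (args : 'I_(farity f) -> term L n).

Inductive formula (L : signature) (n : nat) : Type :=
| FEq (s t : term L n)
| FRel (r : rsym L) (args : 'I_(rarity r) -> term L n)
| FNot (phi : formula L n)
| FAnd (phi psi : formula L n)
| FEx (phi : formula L n.+1).

Record structure (L : signature) := Structure {
  carrier :> Type;
  carrier_inh : inhabited carrier;
  finterp : forall f : fsym L, ('I_(farity f) -> carrier) -> carrier;
  rinterp : forall r : rsym L, ('I_(rarity r) -> carrier) -> Prop }.
Arguments finterp {L} s f _.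
Arguments rinterp {L} s r _.

Fixpoint teval (L : signature) (M : structure L) n (v : 'I_n -> M)
    (t : term L n) : M :=
  match t with
  | TVar i => v i
  | TApp f args => finterp M f (fun i => teval v (args i))
  end.

Fixpoint sat (L : signature) (M : structure L) n (phi : formula L n) :
    ('I_n -> M) -> Prop :=
  match phi with
  | FEq s t => fun v => teval v s = teval v t
  | FRel r args => fun v => rinterp M r (fun i => teval v (args i))
  | FNot psi => fun v => ~ sat psi v
  | FAnd psi chi => fun v => sat psi v /\ sat chi v
  | FEx psi => fun v => exists a : M, sat psi (vcons a v)
  end.

Definition theory (L : signature) := set (formula L 0).

Definition models (L : signature) (M : structure L) (T : theory L) : Prop :=
  forall phi, T phi -> sat (M := M) phi vnil.

Definition entails (L : signature) (T : theory L) (phi : formula L 0) : Prop :=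
  forall M : structure L, models M T -> sat (M := M) phi vnil.

Definition complete_theory (L : signature) (T : theory L) : Prop :=
  (exists M : structure L, models M T) /\
  (forall phi, entails T phi \/ entails T (FNot phi)).

Definition isomorphic (L : signature) (M N : structure L) : Prop :=
  exists2 h : M -> N, bijective h &
    (forall f v, h (finterp M f v) = finterp N f (h \o v)) /\
    (forall r v, rinterp M r v <-> rinterp N r (h \o v)).

(* Vacuously true when [T] is the complete theory of a finite structure. *)
Definition aleph0_categorical (L : signature) (T : theory L) : Prop :=
  forall M N : structure L, models M T -> models N T ->
    [set: M] #= [set: nat] -> [set: N] #= [set: nat] -> isomorphic M N.

Definition functional_formula (L : signature) (T : theory L) n
    (phi : formula L n.+1) : Prop :=
  forall M : structure L, models M T -> forall (v : 'I_n -> M) (a b : M),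
    sat phi (vcons a v) -> sat phi (vcons b v) -> a = b.

Definition pseudometric01 (R : realType) (X : Type) (d : X -> X -> R) : Prop :=
  [/\ forall x y, 0 <= d x y <= 1,
      forall x, d x x = 0,
      forall x y, d x y = d y x &
      forall x y z, d x z <= d x y + d y z].

(* The moduli of uniform continuity in the randomization signature say that
   every symbol is 1-Lipschitz in each argument. *)
Record prestructure (R : realType) (L : signature) := PreStructure {
  sortK : Type;
  sortB : Type;
  ev : forall n, formula L n -> ('I_n -> sortK) -> sortB;
  mu : sortB -> R;
  btop : sortB;
  bbot : sortB;
  bmeet : sortB -> sortB -> sortB;
  bjoin : sortB -> sortB -> sortB;
  bneg : sortB -> sortB;
  dK : sortK -> sortK -> R;
  dB : sortB -> sortB -> R;
  sortK_inh : inhabited sortK;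
  dK_pseudo : pseudometric01 dK;
  dB_pseudo : pseudometric01 dB;
  mu01 : forall x, 0 <= mu x <= 1;
  ev_lip : forall n (phi : formula L n) a b,
    dB (ev phi a) (ev phi b) <= \sum_(i < n) dK (a i) (b i);
  mu_lip : forall x y, `|mu x - mu y| <= dB x y;
  bmeet_lip : forall x x' y y',
    dB (bmeet x y) (bmeet x' y') <= dB x x' + dB y y';
  bjoin_lip : forall x x' y y',
    dB (bjoin x y) (bjoin x' y') <= dB x x' + dB y y';
  bneg_lip : forall x y, dB (bneg x) (bneg y) <= dB x y }.
Arguments ev {R L} p {n} _ _.
Arguments mu {R L} p _.
Arguments btop {R L} p.
Arguments bbot {R L} p.
Arguments bmeet {R L} p _ _.
Arguments bjoin {R L} p _ _.
Arguments bneg {R L} p _.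
Arguments dK {R L} p _ _.
Arguments dB {R L} p _ _.

Definition separated (R : realType) (X : Type) (d : X -> X -> R) : Prop :=
  forall x y, d x y = 0 -> x = y.

(* For a pseudometric this is completeness of the quotient metric space. *)
Definition cauchy_complete (R : realType) (X : Type) (d : X -> X -> R) : Prop :=
  forall u : nat -> X,
    (forall e : R, 0 < e -> exists N, forall m n,
      (N <= m)%N -> (N <= n)%N -> d (u m) (u n) < e) ->
    exists l, forall e : R, 0 < e -> exists N, forall n,
      (N <= n)%N -> d (u n) l < e.

Definition metric_structure (R : realType) (L : signature)
    (P : prestructure R L) : Prop :=
  [/\ separated (dK P), cauchy_complete (dK P),
      separated (dB P) & cauchy_complete (dB P)].

Definition cube (R : realType) (n : nat) : set 'rV[R]_n :=
  [set v | forall i, 0 <= v ord0 i <= 1].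

Record connective (R : realType) (n : nat) := Connective {
  conn_fun :> 'rV[R]_n -> R;
  conn_range : forall v, cube v -> 0 <= conn_fun v <= 1;
  conn_cont : {within @cube R n, continuous conn_fun} }.

(* The only terms of sort K are variables. *)
Inductive bterm (L : signature) (p q : nat) : Type :=
| BVar (j : 'I_q)
| BEv n (phi : formula L n) (x : 'I_n -> 'I_p)
| BTop
| BBot
| BMeet (s t : bterm L p q)
| BJoin (s t : bterm L p q)
| BNeg (s : bterm L p q).

(* Free variables: [p] of sort K and [q] of sort B. *)
Inductive cformula (R : realType) (L : signature) (p q : nat) : Type :=
| CMu (s : bterm L p q)
| CDistK (x y : 'I_p)
| CDistB (s t : bterm L p q)
| CConn n (u : connective R n) (args : 'I_n -> cformula R L p q)
| CSupK (Phi : cformula R L p.+1 q)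
| CInfK (Phi : cformula R L p.+1 q)
| CSupB (Phi : cformula R L p q.+1)
| CInfB (Phi : cformula R L p q.+1).

Fixpoint beval (R : realType) (L : signature) (P : prestructure R L) p q
    (a : 'I_p -> sortK P) (b : 'I_q -> sortB P) (t : bterm L p q) : sortB P :=
  match t with
  | BVar j => b j
  | BEv _ phi x => ev P phi (a \o x)
  | BTop => btop P
  | BBot => bbot P
  | BMeet s t => bmeet P (beval a b s) (beval a b t)
  | BJoin s t => bjoin P (beval a b s) (beval a b t)
  | BNeg s => bneg P (beval a b s)
  end.

Fixpoint ceval (R : realType) (L : signature) (P : prestructure R L) p q
    (Phi : cformula R L p q) : ('I_p -> sortK P) -> ('I_q -> sortB P) -> R :=
  match Phi with
  | CMu s => fun a b => mu P (beval a b s)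
  | CDistK x y => fun a b => dK P (a x) (a y)
  | CDistB s t => fun a b => dB P (beval a b s) (beval a b t)
  | CConn _ u args => fun a b => u (\row_i ceval (args i) a b)
  | CSupK Psi => fun a b => sup (range (fun x => ceval Psi (vcons x a) b))
  | CInfK Psi => fun a b => inf (range (fun x => ceval Psi (vcons x a) b))
  | CSupB Psi => fun a b => sup (range (fun x => ceval Psi a (vcons x b)))
  | CInfB Psi => fun a b => inf (range (fun x => ceval Psi a (vcons x b)))
  end.

(* A continuous sentence is true when its value is 0. *)
Definition ctrue (R : realType) (L : signature) (P : prestructure R L)
    (Phi : cformula R L 0 0) : Prop :=
  ceval (P := P) Phi vnil vnil = 0.

Definition atomless (R : realType) d (Omega : measurableType d)
    (P : probability Omega R) : Prop :=
  forall A : set Omega, measurable A -> (0 < P A)%E ->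
    exists B : set Omega,
      [/\ measurable B, B `<=` A & (0 < P B < P A)%E].

(* The injections [nrX] and [nrE] identify the sorts of [P] with a set of
   functions from [Omega] to [M] and with the sigma-algebra of [Omega]. *)
Record nice_randomization (R : realType) (L : signature) (M : structure L)
    (P : prestructure R L) := NiceRandomization {
  nr_disp : measure_display;
  nr_Omega : measurableType nr_disp;
  nr_prob : probability nr_Omega R;
  nrX : sortK P -> nr_Omega -> M;
  nrE : sortB P -> set nr_Omega;
  nr_atomless : atomless nr_prob;
  nrX_inj : injective nrX;
  nrE_inj : injective nrE;
  nrE_range : range nrE = [set A | measurable A];
  nr_mu : forall x, mu P x = fine (nr_prob (nrE x));
  nr_top : nrE (btop P) = setT;
  nr_bot : nrE (bbot P) = set0;
  nr_meet : forall x y, nrE (bmeet P x y) = nrE x `&` nrE y;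
  nr_join : forall x y, nrE (bjoin P x y) = nrE x `|` nrE y;
  nr_neg : forall x, nrE (bneg P x) = ~` nrE x;
  nr_ev : forall n (psi : formula L n) (a : 'I_n -> sortK P),
    nrE (ev P psi a) = [set w | sat psi (fun i => nrX (a i) w)];
  nr_events : forall x : sortB P,
    exists n (psi : formula L n) (a : 'I_n -> sortK P), x = ev P psi a;
  nr_witness : forall n (theta : formula L n.+1) (b : 'I_n -> sortK P),
    exists a : sortK P, ev P theta (vcons a b) = ev P (FEx theta) b;
  nr_dK : forall a b,
    dK P a b = fine (nr_prob [set w | nrX a w <> nrX b w]);
  nr_dB : forall x y, dB P x y = fine (nr_prob (nrE x `+` nrE y));
  nr_completeK : cauchy_complete (dK P);
  nr_completeB : cauchy_complete (dB P) }.

Definition TR (R : realType) (L : signature) (T : theory L) :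
    set (cformula R L 0 0) :=
  [set Phi | forall (M : structure L) (P : prestructure R L),
    models M T -> nice_randomization M P -> ctrue P Phi].

Definition models_TR (R : realType) (L : signature) (T : theory L)
    (N : prestructure R L) : Prop :=
  metric_structure N /\ forall Phi, TR T Phi -> ctrue N Phi.

Definition dcl (R : realType) (L : signature) (N : prestructure R L)
    (A : set (sortK N)) : set (sortK N) :=
  [set b | exists (n : nat -> nat)
                  (Phi : forall k, cformula R L (n k).+1 0)
                  (a : forall k, 'I_(n k) -> sortK N),
     (forall k i, A (a k i)) /\
     forall e : R, 0 < e -> exists K, forall k, (K <= k)%N -> forall x,
       `|ceval (Phi k) (vcons x (a k)) vnil - dK N x b| < e].

Definition dclB (R : realType) (L : signature) (N : prestructure R L)
    (A : set (sortK N)) : set (sortB N) :=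
  [set b | exists (n : nat -> nat)
                  (Phi : forall k, cformula R L (n k) 1)
                  (a : forall k, 'I_(n k) -> sortK N),
     (forall k i, A (a k i)) /\
     forall e : R, 0 < e -> exists K, forall k, (K <= k)%N -> forall x,
       `|ceval (Phi k) (a k) (vcons x vnil) - dB N x b| < e].

Definition fdclB (R : realType) (L : signature) (N : prestructure R L)
    (A : set (sortK N)) : set (sortB N) :=
  [set b | exists n (phi : formula L n) (a : 'I_n -> sortK N),
     (forall i, A (a i)) /\ b = ev N phi a].

Definition fdcl (R : realType) (L : signature) (T : theory L)
    (N : prestructure R L) (A : set (sortK N)) : set (sortK N) :=
  [set b | exists n (phi : formula L n.+1) (a : 'I_n -> sortK N),
     [/\ functional_formula T phi, forall i, A (a i) &
         ev N phi (vcons b a) = btop N]].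

(* Main.v *)
(* All seven conditions are equivalent to T having finitely many n-types for each
   n (Ryll-Nardzewski).

   If T has finitely many types, then, in a model N of T^R, every event
   definable by a first-order formula from a finite tuple a is a union of atoms,
   and a tuple extending a is determined up to elementary equivalence by the
   measures of the events of its complete types. The latter rests on gluing,
   exact witnesses and Sierpinski's theorem in N, which let two tuples with the
   same measures be extended in the same way. An event, or an element, that is
   not first-order definable over a can then be altered by exchanging pieces of
   equal measure without changing its type over a, so it is not definable.

   If T has infinitely many n-types, choose pairwise inconsistent n-formulas
   psi_k and glue a tuple a with each [[psi_k(a)]] of positive measure. These
   events are infinitely many, and the unions of subfamilies of them are limits
   of first-order definable events; there are uncountably many of those, while
   the formulas are countably many. Two elements that differ everywhere turn
   such events into elements. *)
From mathcomp Require Import all_boot all_order all_algebra.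
From mathcomp Require Import all_classical all_reals all_analysis.
From mathcomp Require Import lra.
Require Import Defs.

Set Implicit Arguments.
Unset Strict Implicit.
Unset Printing Implicit Defensive.

Import Order.TTheory GRing.Theory Num.Theory.
Import numFieldNormedType.Exports.

Local Open Scope classical_set_scope.

(** * First-order syntax *)

(** [N] is known only through the sentences of [T^R], and these transfer infima, not minima: an
    exact witness in every nice randomization becomes an approximate one in [N], and exactness has
    to be regained from completeness. For gluing this is direct, since two approximate gluings are
    close to each other. Witnesses of a formula are not unique, so arbitrary approximations need not
    converge; an approximation is therefore kept wherever it is already correct and replaced only
    elsewhere. Quantifiers over events are an obstacle to an induction on continuous formulas that
    works by extending tuples of elements. Two elements that differ almost everywhere remove it: an
    event is recorded as the place where a glued element agrees with the first of them. If [T] has a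
    finite model, condition 1 is vacuous; the equivalence survives because infinitely many n-types
    force every model of [T] to be infinite. *)

Lemma vcons0 {A : Type} n (a : A) (v : 'I_n -> A) : vcons a v ord0 = a.
Proof. by rewrite /vcons unlift_none. Qed.

Lemma vconsS {A : Type} n (a : A) (v : 'I_n -> A) i :
  vcons a v (lift ord0 i) = v i.
Proof. by rewrite /vcons liftK. Qed.

Lemma ordS_ind n (P : 'I_n.+1 -> Prop) :
  P ord0 -> (forall j : 'I_n, P (lift ord0 j)) -> forall i, P i.
Proof. by move=> P0 PS i; case: (unliftP ord0 i) => [j|] ->. Qed.

Lemma vcons_eta {A : Type} n (v : 'I_n.+1 -> A) :
  vcons (v ord0) (v \o lift ord0) = v.
Proof.
by apply/funext; apply: ordS_ind => [|j]; rewrite ?vcons0 ?vconsS.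
Qed.

Lemma vcons_comp {A B : Type} (f : A -> B) n (a : A) (v : 'I_n -> A) :
  f \o vcons a v = vcons (f a) (f \o v).
Proof.
by apply/funext; apply: ordS_ind => [|j]; rewrite /= ?vcons0 ?vconsS.
Qed.

Lemma vcons_lift {A : Type} n (a : A) (v : 'I_n -> A) :
  vcons a v \o lift ord0 = v.
Proof. by apply/funext => i /=; rewrite vconsS. Qed.

Lemma eq_ord0_fun {A : Type} (v w : 'I_0 -> A) : v = w.
Proof. by apply/funext => -[]. Qed.

Definition up n m (f : 'I_n -> 'I_m) : 'I_n.+1 -> 'I_m.+1 :=
  vcons ord0 (lift ord0 \o f).

Lemma vcons_up {A : Type} n m (a : A) (v : 'I_m -> A) (f : 'I_n -> 'I_m) :
  vcons a v \o up f = vcons a (v \o f).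
Proof. by rewrite /up vcons_comp vcons0 compA vcons_lift. Qed.

Section Renaming.
Variable L : signature.

Fixpoint tren n m (f : 'I_n -> 'I_m) (t : term L n) : term L m :=
  match t with
  | TVar i => TVar L (f i)
  | TApp g args => TApp (fun i => tren f (args i))
  end.

Fixpoint ren n (phi : formula L n) : forall m, ('I_n -> 'I_m) -> formula L m :=
  match phi with
  | FEq s t => fun m f => FEq (tren f s) (tren f t)
  | FRel r args => fun m f => FRel (fun i => tren f (args i))
  | FNot psi => fun m f => FNot (ren psi f)
  | FAnd psi chi => fun m f => FAnd (ren psi f) (ren chi f)
  | FEx psi => fun m f => FEx (ren psi (up f))
  end.

Lemma teval_tren (M : structure L) n m (f : 'I_n -> 'I_m) (t : term L n)
  (v : 'I_m -> M) : teval v (tren f t) = teval (v \o f) t.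
Proof.
by elim: t => [//|g args IH] /=; congr finterp; apply/funext => i; rewrite IH.
Qed.

Lemma sat_ren (M : structure L) n (phi : formula L n) m (f : 'I_n -> 'I_m)
  (v : 'I_m -> M) : sat (ren phi f) v <-> sat phi (v \o f).
Proof.
elim: phi m f v => {n} [n s t|n r args|n phi IH|n phi IH psi IH'|n phi IH] m f v /=.
- by rewrite !teval_tren.
- suff -> : (fun i => teval v (tren f (args i))) =
            (fun i => teval (v \o f) (args i)) by [].
  by apply/funext => i; rewrite teval_tren.
- by rewrite IH.
- by rewrite IH IH'.
- by split=> -[a]; rewrite ?IH ?vcons_up => ?; exists a; rewrite ?IH ?vcons_up.
Qed.

(** For [n = 0] there is no free variable to build an equation from, hence the quantifier; carriers
    are inhabited. *)
Definition FTrue n : formula L n := FEx (FEq (TVar L ord0) (TVar L ord0)).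
Definition FFalse n : formula L n := FNot (FTrue n).
Definition FOr n (phi psi : formula L n) : formula L n :=
  FNot (FAnd (FNot phi) (FNot psi)).

Lemma sat_true (M : structure L) n (v : 'I_n -> M) : sat (FTrue n) v.
Proof. by case: (carrier_inh M) => a; exists a. Qed.

Lemma sat_not (M : structure L) n (phi : formula L n) (v : 'I_n -> M) :
  sat (FNot phi) v <-> ~ sat phi v.
Proof. by []. Qed.

Lemma sat_and (M : structure L) n (phi psi : formula L n) (v : 'I_n -> M) :
  sat (FAnd phi psi) v <-> sat phi v /\ sat psi v.
Proof. by []. Qed.

Lemma sat_or (M : structure L) n (phi psi : formula L n) (v : 'I_n -> M) :
  sat (FOr phi psi) v <-> sat phi v \/ sat psi v.
Proof.
rewrite /=; split; last by tauto.
by move=> h; apply: contrapT; tauto.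
Qed.

Lemma sat_bigor (M : structure L) n (I : finType) (P : pred I)
    (phi : I -> formula L n) (v : 'I_n -> M) :
  sat (\big[@FOr n/FFalse n]_(i | P i) phi i) v <->
  exists2 i, P i & sat (phi i) v.
Proof.
have -> : (exists2 i, P i & sat (phi i) v) <->
  (exists2 i, i \in index_enum I & P i /\ sat (phi i) v).
  split=> [[i Pi si]|[i _ [Pi si]]]; exists i => //.
elim: (index_enum I) => [|i s IH].
  rewrite big_nil; split=> [|[]//].
  by case; apply: sat_true.
rewrite big_cons; case: ifPn => Pi.
  rewrite sat_or IH; split=> [[si|[j js sj]]|[j]].
  - by exists i; rewrite ?mem_head.
  - by exists j; rewrite // inE js orbT.
  - by rewrite inE => /predU1P[->|js] [Pj sj]; [left|right; exists j].
rewrite IH; split=> [[j js sj]|[j]].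
  by exists j; rewrite // inE js orbT.
rewrite inE => /predU1P[->|js] sj; last by exists j.
by case: sj => Pi'; rewrite Pi' in Pi.
Qed.

Definition fconj n (I : finType) (phi : I -> formula L n) : formula L n :=
  FNot (\big[@FOr n/FFalse n]_i FNot (phi i)).

Lemma sat_fconj (M : structure L) n (I : finType) (phi : I -> formula L n)
    (v : 'I_n -> M) : sat (fconj phi) v <-> forall i, sat (phi i) v.
Proof.
rewrite /= sat_bigor; split=> [h i|h [i _]]; last by apply; apply: h.
by apply: contrapT => ?; apply: h; exists i.
Qed.

Fixpoint exs n : formula L n -> formula L 0 :=
  match n with 0 => id | _.+1 => fun phi => exs (FEx phi) end.

Lemma sat_exs (M : structure L) n (phi : formula L n) :
  sat (exs phi) (vnil : 'I_0 -> M) <-> exists v : 'I_n -> M, sat phi v.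
Proof.
elim: n phi => [|n IH] phi /=.
  by split=> [h|[v]]; [exists vnil|rewrite (eq_ord0_fun v vnil)].
rewrite IH /=; split=> [[v [a h]]|[v h]]; first by exists (vcons a v).
by exists (v \o lift ord0), (v ord0); rewrite vcons_eta.
Qed.

(** The quantified variables come first because [k.+1 + n] is convertible with [(k + n).+1]. *)
Fixpoint exK n k : formula L (k + n) -> formula L n :=
  match k with 0 => id | k'.+1 => fun phi => @exK n k' (FEx phi) end.

Lemma sat_exK (M : structure L) n k (phi : formula L (k + n)) (w : 'I_n -> M) :
  sat (exK phi) w <->
  exists2 v : 'I_(k + n) -> M, v \o @rshift k n = w & sat phi v.
Proof.
elim: k phi w => [|k IH] phi w.
  have e (v : 'I_(0 + n) -> M) : v \o @rshift 0 n = v.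
    by apply/funext => i /=; congr v; apply/val_inj.
  by split=> [h|[v <-]]; [exists w; rewrite ?e|rewrite e].
have e : @rshift k.+1 n = lift (ord0 : 'I_(k + n).+1) \o @rshift k n.
  by apply/funext => i; apply/val_inj.
rewrite /= IH /=; split=> [[v vw [a h]]|[v vw h]].
  by exists (vcons a v) => //; rewrite e compA vcons_lift.
exists (v \o lift ord0); first by rewrite -vw e.
by exists (v ord0); rewrite (vcons_eta (v : 'I_(k + n).+1 -> M)).
Qed.

(** Countability of the syntax serves twice: to enumerate the tasks of the Henkin construction, and
    to show that the formulas are too few to name all limits of definable events. Argument families
    are listed along [enum] to become data. *)
Fixpoint tcode n (t : term L n) : GenTree.tree nat :=
  match t with
  | TVar i => GenTree.Leaf (i : nat)
  | TApp f args =>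
      GenTree.Node (pickle f) [seq tcode (args i) | i <- enum 'I_(farity f)]
  end.

Lemma tcode_inj n : injective (@tcode n).
Proof.
elim=> [i|f args IH] [j|g args'] //=; first by case=> /val_inj ->.
case=> /(pcan_inj (@pickleK _)) fg; case: _ / fg args' => args' e.
congr TApp; apply/funext => i; apply: IH.
by move/eq_in_map: e; apply; rewrite mem_enum.
Qed.

Fixpoint fcode n (phi : formula L n) : GenTree.tree nat :=
  match phi with
  | FEq s t => GenTree.Node 0 [:: tcode s; tcode t]
  | FRel r args => GenTree.Node 1 (GenTree.Leaf (pickle r) ::
                     [seq tcode (args i) | i <- enum 'I_(rarity r)])
  | FNot psi => GenTree.Node 2 [:: fcode psi]
  | FAnd psi chi => GenTree.Node 3 [:: fcode psi; fcode chi]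
  | FEx psi => GenTree.Node 4 [:: fcode psi]
  end.

Lemma fcode_inj n : injective (@fcode n).
Proof.
elim=> {n} [n s t|n r args|n phi IH|n phi IH psi IH'|n phi IH]
  [s' t'|r' args'|phi'|phi' psi'|phi'] //=.
- by case=> /tcode_inj -> /tcode_inj ->.
- case=> /(pcan_inj (@pickleK _)) e; case: _ / e args' => args' e.
  congr FRel; apply/funext => i; apply: tcode_inj.
  by move/eq_in_map: e; apply; rewrite mem_enum.
- by case=> /IH ->.
- by case=> /IH -> /IH' ->.
- by case=> /IH ->.
Qed.

End Renaming.
Arguments FTrue {L} n.
Arguments FFalse {L} n.

(** * Finitely many types *)

Section Types.
Variables (L : signature) (T : theory L).

Definition timp n (phi psi : formula L n) : Prop :=
  forall M : structure L, models M T -> forall v : 'I_n -> M,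
    sat phi v -> sat psi v.

Definition consistent n (phi : formula L n) : Prop :=
  exists2 M : structure L, models M T & exists v : 'I_n -> M, sat phi v.

(** Either [theta] generates a complete type or it is inconsistent with [T]. The degenerate case is
    allowed so that it can serve as a default. *)
Definition isolates n (theta : formula L n) : Prop :=
  forall phi, timp theta phi \/ timp theta (FNot phi).

Definition type_partition n (I : finType) (theta : I -> formula L n) : Prop :=
  [/\ forall i, isolates (theta i),
      forall M : structure L, models M T -> forall v : 'I_n -> M,
        exists i, sat (theta i) v &
      forall M : structure L, models M T -> forall (v : 'I_n -> M) i j,
        sat (theta i) v -> sat (theta j) v -> i = j].

Definition finite_types n : Prop :=
  exists (I : finType) (theta : I -> formula L n), type_partition theta.

(** Localized form of having finitely many types, without disjointness. Its failure passes from a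
    formula to one of the two parts into which any other formula cuts it. *)
Definition finitely_atomic n (phi : formula L n) : Prop :=
  exists (I : finType) (theta : I -> formula L n),
    (forall i, isolates (theta i)) /\
    forall M : structure L, models M T -> forall v : 'I_n -> M,
      sat phi v -> exists i, sat (theta i) v.

(** Isolating formulas that are realized together are equivalent modulo [T], so a cover becomes a
    partition once one index is kept in each class. *)
Lemma finite_typesP n : finite_types n <-> finitely_atomic (FTrue n).
Proof.
split=> [[I [theta [iso cov _]]]|[I [theta [iso cov]]]].
  by exists I, theta; split=> // M MT v _; apply: cov.
pose r i j := `[< exists2 M : structure L, models M T &
  exists2 v : 'I_n -> M, sat (theta i) v & sat (theta j) v >].
have rtimp i j : r i j -> timp (theta i) (theta j).
  move=> /asboolP[M MT [v vi vj]]; case: (iso i (theta j)) => // h.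
  by case: (h M MT v vi).
have rsym i j : r i j -> r j i.
  by move=> /asboolP[M MT [v vi vj]]; apply/asboolP; exists M => //; exists v.
have rtrans i j k : r i j -> r j k -> r i k.
  move=> ij; move: (rsym _ _ ij) => /rtimp ji /asboolP[M MT [v vj vk]].
  by apply/asboolP; exists M => //; exists v => //; apply: ji.
(* The default is reached only for inconsistent [theta i], since [r i i] holds otherwise; such
   indices may stay, as they are never realized. *)
pose c i := odflt i [pick j | r i j].
have rc M (MT : models M T) (v : 'I_n -> M) i : sat (theta i) v -> r i (c i).
  move=> vi; rewrite /c; case: pickP => [j //|/(_ i)] /=.
  by move/asboolP => []; exists M => //; exists v.
have cr i j : r i j -> c i = c j.
  move=> ij; rewrite /c (@eq_pick _ (r i) (r j)).
    case: pickP => // /(_ j) /asboolP[].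
    move/asboolP: ij => [M MT [v vi vj]].
    by exists M => //; exists v.
  by move=> k; apply/idP/idP; apply: rtrans => //; apply: rsym.
exists {i : I | c i == i}, (fun i => theta (val i)); split=> [i|M MT v|M MT v i j].
- exact: iso.
- have [i vi] := cov M MT v (sat_true v).
  have ric := rc _ MT v _ vi.
  have cc : c (c i) == c i by rewrite -(cr _ _ ric).
  by exists (exist _ (c i) cc) => /=; apply: rtimp ric _ MT _ vi.
- move=> vi vj; apply/val_inj; rewrite -(eqP (valP i)) -(eqP (valP j)).
  by apply: cr; apply/asboolP; exists M => //; exists v.
Qed.

Lemma isolates_finitely_atomic n (phi : formula L n) :
  isolates phi -> finitely_atomic phi.
Proof.
by move=> iso; exists unit, (fun=> phi); split=> // M MT v phiv; exists tt.
Qed.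

Lemma finitely_atomic_split n (phi psi : formula L n) :
  finitely_atomic (FAnd phi psi) -> finitely_atomic (FAnd phi (FNot psi)) ->
  finitely_atomic phi.
Proof.
move=> [I [f [fi fc]]] [J [g [gi gc]]].
exists (I + J)%type, (fun x => match x with inl i => f i | inr j => g j end).
split=> [[]//|M MT v phiv].
case: (pselect (sat psi v)) => psiv.
  by have [//|i fv] := fc M MT v; exists (inl i).
by have [//|i gv] := gc M MT v; exists (inr i).
Qed.

(** Such a [phi] is not isolating, so some formula cuts it into two consistent parts. One part
    inherits the failure and becomes [psi]; the other witnesses that something is left over. *)
Lemma not_finitely_atomic_split n (phi : formula L n) :
  ~ finitely_atomic phi ->
  exists2 psi, timp psi phi &
    ~ finitely_atomic psi /\ consistent (FAnd phi (FNot psi)).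
Proof.
move=> nf.
have : ~ isolates phi by move/isolates_finitely_atomic.
move=> /existsNP[psi /not_orP[h1 h2]].
have cs1 : consistent (FAnd phi (FNot psi)).
  apply: contrapT => h; apply: h1 => M MT v phiv.
  by apply: contrapT => psiv; apply: h; exists M => //; exists v.
have cs2 : consistent (FAnd phi psi).
  apply: contrapT => h; apply: h2 => M MT v phiv psiv.
  by apply: h; exists M => //; exists v.
case: (pselect (finitely_atomic (FAnd phi psi))) => h; last first.
  exists (FAnd phi psi); first by move=> M MT v [].
  split=> //; case: cs1 => M MT [v [phiv psiv]].
  by exists M => //; exists v; split=> // -[].
exists (FAnd phi (FNot psi)); first by move=> M MT v [].
split; first by move=> h'; apply: nf; apply: finitely_atomic_split h h'.
case: cs2 => M MT [v [phiv psiv]].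
by exists M => //; exists v; split=> //= -[].
Qed.

(** Iterated splitting yields a decreasing sequence of formulas; the differences of consecutive
    terms are consistent and exclude each other. *)
Lemma infinite_antichain n : ~ finite_types n ->
  exists psi : nat -> formula L n, (forall k, consistent (psi k)) /\
    forall j k, (j < k)%N -> timp (psi j) (FNot (psi k)).
Proof.
rewrite finite_typesP => nf.
pose S := {phi : formula L n | ~ finitely_atomic phi}.
have step (s : S) : exists t : S, timp (sval t) (sval s) /\
    consistent (FAnd (sval s) (FNot (sval t))).
  have [psi h [nfp cs]] := not_finitely_atomic_split (proj2_sig s).
  by exists (exist (fun phi => ~ finitely_atomic phi) psi nfp).
have [f fP] := choice step.
pose s k := iter k f (exist (fun phi => ~ finitely_atomic phi) _ nf : S).
have sS k : timp (sval (s k.+1)) (sval (s k)) by case: (fP (s k)).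
have sle j k : (j <= k)%N -> timp (sval (s k)) (sval (s j)).
  move/subnK <-; elim: (k - j)%N => [//|d IH] M MT v h.
  exact/(IH M MT)/sS.
exists (fun k => FAnd (sval (s k)) (FNot (sval (s k.+1)))); split=> [k|j k jk].
  by case: (fP (s k)).
by move=> M MT v [_ h1] [h2 _]; apply: h1; apply: sle h2.
Qed.

Lemma consistent_realized n (phi : formula L n) : complete_theory T ->
  consistent phi -> forall M : structure L, models M T ->
  exists v : 'I_n -> M, sat phi v.
Proof.
move=> [_ Tc] [M MT phiM] N NT; apply/sat_exs.
case: (Tc (exs phi)) => h; first exact: h.
by case: (h M MT); apply/sat_exs.
Qed.

(** By completeness every member of the antichain is realized in [M], each by a different n-tuple,
    while a finite [M] has only finitely many. This makes categoricity applicable to the countable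
    models built by omitting types. *)
Lemma infinite_models n : complete_theory T -> ~ finite_types n ->
  forall M : structure L, models M T -> infinite_set [set: M].
Proof.
move=> Tc nf M MT.
move=> /finite_setP[m /card_set_bijP[f [fm finj _]]].
have [psi [cs inc]] := infinite_antichain nf.
have /choice[v vP] k : exists v : 'I_n -> M, sat (psi k) v.
  exact: consistent_realized.
have psi_neq j k : (j < k)%N -> v j <> v k.
  move=> jk e; have := inc j k jk M MT (v j) (vP j).
  by rewrite e => /(_ (vP k)).
have fltm x : (f x < m)%N by apply: (fm x).
pose g k := [ffun i : 'I_n => Ordinal (fltm (v k i))].
apply: infinite_nat; rewrite -[setT](preimage_setT g).
apply: finite_preimage; last exact: finite_finset.
move=> j k _ _ /ffunP e.
have vjk : v j = v k.
  apply/funext => i; apply: finj; rewrite ?inE//.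
  by have := e i; rewrite !ffunE => -[].
by case: (ltngtP j k) => // /psi_neq; rewrite vjk.
Qed.
End Types.

(** * Omitting types *)

Section Henkin.
Variables (L : signature) (T : theory L).
Variables (n : nat) (Sigma : set (formula L n)).
Variables (m : nat) (Omega : set (formula L m)).

(* Formulas whose free variables are among the Henkin constants, which are the
   natural numbers. *)
Definition inst : Type := {k : nat & (formula L k * ('I_k -> nat))%type}.

Definition Inst k (phi : formula L k) (s : 'I_k -> nat) : inst :=
  existT _ k (phi, s).

Definition isat (M : structure L) (v : nat -> M) (x : inst) : Prop :=
  sat (projT2 x).1 (v \o (projT2 x).2).

Definition inot (x : inst) : inst := Inst (FNot (projT2 x).1) (projT2 x).2.

(** The variables of [x] and [y] are kept apart even if the two mention the same constants; the
    assignment of constants does the identification. *)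
Definition iand (x y : inst) : inst :=
  Inst (FAnd (ren (projT2 x).1 (@lshift _ (projT1 y)))
             (ren (projT2 y).1 (@rshift (projT1 x) _)))
       (fun i => match fintype.split i with
                 | inl j => (projT2 x).2 j | inr j => (projT2 y).2 j end).

Lemma isat_and (M : structure L) (v : nat -> M) x y :
  isat v (iand x y) <-> isat v x /\ isat v y.
Proof.
rewrite /isat /= !sat_ren.
have -> : (v \o (fun i => match fintype.split i with
                 | inl j => (projT2 x).2 j | inr j => (projT2 y).2 j end))
  \o @lshift _ (projT1 y) = v \o (projT2 x).2.
  apply/funext => i /=; case: split_ordP => j /=; first by move/lshift_inj ->.
  by move/eqP; rewrite eq_lrshift.
have -> // : (v \o (fun i => match fintype.split i with
                 | inl j => (projT2 x).2 j | inr j => (projT2 y).2 j end))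
  \o @rshift (projT1 x) _ = v \o (projT2 y).2.
apply/funext => i /=; case: split_ordP => j /=; last by move/rshift_inj ->.
by move/eqP; rewrite eq_rlshift.
Qed.

Lemma inst_code : exists f : inst -> nat, injective f.
Proof.
exists (fun x => pickle (projT1 x, fcode (projT2 x).1,
  [seq (projT2 x).2 i | i <- enum 'I_(projT1 x)])).
move=> [k [phi s]] [k' [phi' s']] /= /(pcan_inj (@pickleK _)) [kk'].
case: _ / kk' phi' s' => phi' s' /fcode_inj <- /eq_in_map e.
rewrite (_ : s = s') //; apply/funext => i; apply: e.
by rewrite mem_enum.
Qed.

Definition sup_index k (s : 'I_k -> nat) : nat := (\sum_i s i).+1.

Lemma sup_indexP k (s : 'I_k -> nat) i : (s i < sup_index s)%N.
Proof. by rewrite ltnS (bigD1 i) //= leq_addr. Qed.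

(** All constants below a common bound [K] are quantified away, and equations tie the remaining
    variables to the constants in [s]. A condition that forces a whole type at [s] thereby becomes a
    formula isolating that type. *)
Lemma inst_image (x : inst) k (s : 'I_k -> nat) :
  exists chi : formula L k, forall (M : structure L) (w : 'I_k -> M),
    sat chi w <-> exists2 v : nat -> M, isat v x & v \o s = w.
Proof.
case: x => l [phi t].
pose K := (sup_index t + sup_index s)%N.
have tK i : (t i < K)%N by rewrite ltn_addr // sup_indexP.
have sK i : (s i < K)%N by rewrite ltn_addl // sup_indexP.
exists (@exK L k K (FAnd (ren phi (fun i => lshift k (Ordinal (tK i))))
  (fconj (fun i : 'I_k => FEq (TVar L (rshift K i))
                             (TVar L (lshift k (Ordinal (sK i)))))))).
move=> M w; rewrite sat_exK; split=> [[u uw]|[v vx vw]].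
  rewrite sat_and sat_fconj sat_ren => -[h1 h2].
  case: (carrier_inh M) => a.
  pose v i := if insub i is Some j then u (lshift k j) else a.
  have vE i (h : (i < K)%N) : v i = u (lshift k (Ordinal h)).
    by rewrite /v insubT.
  exists v; first rewrite /isat /=.
    suff -> : v \o t = u \o (fun i => lshift k (Ordinal (tK i))) by [].
    by apply/funext => i /=; rewrite vE.
  by apply/funext => i; rewrite -uw; have /= -> := h2 i; rewrite vE.
pose u (i : 'I_(K + k)) := match fintype.split i with inl j => v j | inr j => w j end.
have uL j : u (lshift k j) = v j.
  rewrite /u; case: split_ordP => i; first by move/lshift_inj ->.
  by move/eqP; rewrite eq_lrshift.
have uR j : u (rshift K j) = w j.
  rewrite /u; case: split_ordP => i; last by move/rshift_inj ->.
  by move/eqP; rewrite eq_rlshift.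
exists u; first by apply/funext => i /=.
rewrite sat_and sat_fconj sat_ren; split=> [|i /=].
  suff -> : u \o (fun i => lshift k (Ordinal (tK i))) = v \o t by [].
  by apply/funext => i /=; rewrite uL.
by rewrite uR uL -vw.
Qed.

Definition iimp (x y : inst) : Prop :=
  forall M : structure L, models M T -> forall v : nat -> M,
    isat v x -> isat v y.

(* Finite satisfiability together with [T] and with the partial type [Sigma] at
   the first [n] constants. *)
Definition icons (x : inst) : Prop :=
  forall (I : finType) (f : I -> formula L n), (forall i, Sigma (f i)) ->
  exists2 M : structure L, models M T &
    exists2 v : nat -> M, isat v x & forall i, sat (f i) (v \o val).

Lemma icons_split x y : icons x -> icons (iand x y) \/ icons (iand x (inot y)).
Proof.
move=> cx; apply: contrapT => /not_orP[].
move=> /existsNP[I /existsNP[f /not_implyP[fS h1]]].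
move=> /existsNP[J /existsNP[g /not_implyP[gS h2]]].
have [|M MT [v vx vfg]] := cx (I + J)%type
  (fun k => match k with inl i => f i | inr j => g j end); first by case.
case: (pselect (isat v y)) => vy.
  apply: h1; exists M => //; exists v; first by rewrite isat_and.
  by move=> i; apply: (vfg (inl i)).
apply: h2; exists M => //; exists v; first by rewrite isat_and.
by move=> i; apply: (vfg (inr i)).
Qed.

Lemma icons_witness x k (phi : formula L k.+1) (s : 'I_k -> nat) :
  icons x -> iimp x (Inst (FEx phi) s) ->
  exists c, icons (iand x (Inst phi (vcons c s))).
Proof.
(* A fresh constant: above those of [x] and of [s], and above the first [n], at which [Sigma] must
   stay realized. *)
move=> cx xphi; pose c := (n + (sup_index (projT2 x).2 + sup_index s))%N.
exists c => I f fS; have [M MT [v vx vf]] := cx I f fS.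
have [a va] := xphi M MT v vx.
pose v' i := if i == c then a else v i.
have v'E l (t : 'I_l -> nat) : (forall i, (t i < c)%N) -> v' \o t = v \o t.
  by move=> tc; apply/funext => i; rewrite /v' /= (ltn_eqF (tc i)).
exists M => //; exists v' => [|i].
  rewrite isat_and /isat v'E => [|i]; last first.
    apply: leq_trans (sup_indexP _ i) _.
    by rewrite /c addnCA leq_addr.
  split=> //=; rewrite vcons_comp v'E => [|i].
    by rewrite /v' eqxx.
  by apply: leq_trans (sup_indexP s i) _; rewrite /c addnA leq_addl.
rewrite v'E => [|j]; first exact: vf.
exact: leq_trans (ltn_ord j) (leq_addr _ _).
Qed.

Hypothesis Sigma_cons : icons (Inst (FTrue 0) vnil).
Hypothesis Omega_omit : forall x (s : 'I_m -> nat), icons x ->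
  exists2 psi, Omega psi & icons (iand x (inot (Inst psi s))).

Lemma iimp_and x y : iimp (iand x y) x /\ iimp (iand x y) y.
Proof. by split=> M MT v /isat_and[]. Qed.

Lemma iimp_trans x y z : iimp x y -> iimp y z -> iimp x z.
Proof. by move=> xy yz M MT v /(xy M MT) /(yz M MT). Qed.

Definition witness (y : inst) (c : nat) : inst :=
  if (projT2 y).1 is FEx psi then Inst psi (vcons c (projT2 y).2) else y.

Lemma icons_decide x y : icons x -> exists x', [/\ icons x', iimp x' x &
  iimp x' (inot y) \/ iimp x' y /\ exists c, iimp x' (witness y c)].
Proof.
move=> cx; case: (icons_split y cx) => cxy; last first.
  exists (iand x (inot y)).
  by have [? ?] := iimp_and x (inot y); split=> //; left.
have [xyx xyy] := iimp_and x y.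
suff [c cxyc] : exists c, icons (iand (iand x y) (witness y c)).
  exists (iand (iand x y) (witness y c)).
  have [h1 h2] := iimp_and (iand x y) (witness y c); split=> //.
    exact: iimp_trans h1 xyx.
  by right; split; [exact: iimp_trans h1 xyy|exists c].
have triv : icons (iand (iand x y) y).
  move=> I f fS; have [M MT [v vxy vf]] := cxy I f fS.
  exists M => //; exists v => //; rewrite isat_and; split=> //.
  exact: xyy vxy.
case: y {xyx} cxy xyy triv => k [[t u|r args|phi|phi psi|phi] s] cxy xyy triv;
  try by exists 0.
exact: icons_witness cxy xyy.
Qed.

Lemma icons_omit x (s : 'I_m -> nat) : icons x -> exists x',
  [/\ icons x', iimp x' x &
      exists2 psi, Omega psi & iimp x' (inot (Inst psi s))].
Proof.
move=> cx; have [psi Opsi cpsi] := Omega_omit s cx.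
exists (iand x (inot (Inst psi s))).
by have [? ?] := iimp_and x (inot (Inst psi s)); split=> //; exists psi.
Qed.

(** Stage [k] decides, with a witness where needed, the instance of code [k], and omits [Omega] at
    the tuple of constants of code [k]. Codes are injective, so there is at most one of each. *)
Lemma henkin_sequence : exists X : nat -> inst,
  [/\ forall k, icons (X k), forall j k, (j <= k)%N -> iimp (X k) (X j),
      forall y, exists k, iimp (X k) (inot y) \/
        iimp (X k) y /\ exists c, iimp (X k) (witness y c) &
      forall s : 'I_m -> nat, exists2 psi, Omega psi &
        exists k, iimp (X k) (inot (Inst psi s))].
Proof.
have [code code_inj] := inst_code.
pose scode (s : 'I_m -> nat) := pickle [seq s i | i <- enum 'I_m].
have scode_inj : injective scode.
  move=> s t /(pcan_inj (@pickleK _)) /eq_in_map e.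
  by apply/funext => i; apply: e; rewrite mem_enum.
pose S := {x : inst | icons x}.
have step (kx : nat * S) : exists x' : S, [/\ iimp (sval x') (sval kx.2),
    forall y, code y = kx.1 -> iimp (sval x') (inot y) \/
      iimp (sval x') y /\ exists c, iimp (sval x') (witness y c) &
    forall s, scode s = kx.1 ->
      exists2 psi, Omega psi & iimp (sval x') (inot (Inst psi s))].
  case: kx => k [x cx] /=.
  have [x1 [cx1 x1x x1P]] : exists x', [/\ icons x', iimp x' x &
    forall y, code y = k -> iimp x' (inot y) \/
      iimp x' y /\ exists c, iimp x' (witness y c)].
    case: (pselect (exists y, code y = k)) => [[y yk]|ny].
      have [x' [? ? ?]] := icons_decide y cx; exists x'; split=> // y'.
      by rewrite -yk => /code_inj ->.
    by exists x; split=> // y yk; case: ny; exists y.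
  have [x2 [cx2 x2x x2P]] : exists x', [/\ icons x', iimp x' x1 &
    forall s, scode s = k ->
      exists2 psi, Omega psi & iimp x' (inot (Inst psi s))].
    case: (pselect (exists s, scode s = k)) => [[s sk]|ns].
      have [x' [? ? ?]] := icons_omit s cx1; exists x'; split=> // s'.
      by rewrite -sk => /scode_inj ->.
    by exists x1; split=> // s sk; case: ns; exists s.
  exists (exist _ x2 cx2); split=> //=; first exact: iimp_trans x2x x1x.
  move=> y /x1P[h|[h [c hc]]]; first by left; apply: iimp_trans x2x h.
  by right; split; [exact: iimp_trans x2x h|exists c; exact: iimp_trans x2x hc].
have [f fP] := choice step.
pose X := fix X k := if k is k'.+1 then f (k', X k') else exist _ _ Sigma_cons.
exists (fun k => sval (X k)); split.
- by move=> k; apply: (proj2_sig (X k)).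
- move=> j k /subnK <-; elim: (k - j)%N => [//|d IH] /=.
  by case: (fP ((d + j)%N, X (d + j)%N)) => /= h _ _; apply: iimp_trans h IH.
- move=> y; exists (code y).+1.
  by case: (fP (code y, X (code y))) => /= _ /(_ _ erefl) h _.
- move=> s; case: (fP (scode s, X (scode s))) => /= _ _ /(_ _ erefl)[psi h1 h2].
  by exists psi => //; exists (scode s).+1.
Qed.
End Henkin.

(** * The term model of a Henkin sequence *)

Section TermModel.
Variables (L : signature) (T : theory L).
Variables (n : nat) (Sigma : set (formula L n)).
Variables (m : nat) (Omega : set (formula L m)).
Variable X : nat -> inst L.
Hypothesis X_cons : forall k, icons T Sigma (X k).
Hypothesis X_mono : forall j k, (j <= k)%N -> iimp T (X k) (X j).
Hypothesis X_dec : forall y, exists k, iimp T (X k) (inot y) \/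
  iimp T (X k) y /\ exists c, iimp T (X k) (witness y c).
Hypothesis X_omit : forall s : 'I_m -> nat, exists2 psi, Omega psi &
  exists k, iimp T (X k) (inot (Inst psi s)).

Definition holds (y : inst L) : Prop := exists k, iimp T (X k) y.

(** The sequence grows stronger, so finitely many instances are all forced at the largest of their
    stages. This replaces any calculus of deduction. *)
Lemma holds_fin (I : finType) (y : I -> inst L) z : (forall i, holds (y i)) ->
  (forall M : structure L, models M T -> forall v : nat -> M,
    (forall i, isat v (y i)) -> isat v z) -> holds z.
Proof.
move=> /choice[k kP] h; exists (\max_i k i)%N => M MT v Xv.
apply: h => // i; apply: (kP i) => //.
exact: X_mono (leq_bigmax i) _ MT _ Xv.
Qed.

Lemma holds_imp y z : (forall M : structure L, models M T ->
  forall v : nat -> M, isat v y -> isat v z) -> holds y -> holds z.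
Proof.
move=> h hy; apply: (@holds_fin unit (fun=> y)) => // M MT v /(_ tt).
exact: h.
Qed.

Lemma holds_imp2 x y z : (forall M : structure L, models M T ->
  forall v : nat -> M, isat v x -> isat v y -> isat v z) ->
  holds x -> holds y -> holds z.
Proof.
move=> h hx hy; apply: (@holds_fin bool (fun b => if b then x else y)).
  by case.
by move=> M MT v hv; apply: h => //; [apply: (hv true)|apply: (hv false)].
Qed.

Lemma holds_not y : holds (inot y) <-> ~ holds y.
Proof.
split=> [[j hj] [k hk]|ny].
  have [M MT [v vX _]] := X_cons (maxn j k) (I := void) (f := fun=> FTrue n)
    (fun i => match i with end).
  apply: (hj M MT v); first exact: X_mono (leq_maxl j k) _ MT _ vX.
  by apply: hk => //; apply: X_mono (leq_maxr j k) _ MT _ vX.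
have [k [h|[h _]]] := X_dec y; first by exists k.
by case: ny; exists k.
Qed.

Lemma holds_ex k (phi : formula L k.+1) (s : 'I_k -> nat) :
  holds (Inst (FEx phi) s) <-> exists c, holds (Inst phi (vcons c s)).
Proof.
split=> [h|[c]]; last first.
  by apply: holds_imp => M MT v h; exists (v c); rewrite -vcons_comp.
have [j [hn|[_ [c hc]]]] := X_dec (Inst (FEx phi) s).
  by have /holds_not/(_ h) : holds (inot (Inst (FEx phi) s)) by exists j.
by exists c, j.
Qed.

Definition eqi (i j : nat) : inst L :=
  Inst (FEq (TVar L ord0) (TVar L (lift ord0 ord0)))
    (vcons i (vcons j vnil)).

Lemma isat_eqi (M : structure L) (v : nat -> M) i j :
  isat v (eqi i j) <-> v i = v j.
Proof. by rewrite /isat /= vcons0 vconsS vcons0. Qed.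

Lemma eqi_refl i : holds (eqi i i).
Proof. by exists 0%N => M MT v _; apply/isat_eqi. Qed.

(** The choice depends only on the class of [i], so the quotient by forced equality is realized as a
    subtype of [nat], and countability of the term model is immediate. *)
Definition repr (i : nat) : nat := xget 0%N [set j | holds (eqi i j)].

Lemma reprP i : holds (eqi i (repr i)).
Proof.
apply: (@xgetPex _ _ [set j | holds (eqi i j)]).
by exists i; apply: eqi_refl.
Qed.

Lemma repr_eq i j : repr i = repr j <-> holds (eqi i j).
Proof.
split=> [e|hij].
  apply: holds_imp2 (reprP i) (reprP j) => M MT v.
  by rewrite !isat_eqi e => -> ->.
rewrite /repr; congr xget; apply/seteqP; split=> k /=.
  by apply: holds_imp2 hij => M MT v; rewrite !isat_eqi => ->.
by apply: holds_imp2 hij => M MT v; rewrite !isat_eqi => ->.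
Qed.

Lemma repr_idem i : repr (repr i) == repr i.
Proof. by apply/eqP/esym/repr_eq/reprP. Qed.

Definition tcarrier : Type := {i : nat | repr i == i}.
Definition cls (i : nat) : tcarrier := exist _ (repr i) (repr_idem i).

Lemma cls_eq i j : cls i = cls j <-> holds (eqi i j).
Proof.
rewrite -repr_eq; split=> [/(congr1 val) //|e].
exact/val_inj.
Qed.

Lemma cls_val (a : tcarrier) : cls (val a) = a.
Proof. by apply/val_inj => /=; apply/eqP/(valP a). Qed.

Definition app_inst (f : fsym L) (s : 'I_(farity f) -> nat) (c : nat) : inst L :=
  Inst (FEq (TApp (fun i => TVar L (lift ord0 i))) (TVar L ord0)) (vcons c s).

Lemma isat_app (M : structure L) (v : nat -> M) f (s : 'I_(farity f) -> nat) c :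
  isat v (app_inst s c) <-> finterp M f (v \o s) = v c.
Proof.
rewrite /isat /= vcons0.
suff -> : (fun i => v (vcons c s (lift ord0 i))) = v \o s by [].
by apply/funext => i; rewrite vconsS.
Qed.

Definition tfinterp (f : fsym L) (w : 'I_(farity f) -> tcarrier) : tcarrier :=
  cls (xget 0%N [set c | holds (app_inst (val \o w) c)]).

Definition trinterp (r : rsym L) (w : 'I_(rarity r) -> tcarrier) : Prop :=
  holds (Inst (FRel (fun i => TVar L i)) (val \o w)).

Definition term_model : structure L :=
  @Structure L tcarrier (inhabits (cls 0)) tfinterp trinterp.

Lemma app_total f (s : 'I_(farity f) -> nat) : exists c, holds (app_inst s c).
Proof.
apply/holds_ex; exists 0%N => M MT v _.
exists (finterp M f (v \o s)) => /=; rewrite vcons0; congr finterp.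
by apply/funext => i; rewrite vconsS.
Qed.

Lemma tfinterp_eq f (s : 'I_(farity f) -> nat) c : holds (app_inst s c) ->
  tfinterp (cls \o s) = cls c.
Proof.
move=> hc; apply/cls_eq.
have := xgetPex 0%N (app_total (val \o (cls \o s))).
set d := xget _ _ => hd.
pose y (i : option (option 'I_(farity f))) := match i with
  | None => app_inst s c | Some None => app_inst (val \o (cls \o s)) d
  | Some (Some i) => eqi (s i) (repr (s i)) end.
apply: (@holds_fin _ y) => [[[i|]|] //=|M MT v hv]; first exact: reprP.
have := hv None; have := hv (Some None); rewrite /= !isat_app isat_eqi.
move=> <- <-; congr finterp; apply/funext => i /=.
by have /isat_eqi <- := hv (Some (Some i)).
Qed.

Definition term_inst k (t : term L k) (s : 'I_k -> nat) c : inst L :=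
  Inst (FEq (tren (lift ord0) t) (TVar L ord0)) (vcons c s).

Lemma isat_term (M : structure L) (v : nat -> M) k (t : term L k) s c :
  isat v (term_inst t s c) <-> teval (v \o s) t = v c.
Proof. by rewrite /isat /= vcons_comp teval_tren vcons_lift vcons0. Qed.

Lemma teval_term_model k (t : term L k) (s : 'I_k -> nat) :
  exists2 c, holds (term_inst t s c) &
    teval (M := term_model) (cls \o s) t = cls c.
Proof.
elim: t => [i|f args IH] /=.
  by exists (s i) => //; exists 0%N => M MT v _; apply/isat_term.
have /choice[c cP] i : exists c, holds (term_inst (args i) s c) /\
    teval (M := term_model) (cls \o s) (args i) = cls c.
  by have [c ? ?] := IH i; exists c.
have [d hd] := app_total c.
exists d; last first.
  rewrite (_ : (fun i => _) = cls \o c); first exact: tfinterp_eq.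
  by apply/funext => i; case: (cP i).
apply: (@holds_fin _ (fun i : option 'I_(farity f) =>
  if i is Some i then term_inst (args i) s (c i) else app_inst c d)).
  by case=> [i|//]; case: (cP i).
move=> M MT v hv; rewrite isat_term /=.
have := hv None; rewrite /= isat_app => <-; congr finterp; apply/funext => i.
exact/isat_term/(hv (Some i)).
Qed.

(** The truth lemma; negation rests on every instance being decided, the quantifier on the Henkin
    witnesses. *)
Lemma sat_term_model k (phi : formula L k) (s : 'I_k -> nat) :
  sat (M := term_model) phi (cls \o s) <-> holds (Inst phi s).
Proof.
elim: phi s => {k} [k t u|k r args|k phi IH|k phi IH psi IH'|k phi IH] s.
- have [c hc] := teval_term_model t s; have [d hd] := teval_term_model u s.
  move=> /= -> ->; rewrite cls_eq; split=> h.
    apply: (@holds_fin _ (fun i : option bool => match i with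
      | None => eqi c d | Some true => term_inst t s c
      | Some false => term_inst u s d end)) => [[[]|]//|M MT v hv].
    have := hv None; have := hv (Some true); have := hv (Some false).
    by rewrite /= !isat_term isat_eqi /isat /= => -> -> ->.
  apply: (@holds_fin _ (fun i : option bool => match i with
    | None => Inst (FEq t u) s | Some true => term_inst t s c
    | Some false => term_inst u s d end)) => [[[]|]//|M MT v hv].
  have := hv None; have := hv (Some true); have := hv (Some false).
  by rewrite /= !isat_term isat_eqi /isat /= => <- <- ->.
- have /choice[c cP] i : exists c, holds (term_inst (args i) s c) /\
      teval (M := term_model) (cls \o s) (args i) = cls c.
    by have [c ? ?] := teval_term_model (args i) s; exists c.
  rewrite /= (_ : (fun i => _) = cls \o c); last first.
    by apply/funext => i; case: (cP i).
  pose w z (i : option ('I_(rarity r) + 'I_(rarity r))) := match i with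
    | None => z | Some (inl i) => term_inst (args i) s (c i)
    | Some (inr i) => eqi (c i) (repr (c i)) end.
  have wP z : holds z -> forall i, holds (w z i).
    by move=> hz [[i|i]|] //; [case: (cP i)|apply: reprP].
  have wE (M : structure L) (v : nat -> M) z : (forall i, isat v (w z i)) ->
      (fun i => teval (v \o s) (args i)) = v \o (val \o (cls \o c)).
    move=> hv; apply/funext => i /=.
    have /isat_eqi <- := hv (Some (inr i)).
    by have /isat_term := hv (Some (inl i)).
  split=> h; apply: (holds_fin (wP _ h)) => M MT v hv; have e := wE M v _ hv.
    by have := hv None; rewrite /isat /= e.
  by have := hv None; rewrite /isat /= e.
- by rewrite /= IH -holds_not.
- rewrite /= IH IH'; split=> [[h h']|h].
    by apply: holds_imp2 h h' => M MT v.
  by split; apply: holds_imp h => M MT v [].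
- rewrite holds_ex /=; split=> [[a h]|[c h]].
    by exists (val a); rewrite -IH vcons_comp cls_val.
  by exists (cls c); rewrite -vcons_comp IH.
Qed.

Lemma term_modelP : [/\ models term_model T,
  exists w : 'I_n -> term_model, forall phi, Sigma phi -> sat phi w,
  forall w : 'I_m -> term_model, exists2 psi, Omega psi & ~ sat psi w &
  countable [set: term_model]].
Proof.
split.
- move=> phi Tphi; rewrite (eq_ord0_fun vnil (cls \o vnil)) sat_term_model.
  by exists 0%N => M MT v _; rewrite /isat (eq_ord0_fun (v \o _) vnil); apply: MT.
- exists (cls \o val) => phi Sphi; rewrite sat_term_model; apply: contrapT.
  move=> /holds_not[k hk].
  have [M MT [v vX /(_ tt)]] := X_cons k (fun _ : unit => Sphi).
  exact: hk MT v vX.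
- move=> w; have [psi Opsi [k hk]] := X_omit (val \o w).
  exists psi => //; have -> : w = cls \o (val \o w).
    by apply/funext => i /=; rewrite cls_val.
  by rewrite sat_term_model -holds_not; exists k.
- by apply/countable_injP; exists val => a b _ _ /val_inj.
Qed.

End TermModel.

(* The second hypothesis says that no consistent formula isolates [Omega]: one
   can always refute some member of [Omega] consistently. *)
Lemma omitting_types L (T : theory L) n (Sigma : set (formula L n)) m
    (Omega : set (formula L m)) :
  icons T Sigma (Inst (FTrue 0) vnil) ->
  (forall x (s : 'I_m -> nat), icons T Sigma x ->
    exists2 psi, Omega psi & icons T Sigma (iand x (inot (Inst psi s)))) ->
  exists M : structure L, [/\ models M T,
    exists w : 'I_n -> M, forall phi, Sigma phi -> sat phi w,
    forall w : 'I_m -> M, exists2 psi, Omega psi & ~ sat psi w &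
    countable [set: M]].
Proof.
move=> Sc Oo; have [X [X1 X2 X3 X4]] := henkin_sequence Sc Oo.
exists (term_model X2).
exact: (term_modelP X1 X2 X3 X4).
Qed.

Lemma sat_isomorphism L (M N : structure L) (h : M -> N) : bijective h ->
  (forall f v, h (finterp M f v) = finterp N f (h \o v)) ->
  (forall r v, rinterp M r v <-> rinterp N r (h \o v)) ->
  forall n (phi : formula L n) (v : 'I_n -> M),
    sat phi v <-> sat phi (h \o v).
Proof.
move=> hb hf hr.
have ht n (t : term L n) (v : 'I_n -> M) : h (teval v t) = teval (h \o v) t.
  elim: t => [//|f args IH] /=; rewrite hf; congr finterp.
  by apply/funext => i /=.
move=> n; elim=> {n} [n s t|n r args|n phi IH|n phi IH psi IH'|n phi IH] v /=.
- by rewrite -!ht; split=> [->//|]; apply: bij_inj.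
- rewrite hr (_ : h \o _ = (fun i => teval (h \o v) (args i))) //.
  by apply/funext => i /=.
- by rewrite IH.
- by rewrite IH IH'.
- split=> [[a /IH]|[b]]; first by rewrite vcons_comp; exists (h a).
  have [g _ gK] := hb; rewrite -[b]gK -vcons_comp => /IH.
  by exists (g b).
Qed.

Lemma categorical_finite_types L (T : theory L) : complete_theory T ->
  aleph0_categorical T -> forall n, finite_types T n.
Proof.
(* One countable model realizes the negations of all isolating formulas by a
   tuple [w]; the type of [w] is then not isolated, so another countable model
   omits it. *)
move=> Tc cat n; apply: contrapT => nf.
have [M0 MT0] := Tc.1.
pose Sigma : set (formula L n) :=
  [set phi | exists2 theta, isolates T theta & phi = FNot theta].
(* Nothing is to be omitted here, so [Omega] is taken to be the false sentence. *)
have [M1 [MT1 [w wP] _ cM1]] : exists M : structure L, [/\ models M T,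
    exists w : 'I_n -> M, forall phi, Sigma phi -> sat phi w,
    forall w : 'I_0 -> M, exists2 psi, [set FFalse 0] psi & ~ sat psi w &
    countable [set: M]].
  have c0 (x : inst L) (s : 'I_0 -> nat) : icons T Sigma x ->
      exists2 psi, [set FFalse 0] psi & icons T Sigma (iand x (inot (Inst psi s))).
    move=> cx; exists (FFalse 0) => // I f fS.
    have [M MT [v vx vf]] := cx I f fS; exists M => //; exists v => //.
    by rewrite isat_and; split=> //; rewrite /isat /=; apply; apply: sat_true.
  (* If finitely many members of [Sigma] could not be realized together, the isolating formulas they
     negate would cover all n-tuples. *)
  apply: omitting_types c0 => I f fS; apply: contrapT => h.
  apply: nf; apply/finite_typesP; exists I.
  have /choice[g gP] i : exists theta, isolates T theta /\ f i = FNot theta.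
    by have [theta ? ?] := fS i; exists theta.
  exists g; split=> [i|M MT v _]; first by case: (gP i).
  apply: contrapT => /forallNP ng; apply: h; exists M => //.
  case: (carrier_inh M) => a.
  pose v' k := if insub k is Some i then v i else a.
  exists v'; first exact: sat_true.
  move=> i; case: (gP i) => _ -> /=.
  rewrite (_ : v' \o val = v) //; apply/funext => j.
  by rewrite /v' /= valK.
have [M2 [MT2 _ M2P cM2]] : exists M : structure L, [/\ models M T,
    exists w : 'I_0 -> M, forall phi, set0 phi -> sat phi w,
    forall w' : 'I_n -> M, exists2 psi, [set psi | sat psi w] psi & ~ sat psi w' &
    countable [set: M]].
  apply: omitting_types => [I f f0|x s cx].
    have [M MT] := Tc.1; exists M => //; case: (carrier_inh M) => a.
    by exists (fun=> a) => [|i]; [apply: sat_true|case: (f0 i)].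
  (* Otherwise [x] forces the whole type of [w] at the constants [s]. Its projection [chi] then
     isolates this type, so [w] satisfies [FNot chi], and [chi] implies its own negation. *)
  apply: contrapT => /forall2NP h.
  have xp psi : sat psi w -> iimp T x (Inst psi s).
    move=> wpsi M MT v vx; apply: contrapT => npsi.
    case: (h psi) => //; apply => I f f0; exists M => //.
    by exists v => [|i]; [rewrite isat_and; split|case: (f0 i)].
  have [chi chiP] := inst_image x s.
  have chip psi : sat psi w -> timp T chi psi.
    by move=> wpsi M MT u /chiP[v vx <-]; apply: xp vx.
  have : sat (FNot chi) w.
    apply: wP; exists chi => // psi.
    case: (pselect (sat psi w)) => hpsi; first by left; apply: chip.
    by right; apply: chip.
  move=> /chip hchi.
  have [M MT [v vx _]] := cx void (fun=> FTrue 0) (fun i => match i with end).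
  have vchi : sat chi (v \o s) by apply/chiP; exists v.
  exact: (hchi M MT (v \o s) vchi vchi).
have iM (M : structure L) : models M T -> countable [set: M] ->
    ([set: M] #= [set: nat])%card.
  by move=> MT cM; apply: eq_card_nat cM _; apply: (infinite_models Tc nf MT).
have [h hb [hf hr]] := cat M1 M2 MT1 MT2 (iM M1 MT1 cM1) (iM M2 MT2 cM2).
have [psi wpsi] := M2P (h \o w).
by rewrite -(sat_isomorphism hb hf hr).
Qed.

(** * Back and forth *)

Section BackAndForth.
Variables (L : signature) (T : theory L).
Hypothesis ft : forall n, finite_types T n.

Definition same_type (M N : structure L) n (v : 'I_n -> M) (w : 'I_n -> N) :=
  forall phi : formula L n, sat phi v <-> sat phi w.

Lemma same_type_sym (M N : structure L) n (v : 'I_n -> M) (w : 'I_n -> N) :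
  same_type v w -> same_type w v.
Proof. by move=> vw phi; rewrite vw. Qed.

(** If [theta i] isolates the type of [a] together with [v], then [FEx (theta i)] passes from [v] to
    [w], and any witness realizes the same type. *)
Lemma forth (M N : structure L) : models M T -> models N T ->
  forall n (v : 'I_n -> M) (w : 'I_n -> N) (a : M), same_type v w ->
  exists b : N, same_type (vcons a v) (vcons b w).
Proof.
move=> MT NT n v w a vw; have [I [theta [iso cov _]]] := ft n.+1.
have [i vi] := cov M MT (vcons a v).
have /vw[b wi] : sat (FEx (theta i)) v by exists a.
exists b => phi; case: (iso i phi) => h.
  by split=> _; [apply: h wi|apply: h vi].
by have := h M MT _ vi; have := h N NT _ wi; split.
Qed.

Variables (M N : structure L).
Hypotheses (MT : models M T) (NT : models N T).

Definition pstate : Type := {n : nat & (('I_n -> M) * ('I_n -> N))%type}.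

Definition link (s : pstate) (a : M) (b : N) : Prop :=
  exists i, (projT2 s).1 i = a /\ (projT2 s).2 i = b.

Definition pgood (s : pstate) : Prop := same_type (projT2 s).1 (projT2 s).2.

Lemma back_and_forth_step (s : pstate) (a : M) (b : N) : pgood s ->
  exists s', [/\ pgood s', forall x y, link s x y -> link s' x y,
    exists y, link s' a y & exists x, link s' x b].
Proof.
case: s => n [v w] good.
have [b1 good1] := forth MT NT a good.
have [a1 /same_type_sym good2] := forth NT MT b (same_type_sym good1).
exists (existT _ n.+2 (vcons a1 (vcons a v), vcons b (vcons b1 w))).
split=> //.
- move=> x y [i [vx wy]]; exists (lift ord0 (lift ord0 i)).
  by rewrite /= !vconsS.
- by exists b1, (lift ord0 ord0); rewrite /= !vconsS !vcons0.
- by exists a1, ord0; rewrite /= !vcons0.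
Qed.

Lemma back_and_forth (eM : nat -> M) (eN : nat -> N) : complete_theory T ->
  (forall a, exists k, eM k = a) -> (forall b, exists k, eN k = b) ->
  isomorphic M N.
Proof.
move=> [_ Tc] eMP eNP.
have good0 : pgood (existT _ 0 (vnil, vnil)).
  by move=> phi; case: (Tc phi) => h; have := h M MT; have := h N NT.
pose S := {s | pgood s}.
have step (ks : nat * S) : exists s' : S,
    [/\ forall x y, link (sval ks.2) x y -> link (sval s') x y,
     exists y, link (sval s') (eM ks.1) y & exists x, link (sval s') x (eN ks.1)].
  case: ks => k [s gs]; have [s' [gs' ? ? ?]] := back_and_forth_step (eM k) (eN k) gs.
  by exists (exist _ s' gs').
have [f fP] := choice step.
pose s := fix s k := if k is k'.+1 then f (k', s k') else (exist _ _ good0 : S).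
have mono j k x y : (j <= k)%N -> link (sval (s j)) x y -> link (sval (s k)) x y.
  move/subnK <-; elim: (k - j)%N => [//|d IH] /= /IH.
  by case: (fP ((d + j)%N, s (d + j)%N)) => h _ _; apply: h.
pose rel a b := exists k, link (sval (s k)) a b.
have relMN a : exists b, rel a b.
  have [k <-] := eMP a; case: (fP (k, s k)) => _ [b h] _.
  by exists b, k.+1.
have relNM b : exists a, rel a b.
  have [k <-] := eNP b; case: (fP (k, s k)) => _ _ [a h].
  by exists a, k.+1.
(* Finitely many related pairs are linked at a common stage, where they have the same type. Applied
   to two pairs it gives a bijection, and to the arguments of a symbol it gives a homomorphism. *)
have rel_fin (I : finType) (x : I -> M) (y : I -> N) :
    (forall i, rel (x i) (y i)) -> exists n (v : 'I_n -> M) (w : 'I_n -> N),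
      same_type v w /\ exists u : I -> 'I_n, v \o u = x /\ w \o u = y.
  move=> /choice[k kP]; pose K := (\max_i k i)%N.
  have /choice[u uP] i : exists j, (projT2 (sval (s K))).1 j = x i /\
      (projT2 (sval (s K))).2 j = y i.
    exact: mono (leq_bigmax i) (kP i).
  exists _, (projT2 (sval (s K))).1, (projT2 (sval (s K))).2.
  split; first exact: (proj2_sig (s K)).
  by exists u; split; apply/funext => i /=; case: (uP i).
have rel_eq a a' b b' : rel a b -> rel a' b' -> a = a' <-> b = b'.
  move=> ab ab'.
  have [|n [v [w [vw [u [vu wu]]]]]] := @rel_fin bool
    (fun i => if i then a else a') (fun i => if i then b else b').
    by case.
  have := vw (FEq (TVar L (u true)) (TVar L (u false))).
  by move/funeqP: vu => vu; move/funeqP: wu => wu; move: (vu true) (vu false)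
    (wu true) (wu false) => /= -> -> -> ->.
have [h hP] := choice relMN; have [g gP] := choice relNM.
exists h; first exists g.
- by move=> a; apply/(rel_eq _ _ _ _ (gP (h a)) (hP a)).
- by move=> b; apply/(rel_eq _ _ _ _ (hP (g b)) (gP b)).
have rel_opt (I : finType) (x : I -> M) a : exists n (v : 'I_n -> M) (w : 'I_n -> N),
      same_type v w /\ exists (u : I -> 'I_n) j,
      [/\ v \o u = x, w \o u = h \o x, v j = a & w j = h a].
  have [|n [v [w [vw [u [vu wu]]]]]] := @rel_fin (option I)
    (fun i => if i is Some i then x i else a)
    (fun i => if i is Some i then h (x i) else h a).
    by case=> *; apply: hP.
  exists n, v, w; split=> //; exists (u \o Some), (u None).
  move/funeqP: vu => vu; move/funeqP: wu => wu.
  split; [apply/funext => i| apply/funext => i| |].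
  - exact: (vu (Some i)).
  - exact: (wu (Some i)).
  - exact: (vu None).
  - exact: (wu None).
split=> [F x|r x].
  have [n [v [w [vw [u [j [vu wu vj wj]]]]]]] := rel_opt _ x (finterp M F x).
  have [+ _] := vw (FEq (TApp (fun i => TVar L (u i))) (TVar L j)).
  rewrite /= vj wj (_ : (fun i => v (u i)) = x) //.
  by rewrite (_ : (fun i => w (u i)) = h \o x) // => /(_ erefl) ->.
have [a] := carrier_inh M; have [n [v [w [vw [u [j [vu wu vj wj]]]]]]] := rel_opt _ x a.
have := vw (FRel (fun i => TVar L (u i))).
rewrite /= (_ : (fun i => v (u i)) = x) //.
by rewrite (_ : (fun i => w (u i)) = h \o x).
Qed.
End BackAndForth.

Lemma finite_types_categorical L (T : theory L) : complete_theory T ->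
  (forall n, finite_types T n) -> aleph0_categorical T.
Proof.
move=> Tc ft M N MT NT.
have enum (M' : structure L) : ([set: M'] #= [set: nat])%card ->
    exists e : nat -> M', forall a, exists k, e k = a.
  move=> /card_set_bijP[f [_ finj fsurj]].
  have /choice[e eP] k : exists x, f x = k.
    by have [x _ <-] := fsurj k I; exists x.
  exists e => a; exists (f a); apply: finj; rewrite ?inE//.
move=> /enum[eM eMP] /enum[eN eNP].
exact: back_and_forth eMP eNP.
Qed.

(** * Transfer from nice randomizations *)

Local Open Scope ring_scope.

(** * Suprema and infima of families with values in the unit interval *)

Section UnitRange.
Variables (R : realType) (X : Type) (f : X -> R).
Hypothesis f01 : forall x, 0 <= f x <= 1.

Lemma range_sup_ge x : f x <= sup (range f).
Proof.
apply: sup_upper_bound; last by exists x.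
split; first by exists (f x), x.
by exists 1 => _ [y _ <-]; case/andP: (f01 y).
Qed.

Lemma range_inf_le x : inf (range f) <= f x.
Proof.
apply: ge_inf; last by exists x.
by exists 0 => _ [y _ <-]; case/andP: (f01 y).
Qed.

Lemma range_sup01 (x : X) : 0 <= sup (range f) <= 1.
Proof.
case/andP: (f01 x) => x0 _; rewrite (le_trans x0 (range_sup_ge x)) /=.
apply: ge_sup; first by exists (f x), x.
by move=> _ [y _ <-]; case/andP: (f01 y).
Qed.

Lemma range_inf01 (x : X) : 0 <= inf (range f) <= 1.
Proof.
case/andP: (f01 x) => _ x1; rewrite (le_trans (range_inf_le x) x1) andbT.
apply: lb_le_inf; first by exists (f x), x.
by move=> _ [y _ <-]; case/andP: (f01 y).
Qed.

Lemma range_sup_eq0 (x : X) : sup (range f) = 0 <-> forall y, f y = 0.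
Proof.
split=> [e y|f0].
  apply/eqP; rewrite eq_le -{1}e range_sup_ge /=.
  by case/andP: (f01 y).
apply/eqP; rewrite eq_le; case/andP: (range_sup01 x) => -> _; rewrite andbT.
apply: ge_sup; first by exists (f x), x.
by move=> _ [y _ <-]; rewrite f0.
Qed.

Lemma range_inf_eq0 (x : X) : inf (range f) = 0 <->
  forall e, 0 < e -> exists y, f y < e.
Proof.
split=> [e0 e e_gt0|h].
  have [|_ [y _ <-] fy] := @inf_adherent _ (range f) e e_gt0.
    split; first by exists (f x), x.
    by exists 0 => _ [y _ <-]; case/andP: (f01 y).
  by exists y; rewrite e0 add0r in fy.
apply/eqP; rewrite eq_le; case/andP: (range_inf01 x) => -> _; rewrite andbT.
apply/ler_addgt0Pl => e /h[y /ltW fy]; rewrite addr0.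
exact: le_trans (range_inf_le y) fy.
Qed.

End UnitRange.

Section Closure.
Variables (R : realType) (L : signature).

Lemma ceval01 (P : prestructure R L) p q (Phi : cformula R L p q) a b :
  0 <= ceval (P := P) Phi a b <= 1.
Proof.
case: (sortK_inh P) => k0.
elim: Phi a b => {p q} [p q s|p q x y|p q s t|p q n u args IH|p q Phi IH
  |p q Phi IH|p q Phi IH|p q Phi IH] a b /=.
- exact: mu01.
- by case: (dK_pseudo P).
- by case: (dB_pseudo P).
- by apply: conn_range => i; rewrite mxE.
- exact: (@range_sup01 _ _ (fun x => ceval Phi (vcons x a) b) _ k0).
- exact: (@range_inf01 _ _ (fun x => ceval Phi (vcons x a) b) _ k0).
- exact: (@range_sup01 _ _ (fun x => ceval Phi a (vcons x b)) _ (btop P)).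
- exact: (@range_inf01 _ _ (fun x => ceval Phi a (vcons x b)) _ (btop P)).
Qed.

Lemma ceval_supK_eq0 (P : prestructure R L) p q (Phi : cformula R L p.+1 q) a b :
  ceval (P := P) (CSupK Phi) a b = 0 <->
  forall x, ceval Phi (vcons x a) b = 0.
Proof.
case: (sortK_inh P) => k0.
by apply: (range_sup_eq0 _ k0) => x; apply: ceval01.
Qed.

Lemma ceval_infK_eq0 (P : prestructure R L) p q (Phi : cformula R L p.+1 q) a b :
  ceval (P := P) (CInfK Phi) a b = 0 <->
  forall e, 0 < e -> exists x, ceval Phi (vcons x a) b < e.
Proof.
case: (sortK_inh P) => k0.
by apply: (range_inf_eq0 _ k0) => x; apply: ceval01.
Qed.

Lemma ceval_supB_eq0 (P : prestructure R L) p q (Phi : cformula R L p q.+1) a b :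
  ceval (P := P) (CSupB Phi) a b = 0 <->
  forall x, ceval Phi a (vcons x b) = 0.
Proof. by apply: (range_sup_eq0 _ (btop P)) => x; apply: ceval01. Qed.

Lemma ceval_infB_eq0 (P : prestructure R L) p q (Phi : cformula R L p q.+1) a b :
  ceval (P := P) (CInfB Phi) a b = 0 <->
  forall e, 0 < e -> exists x, ceval Phi a (vcons x b) < e.
Proof. by apply: (range_inf_eq0 _ (btop P)) => x; apply: ceval01. Qed.

Fixpoint closeK p q : cformula R L p q -> cformula R L 0 q :=
  match p with 0 => id | _.+1 => fun Phi => closeK (CSupK Phi) end.

Fixpoint closeB q : cformula R L 0 q -> cformula R L 0 0 :=
  match q with 0 => id | _.+1 => fun Phi => closeB (CSupB Phi) end.

Lemma closeK_eq0 (P : prestructure R L) p q (Phi : cformula R L p q) b :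
  ceval (P := P) (closeK Phi) vnil b = 0 <-> forall a, ceval Phi a b = 0.
Proof.
elim: p Phi => [|p IH] Phi.
  by split=> [h a|]; rewrite ?(eq_ord0_fun a vnil).
rewrite IH; split=> h a; last exact/ceval_supK_eq0.
by have /ceval_supK_eq0/(_ (a ord0)) := h (a \o lift ord0); rewrite vcons_eta.
Qed.

Lemma closeB_eq0 (P : prestructure R L) q (Phi : cformula R L 0 q) :
  ceval (P := P) (closeB Phi) vnil vnil = 0 <->
  forall b, ceval (P := P) Phi vnil b = 0.
Proof.
elim: q Phi => [|q IH] Phi.
  by split=> [h b|]; rewrite ?(eq_ord0_fun b vnil).
rewrite IH; split=> h b; last exact/ceval_supB_eq0.
by have /ceval_supB_eq0/(_ (b ord0)) := h (b \o lift ord0); rewrite vcons_eta.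
Qed.

Definition nice_true (T : theory L) (A : prestructure R L -> Prop) : Prop :=
  forall (M : structure L) (P : prestructure R L),
    models M T -> nice_randomization M P -> A P.

Lemma transfer (T : theory L) (N : prestructure R L) p q
    (Phi : cformula R L p q) : models_TR T N ->
  nice_true T (fun P => forall a b, ceval (P := P) Phi a b = 0) ->
  forall a b, ceval (P := N) Phi a b = 0.
Proof.
move=> [_ NT] h a b.
suff /NT : TR T (closeB (closeK Phi)).
  by move/closeB_eq0/(_ b)/closeK_eq0; apply.
move=> M P MT nP; apply/closeB_eq0 => b'; apply/closeK_eq0 => a'.
exact: (h M P).
Qed.

(** The infimum is 0 in [N] as well, but it need not be attained there, hence the error [e]. *)
Lemma transfer_exK (T : theory L) (N : prestructure R L) p q
    (Phi : cformula R L p.+1 q) : models_TR T N ->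
  nice_true T (fun P => forall a b, exists x,
    ceval (P := P) Phi (vcons x a) b = 0) ->
  forall a b e, 0 < e -> exists x, ceval (P := N) Phi (vcons x a) b < e.
Proof.
move=> NT h a b; apply/ceval_infK_eq0.
apply: (transfer (Phi := CInfK Phi) NT) => M P MT nP {}a {}b.
apply/ceval_infK_eq0 => e e0.
by have [x hx] := h M P MT nP a b; exists x; rewrite hx.
Qed.

Lemma transfer_exB (T : theory L) (N : prestructure R L) p q
    (Phi : cformula R L p q.+1) : models_TR T N ->
  nice_true T (fun P => forall a b, exists x,
    ceval (P := P) Phi a (vcons x b) = 0) ->
  forall a b e, 0 < e -> exists x, ceval (P := N) Phi a (vcons x b) < e.
Proof.
move=> NT h a b; apply/ceval_infB_eq0.
apply: (transfer (Phi := CInfB Phi) NT) => M P MT nP {}a {}b.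
apply/ceval_infB_eq0 => e e0.
by have [x hx] := h M P MT nP a b; exists x; rewrite hx.
Qed.

(** Connectives must stay in the unit interval, so a linear equation is expressed by the vanishing
    of a truncated absolute value. *)
Definition affine n (c0 : R) (c : 'I_n -> R) (v : 'rV[R]_n) : R :=
  Num.min 1 `|c0 + \sum_i c i * v ord0 i|.

Lemma affine01 n c0 (c : 'I_n -> R) v : cube v -> 0 <= affine c0 c v <= 1.
Proof. by move=> _; rewrite le_min ler01 normr_ge0 ge_min lexx. Qed.

Lemma affine_continuous n c0 (c : 'I_n -> R) :
  {within @cube R n, continuous (affine c0 c)}.
Proof.
apply: continuous_subspaceT => v.
have := @continuous_min R 'rV[R]_n (fun=> 1) (fun v => `|c0 + \sum_i c i * v ord0 i|) v.
apply; first by apply: (@cst_continuous 'rV[R]_n R).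
suff h : (fun w : 'rV[R]_n => c0 + \sum_i c i * w ord0 i) @ v -->
    (c0 + \sum_i c i * v ord0 i) by exact: cvg_norm h.
have FF : Filter (nbhs v) by exact: nbhs_filter.
have : forall i, (fun w : 'rV[R]_n => w ord0 i) @ v --> v ord0 i.
  by move=> i; apply: coord_continuous.
move: (nbhs v) FF => F FF hF.
apply: cvgD; first exact: cvg_cst.
apply: cvg_big => [|i _]; first exact: add_continuous.
by apply: cvgM; [exact: cvg_cst|exact: hF].
Qed.

Definition caffine n c0 (c : 'I_n -> R) : connective R n :=
  Connective (@affine01 n c0 c) (@affine_continuous n c0 c).

Lemma affine_eq0 n c0 (c : 'I_n -> R) v :
  affine c0 c v = 0 <-> c0 + \sum_i c i * v ord0 i = 0.
Proof.
rewrite /affine; split=> [|->]; last by rewrite normr0 (min_idPr ler01).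
by rewrite /Num.min; case: ifP => _ /eqP; rewrite ?oner_eq0 // normr_eq0 => /eqP.
Qed.

Lemma ceval_affine_eq0 (P : prestructure R L) p q n c0 (c : 'I_n -> R)
    (Phi : 'I_n -> cformula R L p q) a b :
  ceval (P := P) (CConn (caffine c0 c) Phi) a b = 0 <->
  c0 + \sum_i c i * ceval (P := P) (Phi i) a b = 0.
Proof.
rewrite /= affine_eq0 (eq_bigr (fun i => c i * ceval (Phi i) a b)) // => i _.
by rewrite mxE.
Qed.

Lemma transfer_affine (T : theory L) (N : prestructure R L) p q n c0
    (c : 'I_n -> R) (Phi : 'I_n -> cformula R L p q) : models_TR T N ->
  nice_true T (fun P => forall a b,
    c0 + \sum_i c i * ceval (P := P) (Phi i) a b = 0) ->
  forall a b, c0 + \sum_i c i * ceval (P := N) (Phi i) a b = 0.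
Proof.
move=> NT h a b; apply/ceval_affine_eq0; apply: transfer NT _ a b.
by move=> M P MT nP a b; apply/ceval_affine_eq0/(h M P).
Qed.

(** The pointwise meaning of an event term at one sample point. It reduces identities between events
    in [N] to statements about single models of [T]. *)
Fixpoint bsat (M : structure L) p q (v : 'I_p -> M) (be : 'I_q -> Prop)
    (t : bterm L p q) : Prop :=
  match t with
  | BVar j => be j
  | BEv _ phi x => sat phi (v \o x)
  | BTop => True
  | BBot => False
  | BMeet s t => bsat v be s /\ bsat v be t
  | BJoin s t => bsat v be s \/ bsat v be t
  | BNeg s => ~ bsat v be s
  end.

Lemma nice_beval (M : structure L) (P : prestructure R L)
    (nP : nice_randomization M P) p q (t : bterm L p q) a b :
  nrE (n0:=nP) (beval a b t) =
  [set w | bsat (fun i => nrX (n0:=nP) (a i) w) (fun j => nrE (n0:=nP) (b j) w) t].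
Proof.
elim: t => [j|n phi x|||s IHs t IHt|s IHs t IHt|s IHs] //=.
- by rewrite nr_ev.
- by rewrite nr_top; apply/seteqP; split.
- by rewrite nr_bot; apply/seteqP; split.
- by rewrite nr_meet IHs IHt.
- by rewrite nr_join IHs IHt.
- by rewrite nr_neg IHs.
Qed.

Lemma beval_eq (T : theory L) (N : prestructure R L) p q (s t : bterm L p q) :
  models_TR T N ->
  (forall M : structure L, models M T -> forall (v : 'I_p -> M) be,
    bsat v be s <-> bsat v be t) ->
  forall a b, beval (P := N) a b s = beval a b t.
Proof.
move=> NT h a b; case: (NT) => -[_ _ sepB _] _; apply: sepB.
apply: (transfer (Phi := CDistB R s t) NT) => M P MT nP a' b' /=.
rewrite (_ : beval a' b' s = beval a' b' t); first by case: (dB_pseudo P).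
apply: (nrE_inj (n0 := nP)); rewrite !nice_beval; apply/seteqP; split=> w /=.
  by move/h; apply.
by move/h; apply.
Qed.

End Closure.

(** * Measure algebras *)

(** Reflected Boolean expressions, from which measures are expanded into sums over atoms. *)
Inductive bx : Type :=
| XV (i : nat) | XT | XF | XM (e f : bx) | XJ (e f : bx) | XN (e : bx).

Fixpoint bxb (be : nat -> bool) (e : bx) : bool :=
  match e with
  | XV i => be i
  | XT => true
  | XF => false
  | XM e f => bxb be e && bxb be f
  | XJ e f => bxb be e || bxb be f
  | XN e => ~~ bxb be e
  end.

Fixpoint bxwf (n : nat) (e : bx) : bool :=
  match e with
  | XV i => (i < n)%N
  | XT | XF => true
  | XM e f | XJ e f => bxwf n e && bxwf n f
  | XN e => bxwf n e
  end.

Fixpoint bxe (R : realType) (L : signature) (Q : prestructure R L)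
    (env : nat -> sortB Q) (e : bx) : sortB Q :=
  match e with
  | XV i => env i
  | XT => btop Q
  | XF => bbot Q
  | XM e f => bmeet Q (bxe env e) (bxe env f)
  | XJ e f => bjoin Q (bxe env e) (bxe env f)
  | XN e => bneg Q (bxe env e)
  end.

Lemma eq_bxb n (e : bx) be be' : bxwf n e ->
  (forall i, (i < n)%N -> be i = be' i) -> bxb be e = bxb be' e.
Proof.
move=> + h; elim: e => //= [e IHe f IHf|e IHe f IHf|e IHe].
- by case/andP => /IHe -> /IHf ->.
- by case/andP => /IHe -> /IHf ->.
- by move/IHe ->.
Qed.

Section MeasureAlgebra.
Variables (R : realType) (L : signature).

(** The laws common to nice randomizations and to models of [T^R]: Sierpinski's theorem is applied
    to both. Boolean laws are demanded only of measures, which is all that the expansion into atoms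
    needs. *)
Record measure_algebra (Q : prestructure R L) : Prop := {
  ma_bool : forall env e f, (forall be, bxb be e = bxb be f) ->
    mu Q (bxe env e) = mu Q (bxe env f);
  ma_cut : forall x y, mu Q x = mu Q (bmeet Q x y) + mu Q (bmeet Q x (bneg Q y));
  ma_top : mu Q (btop Q) = 1;
  ma_dist : forall x y, dB Q x y =
    mu Q (bjoin Q (bmeet Q x (bneg Q y)) (bmeet Q (bneg Q x) y)) }.

(** Marks the measures of atoms, so that the expansion of [mu] in [mu_lra] does not start over on
    them. *)
Definition amu (Q : prestructure R L) (x : sortB Q) : R := mu Q x.

Lemma amu_ge0 (Q : prestructure R L) (x : sortB Q) : 0 <= amu x.
Proof. by case/andP: (mu01 x). Qed.

(* The measure of [e] as the sum of the measures of the atoms below it of the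
   algebra generated by [s]. *)
Fixpoint expand (Q : prestructure R L) (s : seq (sortB Q)) (acc : sortB Q)
    (be : seq bool) (e : bx) : R :=
  match s with
  | [::] => if bxb (nth false be) e then amu acc else 0
  | x :: s' => expand s' (bmeet Q acc x) (rcons be true) e +
               expand s' (bmeet Q acc (bneg Q x)) (rcons be false) e
  end.

Lemma mu_expand (Q : prestructure R L) : measure_algebra Q ->
  forall (s : seq (sortB Q)) (e : bx), bxwf (size s) e ->
  mu Q (bxe (nth (bbot Q) s) e) = expand s (btop Q) [::] e.
Proof.
move=> ma s0 e; set env := nth _ s0 => wf.
(* [A] is the atom over the variables [pre] treated so far, with signs [be]; its value is the
   accumulator of [expand]. *)
suff gen s pre be A : s0 = pre ++ s -> size be = size pre ->
    (forall ga, bxb ga A = [forall i : 'I_(size pre), ga i == nth false be i]) ->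
    mu Q (bxe env (XM A e)) = expand s (bxe env A) be e.
  rewrite -(gen s0 [::] [::] XT) //.
    by apply: ma_bool => // ga.
  by move=> ga; apply/esym/forallP => -[].
elim: s pre be A => [|x s IH] pre be A /= es sz hA.
  rewrite cats0 in es; case: ifPn => he.
    apply: (ma_bool ma env (e := XM A e) (f := A)) => ga /=.
    rewrite hA; case: forallP => //= h.
    rewrite -he; apply: eq_bxb wf _ => i; rewrite es => isz.
    exact/eqP/(h (Ordinal isz)).
  have b0 : mu Q (bbot Q) = 0.
    have /= h1 := ma_bool ma env (e := XM XF XT) (f := XF) (fun=> erefl).
    have /= h2 := ma_bool ma env (e := XM XF (XN XT)) (f := XF) (fun=> erefl).
    by have := ma_cut ma (bbot Q) (btop Q); rewrite h1 h2 => ?; lra.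
  rewrite -b0; apply: (ma_bool ma env (e := XM A e) (f := XF)) => ga /=.
  rewrite hA; case: forallP => //= h; apply: contraNF he.
  rewrite (eq_bxb wf (be' := nth false be)) // => i; rewrite es => isz.
  exact/eqP/(h (Ordinal isz)).
have ex : env (size pre) = x by rewrite /env es nth_cat ltnn subnn.
have hA' b ga : bxb ga (XM A (if b then XV (size pre) else XN (XV (size pre)))) =
    [forall i : 'I_(size (rcons pre x)), ga i == nth false (rcons be b) i].
  have -> : bxb ga (XM A (if b then XV (size pre) else XN (XV (size pre)))) =
      bxb ga A && (ga (size pre) == b).
    by case: b => /=; case: (ga _).
  rewrite hA; apply/andP/forallP => [[/forallP h /eqP gb] [i /=]|h].
    rewrite size_rcons ltnS leq_eqVlt nth_rcons sz => /predU1P[->|isz].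
      by rewrite ltnn eqxx gb.
    by rewrite isz; apply: (h (Ordinal isz)).
  split.
    apply/forallP => -[i isz].
    have isz' : (i < size (rcons pre x))%N by rewrite size_rcons ltnS ltnW.
    by have := h (Ordinal isz'); rewrite /= nth_rcons sz isz.
  have isz' : (size pre < size (rcons pre x))%N by rewrite size_rcons.
  by have := h (Ordinal isz'); rewrite /= nth_rcons sz ltnn eqxx.
have := IH (rcons pre x) (rcons be true) _ _ _ (hA' true).
have := IH (rcons pre x) (rcons be false) _ _ _ (hA' false).
rewrite !size_rcons sz cat_rcons /= ex => <- // <- //.
have /= := ma_cut ma (bxe env (XM A e)) x => ->.
rewrite -ex; congr (_ + _).
  apply: (ma_bool ma env (e := XM (XM A e) (XV (size pre)))
    (f := XM (XM A (XV (size pre))) e)) => ga /=.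
  by rewrite -!andbA [X in _ && X]andbC.
apply: (ma_bool ma env (e := XM (XM A e) (XN (XV (size pre))))
  (f := XM (XM A (XN (XV (size pre)))) e)) => ga /=.
by rewrite -!andbA [X in _ && X]andbC.
Qed.

End MeasureAlgebra.

Ltac bx_lookup x env :=
  match env with
  | cons x _ => constr:(0%N)
  | cons _ ?e => let n := bx_lookup x e in constr:(S n)
  end.

Ltac bx_reify env t :=
  match constr:(Set) with
  | _ => let n := bx_lookup t env in constr:(XV n)
  | _ => match t with
    | btop _ => constr:(XT)
    | bbot _ => constr:(XF)
    | bmeet _ ?x ?y => let a := bx_reify env x in let b := bx_reify env y in
                       constr:(XM a b)
    | bjoin _ ?x ?y => let a := bx_reify env x in let b := bx_reify env y in
                       constr:(XJ a b)
    | bneg _ ?x => let a := bx_reify env x in constr:(XN a)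
    end
  end.

(* Linear consequences of Boolean identities: every [mu] in the goal is
   replaced by a sum over the atoms of the algebra generated by [env]. *)
Ltac mu_lra ma env :=
  repeat match goal with
  | |- context [@mu ?R ?L ?Q ?e] =>
      let r := bx_reify env e in
      rewrite (@mu_expand R L Q ma env r isT : @mu R L Q e = _)
  end;
  cbn [expand bxb nth rcons negb andb orb];
  repeat match goal with
  | |- context [@amu ?R ?L ?Q ?x] =>
      move: (@amu_ge0 R L Q x); generalize (@amu R L Q x)
  end; intros; lra.

(** * Sierpinski's theorem in a complete atomless measure algebra *)

Section Sierpinski.
Variables (R : realType) (L : signature) (Q : prestructure R L).
Hypothesis ma : measure_algebra Q.

(** Inclusion up to a null event: a linear condition on measures, hence usable by [mu_lra]. *)
Definition sub (x y : sortB Q) : Prop := mu Q (bmeet Q x (bneg Q y)) = 0.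

Lemma sub_refl x : sub x x.
Proof. by rewrite /sub; mu_lra ma [:: x]. Qed.

Lemma sub_trans y x z : sub x y -> sub y z -> sub x z.
Proof. by rewrite /sub; mu_lra ma [:: x; y; z]. Qed.

Hypothesis complete : cauchy_complete (dB Q).
Hypothesis splits : forall x, 0 < mu Q x ->
  exists y, 0 < mu Q (bmeet Q x y) < mu Q x.

Lemma mu_ge0 (x : sortB Q) : 0 <= mu Q x.
Proof. by case/andP: (mu01 x). Qed.

Lemma small_subevent x e : 0 < mu Q x -> 0 < e ->
  exists2 y, sub y x & 0 < mu Q y <= e.
Proof.
move=> x0 e0.
(* The smaller of two parts has at most half the measure, which more than suffices to pass from the
   bound [1 / (n + 1)] to [1 / (n + 2)]. *)
have half n : exists2 y, sub y x & 0 < mu Q y /\ (n%:R + 1) * mu Q y <= 1.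
  elim: n => [|n [y yx [y0 yn]]].
    by exists x; [exact: sub_refl|case/andP: (mu01 x); split=> //; lra].
  have [z /andP[z0 zy]] := splits y0.
  have h : mu Q y = mu Q (bmeet Q y z) + mu Q (bmeet Q y (bneg Q z)).
    exact: ma_cut.
  have n0 : 0 <= n%:R :> R by [].
  rewrite -natr1.
  case: (leP (mu Q (bmeet Q y z)) (mu Q (bmeet Q y (bneg Q z)))) => hle.
    exists (bmeet Q y z); first by move: yx; rewrite /sub; mu_lra ma [:: x; y; z].
    by split=> //; nra.
  exists (bmeet Q y (bneg Q z)).
    by move: yx; rewrite /sub; mu_lra ma [:: x; y; z].
  by split; nra.
have [y yx [y0 yn]] := half (Num.truncn e^-1).
exists y => //; rewrite y0 /=.
have := truncnS_gt e^-1; rewrite -natr1 => /ltW h.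
 have ei : e * e^-1 = 1 by rewrite mulfV // gt_eqF.
have h1 : 1 <= e * ((Num.truncn e^-1)%:R + 1) by rewrite -[leLHS]ei ler_pM2l.
rewrite -[mu Q y]mulr1 (le_trans (ler_wpM2l (mu_ge0 y) h1)) //.
by rewrite mulrCA -[leRHS]mulr1 ler_pM2l // mulrC.
Qed.

(** The measures converge to their supremum, which makes the increasing sequence Cauchy. Its limit
    plays the role of the countable union that abstract events do not have. *)
Lemma sub_limit (u : nat -> sortB Q) :
  (forall k, sub (u k) (u k.+1)) ->
  exists l, (forall k, sub (u k) l) /\
    (forall z, (forall k, mu Q (bmeet Q (u k) z) = 0) -> mu Q (bmeet Q l z) = 0) /\
    forall c, (forall k, mu Q (u k) <= c) -> mu Q l <= c.
Proof.
move=> usub.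
have u_mono j k : (j <= k)%N -> sub (u j) (u k).
  move/subnK <-; elim: (k - j)%N => [|d IH]; first exact: sub_refl.
  exact: sub_trans IH (usub _).
pose s := sup (range (mu Q \o u)).
have hs : has_sup (range (mu Q \o u)).
  split; first by exists (mu Q (u 0%N)), 0%N.
  by exists 1 => _ [k _ <-] /=; case/andP: (mu01 (u k)).
have us k : mu Q (u k) <= s by apply: sup_upper_bound => //; exists k.
have cauchy (e : R) : 0 < e -> exists K, forall m n, (K <= m)%N -> (K <= n)%N ->
    dB Q (u m) (u n) < e.
  move=> e0; have [|_ [K _ <-] /= uK] := @sup_adherent _ _ (e / 2) _ hs.
    by lra.
  exists K => m n /u_mono Km /u_mono Kn; rewrite ma_dist //.
  move: (us m) (us n) uK e0 Km Kn; rewrite /sub -/s.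
  by mu_lra ma [:: u K; u m; u n].
have [l lim] := complete cauchy.
exists l; split; [|split] => [k|z uz|c uc].
- apply/eqP; rewrite eq_le mu_ge0 andbT; apply/ler_addgt0Pl => e /lim[K hK].
  have := hK (maxn K k) (leq_maxl _ _).
  have := u_mono _ _ (leq_maxr K k); rewrite ma_dist // /sub.
  by mu_lra ma [:: u k; u (maxn K k); l].
- apply/eqP; rewrite eq_le mu_ge0 andbT; apply/ler_addgt0Pl => e /lim[K hK].
  have := hK K (leqnn _); have := uz K; rewrite ma_dist //.
  by mu_lra ma [:: u K; z; l].
- apply/ler_addgt0Pl => e /lim[K hK].
  have := hK K (leqnn _); have := uc K; rewrite ma_dist //.
  by mu_lra ma [:: u K; l].
Qed.

Lemma sierpinski x r : 0 <= r <= mu Q x -> exists2 y, sub y x & mu Q y = r.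
Proof.
move=> /andP[r0 rx].
pose S := {y | sub y x /\ mu Q y <= r}.
(* Greedy exhaustion: each step adds at least half of what can be added. *)
have step (y : S) : exists z : S, sub (sval y) (sval z) /\
    forall t, sub t (bmeet Q x (bneg Q (sval y))) -> mu Q (sval y) + mu Q t <= r ->
      mu Q t <= 2 * (mu Q (sval z) - mu Q (sval y)).
  case: y => y [yx yr] /=.
  pose G := [set mu Q t | t in [set t |
    sub t (bmeet Q x (bneg Q y)) /\ mu Q y + mu Q t <= r]].
  have hG : has_sup G.
    split; last by exists 1 => _ [t _ <-]; case/andP: (mu01 t).
    exists (mu Q (bbot Q)), (bbot Q) => //=; split.
      by rewrite /sub; mu_lra ma [:: x; y].
    by move: yr; mu_lra ma [:: x; y].
  have Gub t : sub t (bmeet Q x (bneg Q y)) -> mu Q y + mu Q t <= r ->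
      mu Q t <= sup G.
    by move=> h1 h2; apply: sup_upper_bound => //; exists t.
  have [t [tx tr] tG] : exists2 t, sub t (bmeet Q x (bneg Q y)) /\
      mu Q y + mu Q t <= r & sup G <= 2 * mu Q t.
    case: (leP (sup G) 0) => hs.
      exists (bbot Q); first split.
      - by rewrite /sub; mu_lra ma [:: x; y].
      - by move: yr; mu_lra ma [:: x; y].
      - by apply: le_trans hs _; rewrite mulr_ge0 // mu_ge0.
    have [|_ [t [h1 h2] <-] h3] := @sup_adherent _ G (sup G / 2) _ hG.
      by lra.
    by exists t => //; lra.
  have yt : mu Q (bjoin Q y t) = mu Q y + mu Q t.
    by move: tx; rewrite /sub; mu_lra ma [:: x; y; t].
  have ytx : sub (bjoin Q y t) x.
    by move: tx yx; rewrite /sub; mu_lra ma [:: x; y; t].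
  have ytr : mu Q (bjoin Q y t) <= r by rewrite yt.
  exists (exist (fun y => sub y x /\ mu Q y <= r) _ (conj ytx ytr)) => /=.
  split; first by rewrite /sub; mu_lra ma [:: y; t].
  move=> t' h1 h2; rewrite yt; have := Gub t' h1 h2; lra.
have [f fP] := choice step.
have b0 : sub (bbot Q) x /\ mu Q (bbot Q) <= r.
  by split; move: r0; rewrite /sub; mu_lra ma [:: x].
have [u uS] : exists u : nat -> S, forall k, u k.+1 = f (u k).
  by exists (fun k => iter k f (exist (fun y => sub y x /\ mu Q y <= r) _ b0)).
have [|l [ul [lz lc]]] := @sub_limit (fun k => sval (u k)).
  by move=> k; rewrite uS; case: (fP (u k)).
have lx : sub l x by apply: lz => k; case: (proj2_sig (u k)).
have lr : mu Q l <= r by apply: lc => k; case: (proj2_sig (u k)).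
exists l => //; apply/eqP; rewrite eq_le lr leNgt; apply/negP => lr'.
have [t tx /andP[t0 te]] : exists2 t, sub t (bmeet Q x (bneg Q l)) &
    0 < mu Q t <= r - mu Q l.
  apply: small_subevent; last by lra.
  by move: lx lr' rx; rewrite /sub; mu_lra ma [:: x; l].
have grow k : k%:R * mu Q t <= 2 * mu Q (sval (u k)).
  elim: k => [|k IH]; first by rewrite mul0r mulr_ge0 ?mu_ge0.
  have h1 : sub t (bmeet Q x (bneg Q (sval (u k)))).
    by move: (ul k) tx; rewrite /sub; set y := sval (u k); mu_lra ma [:: x; l; t; y].
  have h2 : mu Q (sval (u k)) + mu Q t <= r.
    by move: (ul k) te; rewrite /sub; set y := sval (u k); mu_lra ma [:: l; t; y].
  have := (fP (u k)).2 t h1 h2; rewrite -uS.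
  by rewrite -natr1 mulrDl mul1r; lra.
have := grow (Num.truncn (2 / mu Q t)).+1.
have := truncnS_gt (2 / mu Q t).
set y := sval _; rewrite ltr_pdivrMr // => h1 h2.
by case/andP: (mu01 y); lra.
Qed.

End Sierpinski.

(** * Randomizations *)

Definition eqe (R : realType) (L : signature) (Q : prestructure R L)
    (x y : sortK Q) : sortB Q :=
  ev Q (FEq (TVar L ord0) (TVar L (lift ord0 ord0))) (vcons x (vcons y vnil)).

(** * The properties of nice randomizations to be transferred *)

Section Nice.
Variables (R : realType) (L : signature) (M : structure L).
Variables (P : prestructure R L) (nP : nice_randomization M P).

Let E := nrE (n0 := nP).
Let X := nrX (n0 := nP).

Lemma nice_measurable x : measurable (E x).
Proof.
have : range (nrE (n0 := nP)) (E x) by exists x.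
by rewrite nrE_range.
Qed.

Lemma nice_event A : measurable A -> exists x, E x = A.
Proof.
move=> mA; have : range (nrE (n0 := nP)) A by rewrite nrE_range.
by case=> x _ <-; exists x.
Qed.

Lemma nice_fin x : nr_prob nP (E x) \is a fin_num.
Proof. by apply: fin_num_measure; apply: nice_measurable. Qed.

Lemma nice_muE x : (mu P x)%:E = nr_prob nP (E x).
Proof. by rewrite (nr_mu nP) fineK //; apply: nice_fin. Qed.

Lemma nice_eqe x y : E (eqe x y) = [set w | X x w = X y w].
Proof.
by rewrite /E nr_ev /=; apply/seteqP; split=> w /=; rewrite vconsS !vcons0.
Qed.

Lemma nice_bxe env e : E (bxe env e) = [set w | bxb (fun i => `[<E (env i) w>]) e].
Proof.
rewrite /E; elim: e => [i|||e IHe f IHf|e IHe f IHf|e IHe] /=.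
- by apply/seteqP; split=> w /= /asboolP.
- by rewrite nr_top; apply/seteqP; split.
- by rewrite nr_bot; apply/seteqP; split.
- by rewrite nr_meet IHe IHf; apply/seteqP; split=> w /= /andP.
- by rewrite nr_join IHe IHf; apply/seteqP; split=> w /= /orP.
- by rewrite nr_neg IHe; apply/seteqP; split=> w /= /negP.
Qed.

Lemma nice_measure_algebra : measure_algebra P.
Proof.
split=> [env e f h|x y||x y].
- rewrite !(nr_mu nP) -!/(E _) !nice_bxe; congr (fine (nr_prob nP _)).
  by apply/seteqP; split=> w /=; rewrite h.
- apply: EFin_inj; rewrite EFinD !nice_muE /E !nr_meet nr_neg.
  rewrite (measureDI (nr_prob nP) (nice_measurable x) (nice_measurable y)).
  by rewrite addeC.
- by rewrite (nr_mu nP) nr_top probability_setT.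
- rewrite (nr_dB nP) (nr_mu nP) nr_join !nr_meet !nr_neg setY_def.
  by rewrite [X in _ `|` X]setIC.
Qed.

Lemma nice_mu_eq0 x : E x = set0 -> mu P x = 0.
Proof. by move=> x0; rewrite (nr_mu nP) -/(E x) x0 measure0. Qed.

Lemma nice_dK x y : dK P x y = mu P (bneg P (eqe x y)).
Proof.
by rewrite (nr_dK nP) (nr_mu nP) nr_neg -/(E _) nice_eqe.
Qed.

Lemma nice_splits x : 0 < mu P x -> exists y, 0 < mu P (bmeet P x y) < mu P x.
Proof.
move=> x0.
have [|B [mB Bx /andP[B0 Bx']]] := @nr_atomless _ _ _ _ nP _ (nice_measurable x).
  by rewrite -nice_muE lte_fin.
have [y yB] := nice_event mB; exists y.
have xyB : E (bmeet P x y) = B.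
  by rewrite /E nr_meet -/(E _) -/(E y) yB setIC; apply/setIidl.
by rewrite -!lte_fin !nice_muE xyB; apply/andP.
Qed.

(** Atomlessness as such speaks of strict inequalities; an exact half is an equation between
    measures and can be transferred. *)
Lemma nice_half x : exists y, mu P (bmeet P x y) = mu P x / 2.
Proof.
have ma := nice_measure_algebra; have x0 := mu_ge0 x.
have [|y yx <-] := sierpinski ma (nr_completeB nP) nice_splits (x := x)
  (r := mu P x / 2); first by apply/andP; split; lra.
by exists y; move: yx; rewrite /sub; mu_lra ma [:: x; y].
Qed.

(** Every event has the form [psi(a)], so gluing along it is a case of witnessing: [theta] says that
    [z] is [x] if [psi(a)] holds and [y] otherwise. Its variables are [z], [x], [y] and then the
    tuple [a]. *)
Lemma nice_glue (x y : sortK P) (e : sortB P) : exists z,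
  (E e `<=` E (eqe z x)) /\ (~` E e `<=` E (eqe z y)).
Proof.
have [n [psi [a ->]]] := nr_events nP e.
pose s : 'I_n -> 'I_n.+3 := fun i => lift ord0 (lift ord0 (lift ord0 i)).
pose z0 : 'I_n.+3 := ord0.
pose x0 : 'I_n.+3 := lift ord0 ord0.
pose y0 : 'I_n.+3 := lift ord0 (lift ord0 ord0).
pose theta := FOr (FAnd (ren psi s) (FEq (TVar L z0) (TVar L x0)))
  (FAnd (FNot (ren psi s)) (FEq (TVar L z0) (TVar L y0))).
have thetaP b c d (u : 'I_n -> M) : sat theta (vcons b (vcons c (vcons d u))) <->
    (sat psi u /\ b = c \/ ~ sat psi u /\ b = d).
  have us : vcons b (vcons c (vcons d u)) \o s = u.
    by apply/funext => i; rewrite /s /= !vconsS.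
  by rewrite sat_or !sat_and /= sat_ren us /z0 /x0 /y0 !vconsS !vcons0.
have [z ez] := nr_witness nP theta (vcons x (vcons y a)).
have {ez} := congr1 (nrE (n0 := nP)) ez; rewrite !nr_ev => ez.
have Xv c w m (b : 'I_m -> sortK P) : (fun i => nrX (n0 := nP) (vcons c b i) w) =
    vcons (X c w) (fun i => X (b i) w).
  exact: (vcons_comp (X^~ w)).
have zP w : sat psi (fun i => X (a i) w) /\ X z w = X x w \/
    ~ sat psi (fun i => X (a i) w) /\ X z w = X y w.
  apply/thetaP; rewrite -!Xv.
  suff : [set w | sat (FEx theta)
    (fun i => nrX (n0 := nP) (vcons x (vcons y a) i) w)] w by rewrite -ez.
  rewrite /= !Xv.
  case: (pselect (sat psi (fun i => X (a i) w))) => hpsi.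
    by exists (X x w); apply/thetaP; left.
  by exists (X y w); apply/thetaP; right.
exists z; rewrite !nice_eqe /E nr_ev; split=> w /= hw.
  by case: (zP w) => -[].
by case: (zP w) => -[].
Qed.

End Nice.

(** * Measure laws in a model of [T^R] *)

Section Model.
Variables (R : realType) (L : signature) (T : theory L).
Variables (N : prestructure R L) (NT : models_TR T N).

Fixpoint bxt (K : nat) (e : bx) : bterm L 0 K.+1 :=
  match e with
  | XV i => BVar L 0 (inord i)
  | XT => BTop L 0 K.+1
  | XF => BBot L 0 K.+1
  | XM e f => BMeet (bxt K e) (bxt K f)
  | XJ e f => BJoin (bxt K e) (bxt K f)
  | XN e => BNeg (bxt K e)
  end.

Fixpoint bxmax (e : bx) : nat :=
  match e with
  | XV i => i
  | XT | XF => 0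
  | XM e f | XJ e f => (bxmax e + bxmax f)%N
  | XN e => bxmax e
  end.

Lemma beval_bxt K (e : bx) (env : nat -> sortB N) a : (bxmax e <= K)%N ->
  beval a (env \o val) (bxt K e) = bxe env e.
Proof.
elim: e => //= [i iK|e IHe f IHf ef|e IHe f IHf ef|e IHe eK].
- by rewrite inordK.
- by rewrite IHe ?IHf // (leq_trans _ ef) // ?leq_addr ?leq_addl.
- by rewrite IHe ?IHf // (leq_trans _ ef) // ?leq_addr ?leq_addl.
- by rewrite IHe.
Qed.

Lemma bsat_bxt (M : structure L) K (e : bx) (v : 'I_0 -> M) be :
  bsat v be (bxt K e) <-> bxb (fun i => `[<be (inord i)>]) e.
Proof.
elim: e => /= [i|||e IHe f IHf|e IHe f IHf|e IHe] //.
- by split=> /asboolP.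
- by rewrite IHe IHf; split=> /andP.
- by rewrite IHe IHf; split=> /orP.
- by rewrite IHe; split=> /negP.
Qed.

Lemma model_bool env e f : (forall be, bxb be e = bxb be f) ->
  bxe (Q := N) env e = bxe env f.
Proof.
move=> h; pose K := (bxmax e + bxmax f)%N.
rewrite -(@beval_bxt K e env vnil) ?leq_addr //.
rewrite -(@beval_bxt K f env vnil) ?leq_addl //.
by apply: (beval_eq NT) => M MT v be; rewrite !bsat_bxt h.
Qed.

Lemma model_measure_algebra : measure_algebra N.
Proof.
split=> [env e f h|x y||x y].
- by rewrite (model_bool _ h).
- pose x0 := BVar L 0 (ord0 : 'I_2).
  pose y0 := BVar L 0 (lift ord0 ord0 : 'I_2).
  pose Phi (i : 'I_3) := nth (CMu R x0)
    [:: CMu R x0; CMu R (BMeet x0 y0); CMu R (BMeet x0 (BNeg y0))] i.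
  pose c (i : 'I_3) : R := nth 0 [:: 1; -1; -1] i.
  have := transfer_affine (c0 := 0) (c := c) (Phi := Phi) NT _ vnil
    (vcons x (vcons y vnil)).
  rewrite !big_ord_recl big_ord0 /Phi /c /= !vconsS !vcons0 => h.
  suff : 0 + (1 * mu N x + (-1 * mu N (bmeet N x y) +
      (-1 * mu N (bmeet N x (bneg N y)) + 0))) = 0 by lra.
  apply: h => M P MT nP a b; rewrite !big_ord_recl big_ord0 /=.
  have := ma_cut (nice_measure_algebra nP) (b ord0) (b (lift ord0 ord0)); lra.
- pose Phi (i : 'I_1) := CMu R (BTop L 0 0).
  have := transfer_affine (c0 := -1) (c := fun i => 1) (Phi := Phi) NT _ vnil vnil.
  rewrite big_ord_recl big_ord0 /= => h.
  suff : -1 + (1 * mu N (btop N) + 0) = 0 by lra.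
  apply: h => M P MT nP a b; rewrite big_ord_recl big_ord0 /=.
  have := ma_top (nice_measure_algebra nP); lra.
- pose x0 := BVar L 0 (ord0 : 'I_2).
  pose y0 := BVar L 0 (lift ord0 ord0 : 'I_2).
  pose Phi (i : 'I_2) := nth (CMu R x0) [:: CDistB R x0 y0;
    CMu R (BJoin (BMeet x0 (BNeg y0)) (BMeet (BNeg x0) y0))] i.
  pose c (i : 'I_2) : R := nth 0 [:: 1; -1] i.
  have := transfer_affine (c0 := 0) (c := c) (Phi := Phi) NT _ vnil
    (vcons x (vcons y vnil)).
  rewrite !big_ord_recl big_ord0 /Phi /c /= !vconsS !vcons0 => h.
  set D := bjoin _ _ _; have {h} : 0 + (1 * dB N x y + (-1 * mu N D + 0)) = 0.
    apply: h => M P MT nP a b; rewrite !big_ord_recl big_ord0 /=.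
    have := ma_dist (nice_measure_algebra nP) (b ord0) (b (lift ord0 ord0)); lra.
  lra.
Qed.

Lemma model_dK x y : dK N x y = mu N (bneg N (eqe x y)).
Proof.
pose x0 : 'I_2 := ord0.
pose y0 : 'I_2 := lift ord0 ord0.
pose Phi (i : 'I_2) := nth (CDistK R L 0 x0 y0) [:: CDistK R L 0 x0 y0;
  CMu R (BNeg (BEv 0 (FEq (TVar L x0) (TVar L y0)) id))] i.
pose c (i : 'I_2) : R := nth 0 [:: 1; -1] i.
have := transfer_affine (c0 := 0) (c := c) (Phi := Phi) NT _
  (vcons x (vcons y vnil)) vnil.
rewrite !big_ord_recl big_ord0 /Phi /c /= !vconsS !vcons0 => h.
have {h} : 0 + (1 * dK N x y + (-1 * mu N (bneg N (eqe x y)) + 0)) = 0.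
  apply: h => M P MT nP a b; rewrite !big_ord_recl big_ord0 /=.
  rewrite (nice_dK nP) /eqe -[a \o id]vcons_eta -[_ \o lift ord0]vcons_eta.
  rewrite (eq_ord0_fun (_ \o _) vnil) /x0 /y0 /=; lra.
lra.
Qed.

End Model.

(** * First-order events and approximate gluing in a model of [T^R] *)

Section ModelGluing.
Variables (R : realType) (L : signature) (T : theory L).
Variables (N : prestructure R L) (NT : models_TR T N).

Let ma : measure_algebra N := model_measure_algebra NT.

Lemma event_eq (x y : sortB N) : sub x y -> sub y x -> x = y.
Proof.
move=> xy yx; case: (NT) => -[_ _ sepB _] _; apply: sepB; rewrite ma_dist //.
by move: xy yx; rewrite /sub; mu_lra ma [:: x; y].
Qed.

Lemma beval_sub p q (s t : bterm L p q) :
  (forall M : structure L, models M T -> forall (v : 'I_p -> M) be,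
    bsat v be s -> bsat v be t) ->
  forall a b, sub (beval (P := N) a b s) (beval a b t).
Proof.
move=> h a b.
have /= e := @beval_eq _ _ T N p q (BMeet s (BNeg t)) (BBot L p q) NT _ a b.
rewrite /sub e => [|M MT v be /=]; first by mu_lra ma (@nil (sortB N)).
by have := h M MT v be; tauto.
Qed.

Lemma ev_sub n m k (phi : formula L n) (psi : formula L m) (a : 'I_k -> sortK N)
    (f : 'I_n -> 'I_k) (g : 'I_m -> 'I_k) :
  (forall M : structure L, models M T -> forall v : 'I_k -> M,
    sat phi (v \o f) -> sat psi (v \o g)) ->
  sub (ev N phi (a \o f)) (ev N psi (a \o g)).
Proof.
move=> h; apply: (@beval_sub k 0 (BEv 0 phi f) (BEv 0 psi g) _ a vnil).
by move=> M MT v be; apply: h.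
Qed.

Lemma ev_timp n (phi psi : formula L n) a : timp T phi psi ->
  sub (ev N phi a) (ev N psi a).
Proof. by move=> h; apply: (@ev_sub n n n phi psi a id id). Qed.

Lemma ev_equiv n (phi psi : formula L n) a : timp T phi psi -> timp T psi phi ->
  ev N phi a = ev N psi a.
Proof. by move=> h h'; apply: event_eq; apply: ev_timp. Qed.

Lemma ev_ren n m (phi : formula L n) (f : 'I_n -> 'I_m) a :
  ev N (ren phi f) a = ev N phi (a \o f).
Proof.
by apply: event_eq; apply: (@ev_sub _ _ m _ _ a) => M MT v; rewrite sat_ren.
Qed.

Lemma ev_not n (phi : formula L n) a : ev N (FNot phi) a = bneg N (ev N phi a).
Proof.
exact: (@beval_eq _ _ T N n 0 (BEv 0 (FNot phi) id) (BNeg (BEv 0 phi id)) NT _ a vnil).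
Qed.

Lemma ev_and n (phi psi : formula L n) a :
  ev N (FAnd phi psi) a = bmeet N (ev N phi a) (ev N psi a).
Proof.
exact: (@beval_eq _ _ T N n 0 (BEv 0 (FAnd phi psi) id)
  (BMeet (BEv 0 phi id) (BEv 0 psi id)) NT _ a vnil).
Qed.

Lemma ev_or n (phi psi : formula L n) a :
  ev N (FOr phi psi) a = bjoin N (ev N phi a) (ev N psi a).
Proof.
apply: (@beval_eq _ _ T N n 0 (BEv 0 (FOr phi psi) id)
  (BJoin (BEv 0 phi id) (BEv 0 psi id)) NT _ a vnil) => M MT v be.
exact: sat_or.
Qed.

Lemma ev_valid n (phi : formula L n) a : (forall M : structure L, models M T ->
  forall v : 'I_n -> M, sat phi v) -> ev N phi a = btop N.
Proof.
move=> h; apply: (@beval_eq _ _ T N n 0 (BEv 0 phi id) (BTop L n 0) NT _ a vnil).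
by move=> M MT v be /=; split=> // _; apply: h.
Qed.

Lemma ev_unsat n (phi : formula L n) a : ~ consistent T phi -> mu N (ev N phi a) = 0.
Proof.
move=> h; have := ev_timp (phi := phi) (psi := FFalse n) a.
have -> : ev N (FFalse n) a = bneg N (btop N).
  rewrite ev_not (ev_valid (phi := FTrue n)) // => M MT v; exact: sat_true.
rewrite /sub; set x := ev N phi a => h'.
have {h'} : mu N (bmeet N x (bneg N (bneg N (btop N)))) = 0.
  by apply: h' => M MT v phiv; case: h; exists M => //; exists v.
by mu_lra ma [:: x].
Qed.

Lemma ev_fun_eq n (a : 'I_n -> sortK N) i j :
  ev N (FEq (TVar L i) (TVar L j)) a = eqe (a i) (a j).
Proof.
rewrite /eqe -[vcons (a i) _](_ : a \o vcons i (vcons j vnil) = _).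
  rewrite -ev_ren; congr ev.
  by rewrite /= vconsS !vcons0.
by rewrite !vcons_comp (eq_ord0_fun (_ \o _) vnil).
Qed.

Lemma null_fconj n (I : finType) (phi : I -> formula L n) a x :
  (forall i, sub x (ev N (phi i) a)) -> sub x (ev N (fconj phi) a).
Proof.
move=> h; rewrite /sub ev_not.
set f := (\big[_/_]_i _ : formula L n).
have : mu N (bmeet N x (ev N f a)) = 0.
  rewrite /f; apply: (big_ind (fun f => mu N (bmeet N x (ev N f a)) = 0)).
  - rewrite ev_not (ev_valid (phi := FTrue n)); last by move=> M MT v; exact: sat_true.
    by mu_lra ma [:: x].
  - move=> g g' hg hg'; rewrite ev_or.
    by move: hg hg'; set y := ev N g a; set z := ev N g' a; mu_lra ma [:: x; y; z].
  - by move=> i _; rewrite ev_not; apply: h.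
by set y := ev N f a; mu_lra ma [:: x; y].
Qed.

(** The agreement of [a] and [a'] is a first-order event of their concatenation, for which
    substitution is a valid implication. *)
Lemma ev_subst n (phi : formula L n) (a a' : 'I_n -> sortK N) x :
  (forall i, sub x (eqe (a i) (a' i))) ->
  sub (bmeet N x (ev N phi a)) (ev N phi a').
Proof.
move=> h.
pose b (i : 'I_(n + n)) := match fintype.split i with inl j => a j | inr j => a' j end.
have bl : b \o @lshift n n = a.
  apply/funext => i; rewrite /b /=; case: split_ordP => j; first by move/lshift_inj ->.
  by move/eqP; rewrite eq_lrshift.
have br : b \o @rshift n n = a'.
  apply/funext => i; rewrite /b /=; case: split_ordP => j; last by move/rshift_inj ->.
  by move/eqP; rewrite eq_rlshift.
pose e := fconj (fun i : 'I_n => FEq (TVar L (lshift n i)) (TVar L (rshift n i))).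
have xe : sub x (ev N e b).
  apply: null_fconj => i; rewrite ev_fun_eq.
  by have := h i; rewrite -[in a i]bl -[in a' i]br.
have : sub (ev N (FAnd e (ren phi (@lshift n n))) b) (ev N (ren phi (@rshift n n)) b).
  apply: ev_timp => M MT v; rewrite sat_and sat_fconj !sat_ren => -[ve].
  suff -> : v \o @lshift n n = v \o @rshift n n by [].
  by apply/funext => i /=; exact: ve.
rewrite ev_and !ev_ren bl br; move: xe.
set y := ev N e b; set z := ev N phi a; set z' := ev N phi a'.
by rewrite /sub; mu_lra ma [:: x; y; z; z'].
Qed.

Lemma eqe_refl x : eqe (Q := N) x x = btop N.
Proof.
rewrite -(ev_fun_eq (fun=> x) ord0 (ord0 : 'I_1)).
by apply: ev_valid.
Qed.

Lemma eqe_sub2 (x y z : sortK N) : sub (bmeet N (eqe x y) (eqe y z)) (eqe x z).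
Proof.
have := @ev_timp 3 (FAnd (FEq (TVar L ord0) (TVar L (lift ord0 ord0)))
  (FEq (TVar L (lift ord0 ord0)) (TVar L (lift ord0 (lift ord0 ord0)))))
  (FEq (TVar L ord0) (TVar L (lift ord0 (lift ord0 ord0))))
  (vcons x (vcons y (vcons z vnil))).
rewrite ev_and !ev_fun_eq !vconsS !vcons0; apply=> M MT v /=.
by case=> -> ->.
Qed.

Lemma eqe_sym (x y : sortK N) : eqe x y = eqe y x.
Proof.
suff h (u v : sortK N) : sub (eqe u v) (eqe v u) by apply: event_eq.
have := @ev_timp 2 (FEq (TVar L ord0) (TVar L (lift ord0 ord0)))
  (FEq (TVar L (lift ord0 ord0)) (TVar L ord0)) (vcons u (vcons v vnil)).
by rewrite !ev_fun_eq !vconsS !vcons0; apply=> M MT w /= ->.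
Qed.

Lemma eqe_inj (x y : sortK N) : mu N (bneg N (eqe x y)) = 0 -> x = y.
Proof.
by rewrite -(model_dK NT); case: (NT) => -[sepK _ _ _] _ /sepK.
Qed.

(** Only an approximate half is available; an error below [mu x / 4] keeps both parts positive. *)
Lemma model_splits (x : sortB N) : 0 < mu N x ->
  exists y, 0 < mu N (bmeet N x y) < mu N x.
Proof.
move=> x0.
pose Phi (i : 'I_2) := nth (CMu R (BTop L 0 2)) [:: CMu R
  (BMeet (BVar L 0 (lift ord0 ord0)) (BVar L 0 ord0));
  CMu R (BVar L 0 (lift ord0 ord0))] i.
pose c (i : 'I_2) : R := nth 0 [:: 1; - 2^-1] i.
have [||y] := transfer_exB (Phi := CConn (caffine 0 c) Phi) NT _ vnil (vcons x vnil)
  (e := mu N x / 4).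
- move=> M P MT nP a b; have [y hy] := nice_half nP (b ord0).
  exists y; apply/ceval_affine_eq0; rewrite !big_ord_recl big_ord0 /Phi /c /=.
  by rewrite !vconsS !vcons0 hy; lra.
- by lra.
rewrite /= /affine !big_ord_recl big_ord0 !mxE /Phi /c /= !vconsS !vcons0.
case/andP: (mu01 x) => _ x1; rewrite gt_min => /orP[|h]; first by lra.
exists y; move: h; rewrite ltr_norml => /andP[h1 h2].
by apply/andP; split; lra.
Qed.

Lemma model_sierpinski (x : sortB N) r : 0 <= r <= mu N x ->
  exists2 y, sub y x & mu N y = r.
Proof.
by apply: sierpinski ma _ model_splits x r; case: (NT) => -[].
Qed.

Definition misglue (z x y : sortK N) (e : sortB N) : sortB N :=
  bjoin N (bmeet N e (bneg N (eqe z x))) (bmeet N (bneg N e) (bneg N (eqe z y))).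

Lemma approx_glue x y e (r : R) : 0 < r -> exists z, mu N (misglue z x y e) < r.
Proof.
pose z0 : 'I_3 := ord0.
pose x0 : 'I_3 := lift ord0 ord0.
pose y0 : 'I_3 := lift ord0 (lift ord0 ord0).
pose e0 : 'I_1 := ord0.
pose eq (i j : 'I_3) := BEv 1 (FEq (TVar L i) (TVar L j)) id.
pose t := BJoin (BMeet (BVar L 3 e0) (BNeg (eq z0 x0)))
  (BMeet (BNeg (BVar L 3 e0)) (BNeg (eq z0 y0))).
move=> r0.
have [|z] := transfer_exK (Phi := CMu R t) NT _ (vcons x (vcons y vnil))
  (vcons e vnil) r0.
  move=> M P MT nP a b.
  have [z [zx zy]] := nice_glue nP (a ord0) (a (lift ord0 ord0)) (b ord0).
  exists z; apply: (nice_mu_eq0 (nP := nP)); rewrite nice_beval.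
  move: zx zy; rewrite !nice_eqe => zx zy.
  apply/seteqP; split=> w //=; rewrite /z0 /x0 /y0 /e0 !vconsS !vcons0.
  case: (pselect (nrE (n0 := nP) (b ord0) w)) => hw.
    by have := zx _ hw; tauto.
  by have := zy _ hw; tauto.
rewrite /= /eq !ev_fun_eq /= /z0 /x0 /y0 /e0 !vconsS !vcons0 => h.
by exists z.
Qed.

(** Where neither [z] nor [z'] is wrong they coincide. Hence ever better approximate gluings form a
    Cauchy sequence. *)
Lemma misglue_dist x y e z z' :
  dK N z z' <= mu N (misglue z x y e) + mu N (misglue z' x y e).
Proof.
rewrite (model_dK NT) /misglue.
have := eqe_sub2 z x z'; have := eqe_sub2 z y z'.
rewrite (eqe_sym x z') (eqe_sym y z') /sub.
set a := eqe z x; set b := eqe z y; set a' := eqe z' x; set b' := eqe z' y.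
by set c := eqe z z'; mu_lra ma [:: a; b; a'; b'; c; e].
Qed.
End ModelGluing.

(** * Exact gluing and exact witnesses from completeness *)

Section ModelWitness.
Variables (R : realType) (L : signature) (T : theory L).
Variables (N : prestructure R L) (NT : models_TR T N).

Let ma : measure_algebra N := model_measure_algebra NT.

Lemma inv_succ_small (e : R) : 0 < e ->
  exists K, forall k, (K <= k)%N -> (k.+1%:R)^-1 < e.
Proof.
move=> e0; exists (Num.truncn e^-1) => k Kk.
rewrite -[e]invrK ltf_pV2 ?posrE ?invr_gt0 ?ltr0n //.
by apply: lt_le_trans (truncnS_gt _) _; rewrite ler_nat.
Qed.

Lemma glue (x y : sortK N) (e : sortB N) :
  exists z, sub e (eqe z x) /\ sub (bneg N e) (eqe z y).
Proof.
have /choice[z zP] k : exists z, mu N (misglue z x y e) < (k.+1%:R)^-1.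
  by apply: (approx_glue NT); rewrite invr_gt0 ltr0n.
have [l lim] : exists l, forall d, 0 < d -> exists K, forall k, (K <= k)%N ->
    dK N (z k) l < d.
  case: (NT) => -[_ cK _ _] _; apply: cK => d d0.
  have [K hK] := @inv_succ_small (d / 2) (divr_gt0 d0 (ltr0Sn _ 1)).
  exists K => m n /hK hm /hK hn.
  apply: le_lt_trans (misglue_dist NT x y e (z m) (z n)) _.
  rewrite [d]splitr; apply: ltrD; first exact: lt_trans (zP m) hm.
  exact: lt_trans (zP n) hn.
suff h : mu N (misglue l x y e) = 0.
  exists l; move: h; rewrite /misglue /sub.
  set a := eqe l x; set b := eqe l y.
  by move=> h; split; move: h; mu_lra ma [:: a; b; e].
apply/eqP; rewrite eq_le mu_ge0 andbT; apply/ler_addgt0Pl => d d0.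
have d2 : 0 < d / 2 by lra.
have [K hK] := inv_succ_small d2; have [K' hK'] := lim _ d2.
have := hK _ (leq_maxl K K'); have := hK' _ (leq_maxr K K').
have := zP (maxn K K'); rewrite (model_dK NT).
set w := z _; have := eqe_sub2 NT w l x; have := eqe_sub2 NT w l y.
rewrite /sub /misglue.
have := eqe_sub2 NT l w x; have := eqe_sub2 NT l w y.
rewrite (eqe_sym NT l w) /sub.
set a := eqe w x; set b := eqe w y; set a' := eqe l x; set b' := eqe l y.
set c := eqe w l; set k := _^-1.
by mu_lra ma [:: a; b; a'; b'; c; e].
Qed.

Lemma limit_glue (z : nat -> sortK N) (G : nat -> sortB N) :
  (forall k, sub (G k) (G k.+1)) -> (forall k, sub (G k) (eqe (z k) (z k.+1))) ->
  (forall e : R, 0 < e -> exists k, mu N (bneg N (G k)) < e) ->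
  exists l, forall k, sub (G k) (eqe (z k) l).
Proof.
move=> GS zS Gsmall.
have Gz k m : (k <= m)%N -> sub (G k) (G m) /\ sub (G k) (eqe (z k) (z m)).
  move/subnK <-; elim: (m - k)%N => [|d [IH1 IH2]].
    by rewrite add0n (eqe_refl NT) // /sub; set x := G k; split; mu_lra ma [:: x].
  split; first exact: sub_trans IH1 (GS _).
  have := zS (d + k)%N; have := eqe_sub2 NT (z k) (z (d + k)%N) (z (d + k).+1).
  move: IH1 IH2; rewrite /sub addSn.
  set x := G k; set y := G _; set a := eqe _ _; set b := eqe _ _; set c := eqe _ _.
  by mu_lra ma [:: x; y; a; b; c].
have [l lim] : exists l, forall d, 0 < d -> exists K, forall k, (K <= k)%N ->
    dK N (z k) l < d.
  case: (NT) => -[_ cK _ _] _; apply: cK => d /Gsmall[K hK].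
  exists K => m n /Gz[_ hm] /Gz[_ hn]; rewrite (model_dK NT).
  have := eqe_sub2 NT (z m) (z K) (z n); move: hm hn hK.
  rewrite (eqe_sym NT (z m)) /sub.
  set x := G K; set a := eqe _ _; set b := eqe _ _; set c := eqe _ _.
  by mu_lra ma [:: x; a; b; c].
exists l => k; apply/eqP; rewrite eq_le mu_ge0 andbT.
apply/ler_addgt0Pl => d d0; have [K hK] := lim d d0.
have := hK _ (leq_maxl K k); have [_] := Gz _ _ (leq_maxr K k).
have := eqe_sub2 NT (z k) (z (maxn K k)) l; rewrite (model_dK NT) /sub.
set x := G k; set a := eqe (z k) (z _); set b := eqe (z (maxn K k)) l.
set c := eqe (z k) l.
by mu_lra ma [:: x; a; b; c].
Qed.

Lemma ev_subst1 n (phi : formula L n.+1) (c c' : sortK N) (a : 'I_n -> sortK N) :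
  sub (bmeet N (eqe c c') (ev N phi (vcons c a))) (ev N phi (vcons c' a)).
Proof.
apply: (ev_subst NT); apply: ordS_ind => [|i]; rewrite ?vcons0 ?vconsS.
  exact: sub_refl.
by rewrite (eqe_refl NT) /sub; set x := eqe _ _; mu_lra ma [:: x].
Qed.

Lemma approx_witness n (theta : formula L n.+1) (b : 'I_n -> sortK N) (r : R) :
  0 < r -> exists a, mu N (bmeet N (ev N (FEx theta) b)
    (bneg N (ev N theta (vcons a b)))) < r.
Proof.
move=> r0.
pose t := BMeet (BEv 0 (FEx theta) (lift ord0)) (BNeg (BEv 0 theta (@id 'I_n.+1))).
have [|a] := transfer_exK (Phi := CMu R t) NT _ b vnil r0.
  move=> M P MT nP a be; have [z ez] := nr_witness nP theta a.
  exists z => /=; rewrite (_ : _ \o lift ord0 = a) ?vcons_lift //.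
  rewrite -ez; set x := ev P theta _.
  by mu_lra (nice_measure_algebra nP) [:: x].
by rewrite /= (_ : _ \o lift ord0 = b) ?vcons_lift //; exists a.
Qed.

Lemma event_witness n (theta : formula L n.+1) (b : 'I_n -> sortK N) :
  exists a, sub (ev N (FEx theta) b) (ev N theta (vcons a b)).
Proof.
set E := ev N (FEx theta) b.
have /choice[a aP] k : exists a, mu N (bmeet N E (bneg N (ev N theta (vcons a b))))
    < (k.+1%:R)^-1.
  by apply: approx_witness; rewrite invr_gt0 ltr0n.
(* [G z] is the event where [z] is already a correct witness; it is never
   modified again. *)
pose G z := bjoin N (ev N theta (vcons z b)) (bneg N E).
have /choice[g gP] (kz : nat * sortK N) : exists z, sub (G kz.2) (eqe z kz.2) /\
    sub (bneg N (G kz.2)) (eqe z (a kz.1.+1)).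
  exact: glue.
have [z [z0 zS]] : exists z : nat -> sortK N,
    z 0%N = a 0%N /\ forall k, z k.+1 = g (k, z k).
  by exists (fix z k := if k is k'.+1 then g (k', z k') else a 0%N).
have zG k : sub (G (z k)) (G (z k.+1)).
  have := (gP (k, z k)).1; rewrite -zS /= /G (eqe_sym NT).
  have := ev_subst1 theta (z k) (z k.+1) b; rewrite /sub.
  set c := eqe _ _; set x := ev _ _ _; set y := ev _ _ _.
  by mu_lra ma [:: c; x; y; E].
have zeq k : sub (G (z k)) (eqe (z k) (z k.+1)).
  by rewrite zS (eqe_sym NT); case: (gP (k, z k)).
have zsmall k : mu N (bneg N (G (z k))) < (k.+1%:R)^-1.
  case: k => [|k].
    have := aP 0%N; rewrite z0 /G; set x := ev _ _ _.
    by set r := _^-1; mu_lra ma [:: x; E].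
  have := zG k; have := (gP (k, z k)).2; rewrite -zS /=; rewrite (eqe_sym NT) /G.
  have := ev_subst1 theta (a k.+1) (z k.+1) b; have := aP k.+1; rewrite /sub.
  set c := eqe _ _; set x := ev _ _ (vcons (a _) _).
  set y := ev _ _ (vcons (z k) _); set y' := ev _ _ (vcons (z k.+1) _).
  by set r := _^-1; mu_lra ma [:: c; x; y; y'; E].
have [|l lP] := limit_glue zG zeq.
  move=> e /inv_succ_small[K hK]; exists K.
  exact: lt_trans (zsmall K) (hK K (leqnn K)).
exists l; apply/eqP; rewrite eq_le mu_ge0 andbT.
apply/ler_addgt0Pl => d /inv_succ_small[K /(_ K (leqnn _))].
have := zsmall K; have := lP K; have := ev_subst1 theta (z K) l b.
rewrite /sub /G.
set c := eqe _ _; set x := ev _ _ (vcons (z K) _); set y := ev _ _ (vcons l _).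
by set r := _^-1; mu_lra ma [:: c; x; y; E].
Qed.

(** The differences of consecutive terms are countably many disjoint events of positive measure that
    exhaust the space, a place for infinitely many types. *)
Lemma halving_sequence : exists H : nat -> sortB N, [/\ H 0%N = btop N,
  forall k, sub (H k.+1) (H k), forall k, mu N (H k.+1) = mu N (H k) / 2 &
  forall e : R, 0 < e -> exists k, mu N (H k) < e].
Proof.
have /choice[f fP] x : exists y, sub y x /\ mu N y = mu N x / 2.
  have [|y yx hy] := @model_sierpinski _ _ _ _ NT x (mu N x / 2).
    by have := mu_ge0 x; move=> h; apply/andP; split; lra.
  by exists y.
have [H [H0 HS]] : exists H : nat -> sortB N,
    H 0%N = btop N /\ forall k, H k.+1 = f (H k).
  by exists (fun k => iter k f (btop N)).
exists H; split=> // [k|k|e /inv_succ_small[K hK]]; try by rewrite HS; case: (fP (H k)).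
exists K; apply: le_lt_trans (hK K (leqnn _)).
rewrite -[leRHS]mul1r ler_pdivlMr ?ltr0n //.
elim: K {hK} => [|K IH]; first by rewrite H0 (ma_top ma) mulr1.
have -> : mu N (H K.+1) = mu N (H K) / 2 by rewrite HS; case: (fP (H K)).
have := mu_ge0 (H K); move: IH; rewrite -[K.+2%:R]natr1 -natr1.
have : 0 <= K%:R :> R by []. nra.
Qed.

(** Stage [k] puts [y k] on all of [H k]; later stages change only what lies in [H k.+1]. *)
Lemma countable_glue (H : nat -> sortB N) (y : nat -> sortK N) :
  (forall k, sub (H k.+1) (H k)) ->
  (forall e : R, 0 < e -> exists k, mu N (H k) < e) ->
  exists z, forall k, sub (bmeet N (H k) (bneg N (H k.+1))) (eqe z (y k)).
Proof.
move=> HS Hsmall.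
have /choice[g gP] (kz : nat * sortK N) : exists z,
    sub (H kz.1) (eqe z (y kz.1)) /\ sub (bneg N (H kz.1)) (eqe z kz.2).
  exact: glue.
have [z zS] : exists z : nat -> sortK N, forall k, z k.+1 = g (k, z k).
  by exists (fix z k := if k is k'.+1 then g (k', z k') else y 0%N).
have [|||l lP] := @limit_glue z (fun k => bneg N (H k)).
- move=> k; have := HS k; rewrite /sub; set a := H k; set b := H k.+1.
  by mu_lra ma [:: a; b].
- by move=> k; rewrite zS (eqe_sym NT); case: (gP (k, z k)).
- move=> e /Hsmall[k hk]; exists k; move: hk.
  by set a := H k; mu_lra ma [:: a].
exists l => k; have := lP k.+1; have := (gP (k, z k)).1.
rewrite -zS /= (eqe_sym NT (z k.+1) l).
have := eqe_sub2 NT l (z k.+1) (y k); rewrite /sub.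
set a := eqe _ _; set b := eqe _ _; set c := eqe _ _; set u := H k; set v := H k.+1.
by mu_lra ma [:: a; b; c; u; v].
Qed.

End ModelWitness.

(** * Types of tuples of random elements *)

Section Partitions.
Variables (R : realType) (L : signature) (T : theory L).
Variables (N : prestructure R L) (NT : models_TR T N).

Let ma : measure_algebra N := model_measure_algebra NT.

Definition disjoint_events (I : finType) (G : I -> sortB N) : Prop :=
  forall i j, i != j -> mu N (bmeet N (G i) (G j)) = 0.

(** The law of total probability, taken as the definition because it is the form in which partitions
    are used; it implies disjointness and total measure 1. *)
Definition event_partition (I : finType) (G : I -> sortB N) : Prop :=
  forall x, mu N x = \sum_i mu N (bmeet N x (G i)).

Lemma disjoint_sum (I : finType) (G : I -> sortB N) (x : sortB N) (s : seq I) :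
  disjoint_events G -> uniq s ->
  mu N (bmeet N x (\big[bjoin N/bbot N]_(i <- s) G i)) =
  \sum_(i <- s) mu N (bmeet N x (G i)).
Proof.
move=> dG; elim: s => [|i s IH] /=.
  by rewrite !big_nil => _; mu_lra ma [:: x].
move=> /andP[nis us]; rewrite !big_cons -IH //.
set U := \big[_/_]_(_ <- _) _.
suff : mu N (bmeet N (G i) U) = 0.
  by set y := G i; mu_lra ma [:: x; y; U].
rewrite {}/U; elim: s nis {IH us} => [|j s IH].
  by rewrite big_nil; set y := G i; mu_lra ma [:: y].
rewrite inE negb_or => /andP[ij /IH]; rewrite big_cons; move: (dG _ _ ij).
set U := \big[_/_]_(_ <- _) _; set y := G i; set z := G j.
by mu_lra ma [:: y; z; U].
Qed.

Lemma event_partitionP (I : finType) (G : I -> sortB N) :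
  disjoint_events G -> \sum_i mu N (G i) = 1 -> event_partition G.
Proof.
move=> dG G1 x.
have U1 : mu N (\big[bjoin N/bbot N]_i G i) = 1.
  have := disjoint_sum (btop N) dG (index_enum_uniq I).
  rewrite (eq_bigr (fun i => mu N (G i))) => [|i _].
    by rewrite G1; set U := \big[_/_]_i _; mu_lra ma [:: U].
  by set y := G i; mu_lra ma [:: y].
rewrite -(disjoint_sum x dG (index_enum_uniq I)).
move: U1; set U := \big[_/_]_i _; have := ma_top ma.
by mu_lra ma [:: x; U].
Qed.

Lemma partition_sub (I : finType) (G : I -> sortB N) x y :
  event_partition G ->
  (forall i, mu N (bmeet N (bmeet N x (bneg N y)) (G i)) = 0) -> sub x y.
Proof. by move=> pG h; rewrite /sub pG big1. Qed.

Lemma finite_glue (I : finType) (G : I -> sortB N) (y : I -> sortK N) :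
  disjoint_events G -> exists z, forall i, sub (G i) (eqe z (y i)).
Proof.
move=> dG; case: (sortK_inh N) => k0.
suff [z zP] : exists z, forall i, i \in index_enum I -> sub (G i) (eqe z (y i)).
  by exists z => i; apply: zP; rewrite mem_index_enum.
elim: (index_enum I) (index_enum_uniq I) => [|i s IH] /=; first by exists k0.
move=> /andP[nis /IH[z zP]].
have [z' [z1 z2]] := glue NT (y i) z (G i).
exists z' => j; rewrite inE => /predU1P[->//|js].
have /dG : i != j by apply: contraNneq nis => ->.
move: (zP j js) z1 z2; have := eqe_sub2 NT z' z (y j); rewrite /sub.
set a := eqe _ _; set b := eqe _ _; set c := eqe _ _; set d := eqe _ _.
set u := G i; set v := G j.
by mu_lra ma [:: a; b; c; u; v].
Qed.

Lemma event_split (I : finType) (r : I -> R) (x : sortB N) :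
  (forall i, 0 <= r i) -> \sum_i r i = mu N x ->
  exists G : I -> sortB N, disjoint_events G /\
    forall i, sub (G i) x /\ mu N (G i) = r i.
Proof.
move=> r0 rx.
suff [G GP] : exists G : I -> sortB N,
    (forall i j, i \in index_enum I -> j \in index_enum I -> i != j ->
      mu N (bmeet N (G i) (G j)) = 0) /\
    forall i, i \in index_enum I -> sub (G i) x /\ mu N (G i) = r i.
  exists G; split=> [i j ij|i]; first by apply: GP.1 => //; rewrite mem_index_enum.
  by apply: GP.2; rewrite mem_index_enum.
(* The equality is relaxed so that the induction applies to a tail of the index list. *)
have {rx} : \sum_i r i <= mu N x by rewrite rx.
elim: (index_enum I) (index_enum_uniq I) x => [|i s IH] /=.
  by move=> _ x _; exists (fun=> x).
move=> /andP[nis us] x; rewrite big_cons => rx.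
have s0 : 0 <= \sum_(j <- s) r j by apply: sumr_ge0 => j _.
have [|y yx yr] := @model_sierpinski _ _ _ _ NT x (r i).
  by rewrite r0 /=; lra.
have [|G [dG GP]] := IH us (bmeet N x (bneg N y)).
  by move: yx rx; rewrite -yr /sub; set q := \sum_(_ <- _) _; mu_lra ma [:: x; y].
exists (fun j => if j == i then y else G j).
have hs j : j \in i :: s -> j != i -> j \in s.
  by rewrite inE => /orP[->|].
have yG j : j \in s -> mu N (bmeet N y (G j)) = 0.
  move=> /GP[h _]; move: h; rewrite /sub; set z := G j.
  by mu_lra ma [:: x; y; z].
split=> [j k js ks jk|j js].
  case: eqP => ji; case: eqP => ki.
  - by rewrite ji ki eqxx in jk.
  - by apply: yG; apply: hs => //; apply/eqP.
  - have := yG j (hs _ js (introN eqP ji)).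
    by set z := G j; mu_lra ma [:: y; z].
  - by apply: dG => //; apply: hs => //; apply/eqP.
case: eqP => [->//|ji].
have [h1 h2] := GP j (hs _ js (introN eqP ji)); split=> //.
by move: h1; rewrite /sub; set z := G j; mu_lra ma [:: x; y; z].
Qed.

Lemma realize (I : finType) (G : I -> sortB N) n (a : 'I_n -> sortK N)
    (theta : I -> formula L n.+1) : disjoint_events G ->
  (forall i, sub (G i) (ev N (FEx (theta i)) a)) ->
  exists d, forall i, sub (G i) (ev N (theta i) (vcons d a)).
Proof.
move=> dG hG.
have /choice[y yP] i := event_witness NT (theta i) a.
have [d dP] := finite_glue y dG.
exists d => i; have := ev_subst1 NT (theta i) (y i) d a.
move: (hG i) (dP i) (yP i); rewrite (eqe_sym NT d) /sub.
set u := eqe _ _; set v := G i; set w := ev _ _ (vcons d a).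
set w' := ev _ _ (vcons _ a); set z := ev _ _ a.
by mu_lra ma [:: u; v; w; w'; z].
Qed.

Lemma types_partition n (I : finType) (theta : I -> formula L n) a :
  type_partition T theta -> event_partition (fun i => ev N (theta i) a).
Proof.
move=> [_ cov dis].
have dG : disjoint_events (fun i => ev N (theta i) a).
  move=> i j ij; rewrite -(ev_and NT); apply: (ev_unsat NT) => -[M MT [v [vi vj]]].
  by rewrite (dis M MT v i j vi vj) eqxx in ij.
apply: event_partitionP => //.
have := disjoint_sum (btop N) dG (index_enum_uniq I).
rewrite (eq_bigr (fun i => mu N (ev N (theta i) a))) => [<-|i _]; last first.
  by set y := ev _ _ _; mu_lra ma [:: y].
have -> : \big[bjoin N/bbot N]_i ev N (theta i) a = btop N.
  have ev0 : ev N (FFalse n) a = bbot N.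
    apply: (event_eq NT); last by rewrite /sub; set y := ev _ _ _; mu_lra ma [:: y].
    have : mu N (ev N (FFalse n) a) = 0.
      by apply: (ev_unsat NT) => -[M _ [v]]; apply; apply: sat_true.
    by rewrite /sub; set y := ev _ _ _; mu_lra ma [:: y].
  rewrite -(big_morph (fun phi => ev N phi a) (fun phi psi => ev_or NT phi psi a) ev0).
  apply: (ev_valid NT) => M MT v; apply/sat_bigor.
  by have [i vi] := cov M MT v; exists i.
by have := ma_top ma; mu_lra ma (@nil (sortB N)).
Qed.

Lemma partition_total (I : finType) (G : I -> sortB N) :
  event_partition G -> \sum_i mu N (G i) = 1.
Proof.
move=> pG; rewrite -(ma_top ma) pG; apply: eq_bigr => i _.
by set y := G i; mu_lra ma [:: y].
Qed.

Lemma partition_disjoint (I : finType) (G : I -> sortB N) :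
  event_partition G -> disjoint_events G.
Proof.
move=> pG i j ij; have := pG (G i); rewrite (bigD1 i) //=.
have -> : mu N (bmeet N (G i) (G i)) = mu N (G i).
  by set y := G i; mu_lra ma [:: y].
move=> h; have {h} : \sum_(k | k != i) mu N (bmeet N (G i) (G k)) = 0 by lra.
move/psumr_eq0P; apply; last by rewrite eq_sym.
by move=> k _; apply: mu_ge0.
Qed.

(** Defined through first-order events only; [ceval_eqtp] shows that, with finitely many types, all
    continuous formulas then agree too. *)
Definition eqtp n (a b : 'I_n -> sortK N) : Prop :=
  forall phi : formula L n, mu N (ev N phi a) = mu N (ev N phi b).

Lemma ev_atom n (I : finType) (theta : I -> formula L n) (phi : formula L n) a i :
  type_partition T theta ->
  mu N (bmeet N (ev N phi a) (ev N (theta i) a)) =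
  if `[< timp T (theta i) phi >] then mu N (ev N (theta i) a) else 0.
Proof.
move=> [iso _ _]; case: asboolP => h.
  by have := ev_timp NT a h; rewrite /sub; set x := ev _ _ _; set y := ev _ _ _;
    mu_lra ma [:: x; y].
case: (iso i phi) => // /(ev_timp NT a); rewrite (ev_not NT) /sub.
by set x := ev _ _ _; set y := ev _ _ _; mu_lra ma [:: x; y].
Qed.

Lemma eqtp_atoms n (I : finType) (theta : I -> formula L n) a b :
  type_partition T theta ->
  (forall i, mu N (ev N (theta i) a) = mu N (ev N (theta i) b)) -> eqtp a b.
Proof.
move=> tp h phi; rewrite (types_partition a tp) (types_partition b tp (ev N phi b)).
by apply: eq_bigr => i _; rewrite !ev_atom // h.
Qed.

Lemma mu_ev_atom n (J : finType) (theta : J -> formula L n) a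
    (I : finType) (G : I -> sortB N) (f : I -> J) :
  type_partition T theta -> event_partition G ->
  (forall i, sub (G i) (ev N (theta (f i)) a)) ->
  forall j, mu N (ev N (theta j) a) = \sum_(i | f i == j) mu N (G i).
Proof.
move=> tp pG hG j; rewrite pG (bigID (fun i => f i == j)) /=.
rewrite [X in _ + X]big1 ?addr0 => [|i fij].
  apply: eq_bigr => i /eqP <-; move: (hG i); rewrite /sub.
  by set x := ev _ _ _; set y := G i; mu_lra ma [:: x; y].
have := partition_disjoint (types_partition a tp) fij.
move: (hG i); rewrite /sub.
by set x := ev _ _ _; set y := G i; set z := ev _ _ _; mu_lra ma [:: x; y; z].
Qed.

Hypothesis ft : forall n, finite_types T n.

(** The back-and-forth step. Each type event [e' i] of [b] has the measure of [e i], so it can be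
    cut into pieces [H i j] as large as the parts of [e i] on which [(c, a)] has type [j]; [d] is
    then realized with type [j] on each of these pieces. *)
Lemma eqtp_extend n (a b : 'I_n -> sortK N) c : eqtp a b ->
  exists d, eqtp (vcons c a) (vcons d b).
Proof.
move=> ab; have [I [chi chiP]] := ft n; have [J [theta thetaP]] := ft n.+1.
pose e i := ev N (chi i) a; pose e' i := ev N (chi i) b.
pose G j := ev N (theta j) (vcons c a).
have pe : event_partition e by apply: types_partition.
have pe' : event_partition e' by apply: types_partition.
have pG : event_partition G by apply: types_partition.
have /choice[H HP] i : exists H : J -> sortB N, disjoint_events H /\
    forall j, sub (H j) (e' i) /\ mu N (H j) = mu N (bmeet N (e i) (G j)).
  by apply: event_split => [j|]; rewrite ?mu_ge0 // -pG -ab.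
pose K (ij : I * J) := H ij.1 ij.2.
have pK : event_partition K.
  apply: event_partitionP => [[i j] [i' j']|].
    rewrite xpair_eqE negb_and /K /=.
    case: (eqVneq i i') => [<-|ii' _]; first exact: (HP i).1.
    have := partition_disjoint pe' ii'.
    move: ((HP i).2 j).1 ((HP i').2 j').1; rewrite /sub.
    set x := e' i; set x' := e' i'; set y := H i j; set y' := H i' j'.
    by mu_lra ma [:: x; x'; y; y'].
  rewrite -(partition_total pe).
  rewrite -(pair_bigA_idem (addr0 _) (fun i j => mu N (H i j))) /=.
  by apply: eq_bigr => i _; rewrite pG; apply: eq_bigr => j _; case: ((HP i).2 j).
have [|d dP] := @realize _ K n b (fun ij => theta ij.2) (partition_disjoint pK).
  move=> [i j] /=; rewrite /K /=; have [h1 h2] := (HP i).2 j.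
  (* If type [j] extends type [i], isolation makes [chi i] imply [FEx (theta j)]; if not, the piece
     is null. *)
  case: (pselect (consistent T (FAnd (ren (chi i) (lift ord0)) (theta j)))) => hc.
    have [iso _ _] := chiP; apply: sub_trans ma _ _ _ h1 _; apply: (ev_timp NT).
    case: (iso i (FEx (theta j))) => // h.
    case: hc => M MT [v]; rewrite sat_and sat_ren => -[/(h M MT) nh vj].
    by case: nh; exists (v ord0); rewrite vcons_eta.
  have := ev_unsat NT (vcons c a) hc; rewrite (ev_and NT) (ev_ren NT) vcons_lift.
  rewrite -/(e i) -/(G j) -h2 /sub; set x := H i j; set y := ev _ _ _.
  by mu_lra ma [:: x; y].
exists d; apply: (eqtp_atoms thetaP) => j.
rewrite (mu_ev_atom (f := snd) thetaP pK dP) -/(G j) pe.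
rewrite -(pair_big xpredT (pred1 j) (fun i k => mu N (H i k))) /=.
apply: eq_bigr => i _; rewrite big_pred1_eq ((HP i).2 j).2.
by set x := e i; set y := G j; mu_lra ma [:: x; y].
Qed.

Lemma beval_formula p q (t : bterm L p q) n (x : 'I_p -> 'I_n)
    (psi : 'I_q -> formula L n) : exists chi : formula L n,
  forall a, beval (a \o x) (fun j => ev N (psi j) a) t = ev N chi a.
Proof.
elim: t => [j|m phi y|||s [f IHf] t [g IHg]|s [f IHf] t [g IHg]|s [f IHf]] /=.
- by exists (psi j).
- by exists (ren phi (x \o y)) => a; rewrite (ev_ren NT).
- by exists (FTrue n) => a; rewrite (ev_valid NT) // => M MT v; apply: sat_true.
- exists (FFalse n) => a; apply: (event_eq NT); last first.
    have : mu N (ev N (FFalse n) a) = 0.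
      by apply: (ev_unsat NT) => -[M _ [v]]; apply; apply: sat_true.
    by rewrite /sub; set y := ev _ _ _; mu_lra ma [:: y].
  by rewrite /sub; set y := ev _ _ _; mu_lra ma [:: y].
- by exists (FAnd f g) => a; rewrite IHf IHg (ev_and NT).
- by exists (FOr f g) => a; rewrite IHf IHg (ev_or NT).
- by exists (FNot f) => a; rewrite IHf (ev_not NT).
Qed.

Lemma distinct_elements :
  (forall M : structure L, models M T -> exists a b : M, a <> b) ->
  exists x y : sortK N, mu N (eqe x y) = 0.
Proof.
move=> two; case: (sortK_inh N) => x.
have [y hy] := event_witness NT
  (FNot (FEq (TVar L ord0) (TVar L (lift ord0 ord0)))) (fun _ : 'I_1 => x).
exists y, x; move: hy; rewrite (ev_valid NT) => [|M MT v].
  rewrite (ev_not NT) (ev_fun_eq NT) vcons0 vconsS /sub.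
  by set u := eqe _ _; mu_lra ma [:: u].
have [a [b ab]] := two M MT.
case: (pselect (a = v ord0)) => [e|na].
  by exists b; rewrite /= vcons0 vconsS -e; apply/nesym.
by exists a; rewrite /= vcons0 vconsS.
Qed.

(* Every event is of the form [d = c], so the events occurring in a formula can
   be coded by random elements. *)
Lemma event_code (e : sortB N) (x y : sortK N) : mu N (eqe x y) = 0 ->
  exists z, eqe z x = e /\ sub e (eqe z x) /\ sub (bneg N e) (eqe z y).
Proof.
move=> xy; have [z [zx zy]] := glue NT x y e; exists z; split=> //.
apply: (event_eq NT) => //; move: zx zy xy (eqe_sub2 NT x z y).
rewrite (eqe_sym NT x z) /sub.
set a := eqe z x; set b := eqe z y; set c := eqe x y.
by mu_lra ma [:: a; b; c; e].
Qed.

Hypothesis two : forall M : structure L, models M T -> exists a b : M, a <> b.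

(** Under a quantifier the tuples [a] and [b] are extended in parallel, and the two ranges of values
    coincide. The map [x] and the formulas [psi] let the tuple contain more entries than [Phi]
    mentions, which the coding of events requires. *)
Lemma ceval_eqtp p q (Phi : cformula R L p q) n (x : 'I_p -> 'I_n)
    (psi : 'I_q -> formula L n) (a b : 'I_n -> sortK N) : eqtp a b ->
  ceval Phi (a \o x) (fun j => ev N (psi j) a) =
  ceval Phi (b \o x) (fun j => ev N (psi j) b).
Proof.
have eqtp_sym m (u v : 'I_m -> sortK N) : eqtp u v -> eqtp v u.
  by move=> uv phi; rewrite uv.
have upE m (z : sortK N) (u : 'I_m -> sortK N) r (y : 'I_r -> 'I_m) :
    vcons z (u \o y) = vcons z u \o up y by rewrite vcons_up.
have rangeK p' q' (Psi : cformula R L p'.+1 q')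
    (IH : forall m (x : 'I_p'.+1 -> 'I_m) (psi : 'I_q' -> formula L m)
      (a b : 'I_m -> sortK N), eqtp a b ->
      ceval Psi (a \o x) (fun j => ev N (psi j) a) =
      ceval Psi (b \o x) (fun j => ev N (psi j) b)) m (y : 'I_p' -> 'I_m)
    (ps : 'I_q' -> formula L m) (u v : 'I_m -> sortK N) : eqtp u v ->
    range (fun z => ceval Psi (vcons z (u \o y)) (fun j => ev N (ps j) u)) `<=`
    range (fun z => ceval Psi (vcons z (v \o y)) (fun j => ev N (ps j) v)).
  move=> uv _ [z _ <-]; have [z' zz'] := eqtp_extend z uv; exists z' => //.
  have := IH _ (up y) (fun j => ren (ps j) (lift ord0)) _ _ zz'.
  rewrite !vcons_up => e; symmetry.
  rewrite (_ : (fun j => ev N (ps j) u) = (fun j =>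
    ev N (ren (ps j) (lift ord0)) (vcons z u))).
    rewrite e; congr ceval; apply/funext => j.
    by rewrite (ev_ren NT) vcons_lift.
  by apply/funext => j; rewrite (ev_ren NT) vcons_lift.
have rangeB p' q' (Psi : cformula R L p' q'.+1)
    (IH : forall m (x : 'I_p' -> 'I_m) (psi : 'I_q'.+1 -> formula L m)
      (a b : 'I_m -> sortK N), eqtp a b ->
      ceval Psi (a \o x) (fun j => ev N (psi j) a) =
      ceval Psi (b \o x) (fun j => ev N (psi j) b)) m (y : 'I_p' -> 'I_m)
    (ps : 'I_q' -> formula L m) (u v : 'I_m -> sortK N) : eqtp u v ->
    range (fun z => ceval Psi (u \o y) (vcons z (fun j => ev N (ps j) u))) `<=`
    range (fun z => ceval Psi (v \o y) (vcons z (fun j => ev N (ps j) v))).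
  (* The event [e] is written as the agreement of [z] with [c]. Extending [v] by counterparts [c']
     and [z'] yields the matching event [eqe z' c']. *)
  move=> uv _ [e _ <-].
  have [c [d cd]] := distinct_elements two.
  have [z [ze _]] := event_code e cd.
  have [c' cc'] := eqtp_extend c uv; have [z' zz'] := eqtp_extend z cc'.
  exists (eqe z' c') => //.
  pose s : 'I_m -> 'I_m.+2 := lift ord0 \o lift ord0.
  pose ps' : 'I_q'.+1 -> formula L m.+2 :=
    vcons (FEq (TVar L ord0) (TVar L (lift ord0 ord0))) (fun j => ren (ps j) s).
  have psE w1 w2 (w : 'I_m -> sortK N) :
      (fun j => ev N (ps' j) (vcons w1 (vcons w2 w))) =
      vcons (eqe w1 w2) (fun j => ev N (ps j) w).
    apply/funext; apply: ordS_ind => [|j]; rewrite /ps' ?vcons0 ?vconsS.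
      by rewrite (ev_fun_eq NT) vcons0 vconsS vcons0.
    rewrite (ev_ren NT) /s; congr ev.
    by apply/funext => i; rewrite /= !vconsS.
  have sE w1 w2 (w : 'I_m -> sortK N) : vcons w1 (vcons w2 w) \o (s \o y) = w \o y.
    by apply/funext => i; rewrite /= /s /= !vconsS.
  by have := IH _ (s \o y) ps' _ _ zz'; rewrite !psE !sE ze.
elim: Phi n x psi a b => {p q} [p q s|p q i j|p q s t|p q m u args IH|p q Phi IH
  |p q Phi IH|p q Phi IH|p q Phi IH] n x psi a b ab /=.
- by have [chi h] := beval_formula s x psi; rewrite !h.
- rewrite !(model_dK NT).
  have := ab (FNot (FEq (TVar L (x i)) (TVar L (x j)))).
  by rewrite !(ev_not NT) !(ev_fun_eq NT).
- rewrite !(ma_dist ma).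
  have [f hf] := beval_formula s x psi; have [g hg] := beval_formula t x psi.
  rewrite !hf !hg -!(ev_not NT) -!(ev_and NT) -!(ev_or NT).
  exact: ab.
- by congr (u _); apply/rowP => i; rewrite !mxE; apply: IH.
- by congr sup; apply/seteqP; split; apply: rangeK => //; apply: eqtp_sym.
- by congr inf; apply/seteqP; split; apply: rangeK => //; apply: eqtp_sym.
- by congr sup; apply/seteqP; split; apply: rangeB => //; apply: eqtp_sym.
- by congr inf; apply/seteqP; split; apply: rangeB => //; apply: eqtp_sym.
Qed.

End Partitions.

(** * Definable closures *)

Lemma finite_enum (X : Type) (A : set X) : finite_set A ->
  exists n (a : 'I_n -> X), (forall i, A (a i)) /\ forall x, A x -> exists i, a i = x.
Proof.
move=> /finite_setP[n /card_set_bijP[f [fA finj fsurj]]].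
have /choice[a aP] (i : 'I_n) : exists x, A x /\ f x = i.
  by have [x Ax fx] := fsurj i (ltn_ord i); exists x.
exists n, a; split=> [i|x Ax]; first by case: (aP i).
exists (Ordinal (fA x Ax)).
by apply: finj; rewrite ?inE //; case: (aP (Ordinal (fA x Ax))).
Qed.

Section Closures.
Variables (R : realType) (L : signature) (T : theory L).
Variables (N : prestructure R L) (NT : models_TR T N).

Let ma : measure_algebra N := model_measure_algebra NT.

Lemma fdclB_tuple n (a : 'I_n -> sortK N) :
  fdclB (range a) = range (fun phi => ev N phi a).
Proof.
apply/seteqP; split=> [_ [k [phi [b [bA ->]]]]|_ [phi _ <-]]; last first.
  by exists n, phi, a; split=> // i; exists i.
have /choice[x xP] i : exists j, a j = b i by have [j _ <-] := bA i; exists j.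
exists (ren phi x) => //; rewrite (ev_ren NT); congr ev.
exact/funext.
Qed.

Lemma functional_ren k n (phi : formula L k.+1) (x : 'I_k -> 'I_n) :
  functional_formula T phi -> functional_formula T (ren phi (up x)).
Proof.
by move=> h M MT v u u'; rewrite !sat_ren !vcons_up; apply: h.
Qed.

Lemma fdcl_tuple n (a : 'I_n -> sortK N) b : fdcl T (range a) b <->
  exists2 phi : formula L n.+1, functional_formula T phi &
    ev N phi (vcons b a) = btop N.
Proof.
split=> [[k [phi [c [phif cA pb]]]]|[phi phif pb]]; last first.
  by exists n, phi, a; split=> // i; exists i.
have /choice[x xP] i : exists j, a j = c i by have [j _ <-] := cA i; exists j.
exists (ren phi (up x)); first exact: functional_ren.
rewrite (ev_ren NT) vcons_up -pb; congr (ev N phi (vcons b _)).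
exact/funext.
Qed.

Lemma functional_eqe n (phi : formula L n.+1) (a : 'I_n -> sortK N) b :
  functional_formula T phi -> ev N phi (vcons b a) = btop N ->
  forall x, ev N phi (vcons x a) = eqe x b.
Proof.
move=> phif pb x; apply: (event_eq NT).
  pose f : 'I_n.+1 -> 'I_n.+2 := vcons ord0 (lift ord0 \o lift ord0).
  have fE (X : Type) (y z : X) (v : 'I_n -> X) : vcons y (vcons z v) \o f = vcons y v.
    rewrite /f vcons_comp vcons0; congr vcons.
    by apply/funext => i; rewrite /= !vconsS.
  have := @ev_timp _ _ _ _ NT _ (FAnd (ren phi f) (ren phi (lift ord0)))
    (FEq (TVar L ord0) (TVar L (lift ord0 ord0))) (vcons x (vcons b a)).
  rewrite (ev_and NT) !(ev_ren NT) fE vcons_lift (ev_fun_eq NT) vconsS !vcons0 pb.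
  move=> h; have {h} : sub (bmeet N (ev N phi (vcons x a)) (btop N)) (eqe x b).
    apply: h => M MT v; rewrite sat_and !sat_ren => -[h1 h2] /=.
    move: h1 h2; rewrite -(vcons_eta v) -(vcons_eta (v \o lift ord0)) fE vcons_lift.
    by rewrite vconsS !vcons0; apply: phif MT _ _ _.
  by rewrite /sub; set u := ev _ _ _; set w := eqe _ _; mu_lra ma [:: u; w].
have := ev_subst1 NT phi b x a; rewrite pb (eqe_sym NT b) /sub.
by set u := ev _ _ _; set w := eqe _ _; mu_lra ma [:: u; w].
Qed.

Lemma functional_dist n (phi : formula L n.+1) (a : 'I_n -> sortK N) b :
  functional_formula T phi -> ev N phi (vcons b a) = btop N ->
  forall x, dK N x b = mu N (bneg N (ev N phi (vcons x a))).
Proof. by move=> phif pb x; rewrite (model_dK NT) (functional_eqe phif pb). Qed.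

Lemma abs_triangle (X : Type) (d : X -> X -> R) : pseudometric01 d ->
  forall x y z, `|d x y - d x z| <= d y z.
Proof.
move=> [_ _ dC dT] x y z; rewrite ler_norml.
have := dT x y z; have := dT x z y; rewrite (dC z y).
by move=> h1 h2; apply/andP; split; lra.
Qed.

Lemma dclB_limit (A : set (sortK N)) b :
  (forall e : R, 0 < e -> exists2 c, fdclB A c & dB N c b < e) -> dclB A b.
Proof.
move=> h.
have /choice[s sP] k : exists s : {n : nat & (formula L n * ('I_n -> sortK N))%type},
    (forall i, A ((projT2 s).2 i)) /\
    dB N (ev N (projT2 s).1 (projT2 s).2) b < (k.+1%:R)^-1.
  have [|c [n [phi [a [aA ->]]]] cb] := h (k.+1%:R)^-1.
    by rewrite invr_gt0 ltr0n.
  by exists (existT _ n (phi, a)).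
exists (fun k => projT1 (s k)),
  (fun k => CDistB R (BVar L _ (ord0 : 'I_1)) (BEv 1 (projT2 (s k)).1 id)),
  (fun k => (projT2 (s k)).2); split=> [k i|e e0]; first by case: (sP k).
have [K hK] := inv_succ_small e0; exists K => k /hK ke x /=.
rewrite vcons0; apply: le_lt_trans (abs_triangle (dB_pseudo N) _ _ _) _.
exact: lt_trans (sP k).2 ke.
Qed.

(** The approximating element [c] need not be a parameter, so its distance function is expressed as
    the measure of the failure of its functional formula. *)
Lemma dcl_limit (A : set (sortK N)) b :
  (forall e : R, 0 < e -> exists2 c, fdcl T A c & dK N c b < e) -> dcl A b.
Proof.
move=> h.
have /choice[s sP] k : exists s : {n : nat & (formula L n.+1 * ('I_n -> sortK N))%type},
    (forall i, A ((projT2 s).2 i)) /\ exists2 c,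
      (forall x, dK N x c = mu N (bneg N (ev N (projT2 s).1 (vcons x (projT2 s).2)))) &
      dK N c b < (k.+1%:R)^-1.
  have [|c [n [phi [a [phif aA pc]]]] cb] := h (k.+1%:R)^-1.
    by rewrite invr_gt0 ltr0n.
  exists (existT _ n (phi, a)); split=> //; exists c => //.
  exact: functional_dist phif pc.
exists (fun k => projT1 (s k)),
  (fun k => CMu R (BNeg (BEv 0 (projT2 (s k)).1 id))),
  (fun k => (projT2 (s k)).2); split=> [k i|e e0]; first by case: (sP k).
have [K hK] := inv_succ_small e0; exists K => k /hK ke x /=.
have [_ [c cE cb]] := sP k; rewrite -cE.
apply: le_lt_trans (abs_triangle (dK_pseudo N) _ _ _) _.
exact: lt_trans cb ke.
Qed.

Lemma fdclB_dclB (A : set (sortK N)) : fdclB A `<=` dclB A.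
Proof.
move=> b bA; apply: dclB_limit => e e0; exists b => //.
by case: (dB_pseudo N) => _ ->.
Qed.

Lemma fdcl_dcl (A : set (sortK N)) : fdcl T A `<=` dcl A.
Proof.
move=> b bA; apply: dcl_limit => e e0; exists b => //.
by case: (dK_pseudo N) => _ ->.
Qed.

Hypothesis ft : forall n, finite_types T n.
Hypothesis two : forall M : structure L, models M T -> exists a b : M, a <> b.

(** The formulas over [a] that approximate the distance to [b] take the same values at [b] and [b'],
    so [b'] is at distance 0 from [b]. *)
Lemma dcl_eqtp n (a : 'I_n -> sortK N) b b' : dcl (range a) b ->
  eqtp (vcons b a) (vcons b' a) -> b' = b.
Proof.
move=> [m [Phi [c [cA lim]]]] bb'.
case: (NT) => -[sepK _ _ _] _; apply: sepK.
case: (dK_pseudo N) => _ dK0 _ _; rewrite -(dK0 b); apply: esym.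
have [u hu] : exists u : nat -> R, forall k,
    ceval (Phi k) (vcons b (c k)) vnil = u k /\
    ceval (Phi k) (vcons b' (c k)) vnil = u k.
  exists (fun k => ceval (Phi k) (vcons b (c k)) vnil) => k; split=> //.
  have /choice[x xP] i : exists j, a j = c k i by have [j _ <-] := cA k i; exists j.
  have -> : c k = a \o x by exact/esym/funext.
  have := ceval_eqtp NT ft two (Phi k) (up x) vnil bb'.
  by rewrite !vcons_up (eq_ord0_fun (fun j => _) vnil)
    (eq_ord0_fun (fun j => ev N (vnil j) (vcons b' a)) vnil).
have h e : 0 < e -> exists k, `|u k - dK N b b| < e /\ `|u k - dK N b' b| < e.
  move=> /lim[K /(_ K (leqnn K)) hK]; exists K.
  by have := hK b; have := hK b'; rewrite (hu K).1 (hu K).2.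
apply/eqP; rewrite -subr_eq0 -normr_le0; apply/ler_addgt0Pl => e e0.
have [k [h1 h2]] := h (e / 2) (divr_gt0 e0 (ltr0Sn _ 1)).
have -> : dK N b b - dK N b' b = (u k - dK N b' b) - (u k - dK N b b) by lra.
by apply: le_trans (ler_normB _ _) _; lra.
Qed.

(** The counterpart for events. An event has no type of its own here, so it is presented as [psi] of
    a tuple [t] that contains [a]. *)
Lemma dclB_eqtp n (a : 'I_n -> sortK N) m (t t' : 'I_m -> sortK N)
    (s : 'I_n -> 'I_m) (psi : formula L m) : eqtp t t' ->
  t \o s = a -> t' \o s = a -> dclB (range a) (ev N psi t) ->
  ev N psi t' = ev N psi t.
Proof.
move=> tt' ts ts' [l [Phi [c [cA lim]]]].
case: (NT) => -[_ _ sepB _] _; apply: sepB.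
set e := ev N psi t; set e' := ev N psi t'.
case: (dB_pseudo N) => _ dB0 _ _; rewrite -(dB0 e); apply: esym.
have [u hu] : exists u : nat -> R, forall k,
    ceval (Phi k) (c k) (vcons e vnil) = u k /\
    ceval (Phi k) (c k) (vcons e' vnil) = u k.
  exists (fun k => ceval (Phi k) (c k) (vcons e vnil)) => k; split=> //.
  have /choice[x xP] i : exists j, a j = c k i by have [j _ <-] := cA k i; exists j.
  have ck : c k = a \o x by exact/esym/funext.
  have := ceval_eqtp NT ft two (Phi k) (s \o x) (fun=> psi) tt'.
  have vE (z : sortB N) : (fun j : 'I_1 => z) = vcons z vnil.
    by apply/funext => j; rewrite (ord1 j) vcons0.
  have -> : t \o (s \o x) = a \o x by rewrite -ts.
  have -> : t' \o (s \o x) = a \o x by rewrite -ts'.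
  by rewrite ck !vE.
have h d : 0 < d -> exists k, `|u k - dB N e e| < d /\ `|u k - dB N e' e| < d.
  move=> /lim[K /(_ K (leqnn K)) hK]; exists K.
  by have := hK e; have := hK e'; rewrite (hu K).1 (hu K).2.
apply/eqP; rewrite -subr_eq0 -normr_le0; apply/ler_addgt0Pl => d d0.
have [k [h1 h2]] := h (d / 2) (divr_gt0 d0 (ltr0Sn _ 1)).
have -> : dB N e e - dB N e' e = (u k - dB N e' e) - (u k - dB N e e) by lra.
by apply: le_trans (ler_normB _ _) _; lra.
Qed.

(* Over every complete type in [v] the element [c] is chosen in a fixed complete
   type, so that it adds no event to those definable from [a]. *)
Lemma constant_type n (a : 'I_n -> sortK N) (rho : formula L n.+1) :
  (forall M : structure L, models M T -> forall v : 'I_n -> M,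
     exists u, sat rho (vcons u v)) ->
  exists c, ev N rho (vcons c a) = btop N /\ forall phi : formula L n.+1,
    exists phi' : formula L n, ev N phi (vcons c a) = ev N phi' a.
Proof.
move=> rhoP; have [I [chi chiP]] := ft n; have [J [theta thetaP]] := ft n.+1.
have [chi_iso _ _] := chiP; have [theta_iso theta_cov _] := thetaP.
have /choice[f fP] i : exists f : formula L n.+1, isolates T f /\
    (consistent T (chi i) -> timp T (chi i) (FEx f) /\ timp T f rho).
  case: (pselect (consistent T (chi i))) => [[M MT [v vi]]|]; last first.
    by exists (FFalse n.+1); split=> // psi; left=> M MT v []; apply: sat_true.
  have [u ur] := rhoP M MT v; have [j vj] := theta_cov M MT (vcons u v).
  exists (theta j); split=> // _; split.
    by case: (chi_iso i (FEx (theta j))) => // /(_ M MT v vi) []; exists u.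
  by case: (theta_iso j rho) => // /(_ M MT _ vj).
have pE := types_partition NT a chiP.
have [|c cP] := @realize _ _ _ _ NT _ (fun i => ev N (chi i) a) n a f
  (partition_disjoint NT pE).
  move=> i; case: (pselect (consistent T (chi i))) => hc.
    exact: (ev_timp NT) ((fP i).2 hc).1.
  have := ev_unsat NT a hc; rewrite /sub; set x := ev _ _ _; set y := ev _ _ _.
  by mu_lra ma [:: x; y].
exists c; split.
  apply: (event_eq NT); first by rewrite /sub; set x := ev _ _ _; mu_lra ma [:: x].
  apply: (partition_sub pE) => i.
  case: (pselect (consistent T (chi i))) => hc; last first.
    have := ev_unsat NT a hc; set x := ev _ _ a; set y := ev _ _ _.
    by mu_lra ma [:: x; y].
  have := ev_timp NT (vcons c a) ((fP i).2 hc).2; have := cP i; rewrite /sub.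
  set x := ev _ _ a; set y := ev _ rho _; set z := ev _ (f i) _.
  by mu_lra ma [:: x; y; z].
(* Over [chi i] the tuple [(c, a)] satisfies the isolating formula [f i], so the event of [phi]
   contains or misses [chi i] as a whole. *)
move=> phi; exists (\big[@FOr L n/FFalse n]_(i | `[< timp T (f i) phi >]) chi i).
set psi := \big[_/_]_(i | _) _.
have psi1 i : timp T (f i) phi -> timp T (chi i) psi.
  move=> h M MT v vi; apply/sat_bigor; exists i => //; exact/asboolP.
have psi2 i : ~ timp T (f i) phi -> ~ consistent T (FAnd (chi i) psi).
  move=> h [M MT [v [vi /sat_bigor[j /asboolP hj vj]]]].
  by have [_ _ dis] := chiP; rewrite (dis M MT v i j vi vj) in h.
apply: (event_eq NT); apply: (partition_sub pE) => i.
  have := cP i; case: (pselect (timp T (f i) phi)) => h.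
    have := ev_timp NT a (psi1 i h); rewrite /sub.
    set x := ev _ _ _; set y := ev _ _ _; set z := ev _ _ _; set w := ev _ _ _.
    by mu_lra ma [:: x; y; z; w].
  case: ((fP i).1 phi) => // /(ev_timp NT (vcons c a)); rewrite (ev_not NT) /sub.
  set x := ev _ _ _; set y := ev _ _ _; set z := ev _ _ _; set w := ev _ _ _.
  by mu_lra ma [:: x; y; z; w].
have := cP i; case: (pselect (timp T (f i) phi)) => h.
  have := ev_timp NT (vcons c a) h; rewrite /sub.
  set x := ev _ _ _; set y := ev _ _ _; set z := ev _ _ _; set w := ev _ _ _.
  by mu_lra ma [:: x; y; z; w].
have := ev_unsat NT a (psi2 i h); rewrite (ev_and NT) /sub.
set x := ev _ _ _; set y := ev _ _ _; set z := ev _ _ _; set w := ev _ _ _.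
by mu_lra ma [:: x; y; z; w].
Qed.

Lemma equal_subevents x y : 0 < mu N x -> 0 < mu N y ->
  mu N (bmeet N x y) = 0 -> exists x' y', [/\ sub x' x, sub y' y,
    mu N x' = mu N y' & 0 < mu N x'].
Proof.
move=> x0 y0 xy; pose r := Num.min (mu N x) (mu N y).
have r0 : 0 < r by rewrite lt_min x0 y0.
have [|x' x'x x'r] := @model_sierpinski _ _ _ _ NT x r.
  by rewrite (ltW r0) ge_min lexx.
have [|y' y'y y'r] := @model_sierpinski _ _ _ _ NT y r.
  by rewrite (ltW r0) ge_min lexx orbT.
by exists x', y'; rewrite x'r y'r.
Qed.

Lemma dclB_fdclB n (a : 'I_n -> sortK N) : dclB (range a) `<=` fdclB (range a).
Proof.
move=> b bA; rewrite fdclB_tuple.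
have [I [chi chiP]] := ft n; have pE := types_partition NT a chiP.
have [chi_iso _ chi_dis] := chiP.
(* The union of the atoms that meet [b]; it equals [b] unless some atom is properly cut by [b]. *)
pose psi := \big[@FOr L n/FFalse n]_(i | mu N (bmeet N (ev N (chi i) a) b) != 0) chi i.
case: (pselect (exists i, 0 < mu N (bmeet N (ev N (chi i) a) b) /\
    0 < mu N (bmeet N (ev N (chi i) a) (bneg N b)))) => [[i [i1 i2]]|hn]; last first.
  exists psi => //; apply: (event_eq NT); apply: (partition_sub pE) => i.
    case: (eqVneq (mu N (bmeet N (ev N (chi i) a) b)) 0) => hi.
      have : mu N (ev N (FAnd (chi i) psi) a) = 0.
        apply: (ev_unsat NT) => -[M MT [v [vi /sat_bigor[j hj vj]]]].
        by rewrite -(chi_dis M MT v i j vi vj) hi eqxx in hj.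
      rewrite (ev_and NT); set x := ev _ _ _; set y := ev _ _ _.
      by mu_lra ma [:: x; y; b].
    have /eqP : mu N (bmeet N (ev N (chi i) a) (bneg N b)) == 0.
      apply: contra_notT hn => h; exists i.
      by rewrite !lt_def hi h !mu_ge0.
    set x := ev _ _ _; set y := ev _ _ _.
    by mu_lra ma [:: x; y; b].
  case: (eqVneq (mu N (bmeet N (ev N (chi i) a) b)) 0) => hi.
    move: hi; set x := ev _ _ _; set y := ev _ _ _.
    by mu_lra ma [:: x; y; b].
  have : timp T (chi i) psi by move=> M MT v vi; apply/sat_bigor; exists i.
  move/(ev_timp NT a); rewrite /sub; set x := ev _ _ _; set y := ev _ _ _.
  by mu_lra ma [:: x; y; b].
(* Exchanging a piece [C] of [b] for a piece [D] of its complement inside one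
   atom changes [b] but not its type over [a]. *)
pose E := ev N (chi i) a.
have [|C [D [Cb Db CD C0]]] := equal_subevents i1 i2.
  by rewrite -/E; mu_lra ma [:: E; b].
pose b' := bjoin N (bmeet N b (bneg N C)) D.
(* To compare the types of [b] and [b'], both are coded with elements [c0] and [d0] that differ
   everywhere. These are taken of constant type, so every first-order event of [(c0, d0, a)] is
   already one of [a]. *)
have [d0 [_ d0P]] := @constant_type n a (FTrue n.+1)
  (fun M MT v => let: inhabits u := carrier_inh M in
     ex_intro _ u (sat_true (vcons u v))).
have [c0 [c0d0 c0P]] : exists c,
      ev N (FNot (FEq (TVar L ord0) (TVar L (lift ord0 ord0))))
        (vcons c (vcons d0 a)) = btop N /\ forall phi : formula L n.+2,
    exists phi', ev N phi (vcons c (vcons d0 a)) = ev N phi' (vcons d0 a).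
  apply: constant_type => M MT v; have [u [u' uu']] := two MT.
  case: (pselect (u = v ord0)) => [e|nu].
    by exists u'; rewrite /= vcons0 vconsS -e; apply/nesym.
  by exists u; rewrite /= vcons0 vconsS.
have {}c0d0 : mu N (eqe c0 d0) = 0.
  move: c0d0; rewrite (ev_not NT) (ev_fun_eq NT) vcons0 !vconsS vcons0.
  move=> h.
  have : mu N (bneg N (bneg N (eqe c0 d0))) = mu N (bneg N (btop N)) by rewrite h.
  by set u := eqe _ _; mu_lra ma [:: u].
have [d [dc [d1 d2]]] := event_code NT b c0d0.
have [d' [dc' [d1' d2']]] := event_code NT b' c0d0.
(* The exchange happens inside the atom [E], which every [phi(a)] contains or misses, and [C] and
   [D] have equal measure. *)
have ba phi : mu N (bmeet N b (ev N phi a)) = mu N (bmeet N b' (ev N phi a)).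
  rewrite pE (pE (bmeet N b' _)); apply: eq_bigr => j _.
  case: (eqVneq j i) => [->|ji].
    case: (chi_iso i phi) => /(ev_timp NT a); rewrite ?(ev_not NT) -/E /b'.
      move: Cb Db CD; rewrite -/E /sub; set x := ev _ _ _.
      by mu_lra ma [:: x; b; E; C; D].
    rewrite /sub; set x := ev _ _ _.
    by mu_lra ma [:: x; b; E; C; D].
  move: Cb Db (partition_disjoint NT pE ji); rewrite -/E /sub /b'.
  set x := ev _ _ _; set y := ev _ _ _.
  by mu_lra ma [:: x; y; b; E; C; D].
pose t := vcons c0 (vcons d0 a).
pose s3 : 'I_n.+2 -> 'I_n.+3 := lift ord0.
(* A code [z] is [c0] on [e] and [d0] off [e], so its type is determined by the measures of [e] and
   its complement inside events of [(c0, d0, a)], hence of [a]. *)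
have two_step (phi : formula L n.+3) z e :
    sub e (eqe z c0) -> sub (bneg N e) (eqe z d0) ->
    mu N (ev N phi (vcons z t)) = mu N (bmeet N e (ev N phi (vcons c0 t))) +
      mu N (bmeet N (bneg N e) (ev N phi (vcons d0 t))).
  have half u x : sub x (eqe z u) -> mu N (bmeet N x (ev N phi (vcons z t))) =
      mu N (bmeet N x (ev N phi (vcons u t))).
    move=> xzu; have := ev_subst1 NT phi z u t; have := ev_subst1 NT phi u z t.
    rewrite (eqe_sym NT u); move: xzu; rewrite /sub.
    set y := eqe _ _; set p := ev _ _ _; set p' := ev _ _ _.
    by mu_lra ma [:: x; y; p; p'].
  move=> /half <- /half <-; set p := ev _ _ _.
  by mu_lra ma [:: e; p].
have eqt : eqtp (vcons d t) (vcons d' t).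
  move=> phi; rewrite (two_step phi d b) // (two_step phi d' b') //.
  have h (z : sortK N) (f : 'I_n.+3 -> 'I_n.+2) : vcons z t = t \o f ->
      exists phi', ev N phi (vcons z t) = ev N phi' a.
    move=> ->; rewrite -(ev_ren NT); have [phi1 ->] := c0P (ren phi f).
    by have [phi2 ->] := d0P phi1; exists phi2.
  have [|p1 ->] := h c0 (vcons ord0 id).
    by rewrite vcons_comp /t vcons0.
  have [|p2 ->] := h d0 (vcons (lift ord0 ord0) id).
    by rewrite vcons_comp /t vconsS vcons0.
  have := ba p1; have := ba p2; set x := ev _ _ _; set y := ev _ _ _.
  by mu_lra ma [:: x; y; b; b'].
have tE z : ev N (FEq (TVar L ord0) (TVar L (lift ord0 ord0))) (vcons z t) = eqe z c0.
  by rewrite (ev_fun_eq NT) vconsS /t !vcons0.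
have sE z : vcons z t \o (lift ord0 \o (lift ord0 \o lift ord0)) = a.
  by apply/funext => j; rewrite /= /t !vconsS.
have := dclB_eqtp (psi := FEq (TVar L ord0) (TVar L (lift ord0 ord0)))
  eqt (sE d) (sE d').
rewrite !tE dc dc' => /(_ bA) e.
move: Cb C0; have : mu N (bmeet N C b) = mu N (bmeet N C b') by rewrite e.
move: Db; rewrite /b' /sub -/E.
by mu_lra ma [:: b; C; D; E].
Qed.

End Closures.

(** * Definable elements and finiteness of closures for finitely many types *)

Section FiniteTypes.
Variables (R : realType) (L : signature) (T : theory L).
Variables (N : prestructure R L) (NT : models_TR T N).
Hypothesis ft : forall n, finite_types T n.
Hypothesis two : forall M : structure L, models M T -> exists a b : M, a <> b.

Let ma : measure_algebra N := model_measure_algebra NT.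

Lemma sum_option_bool (F : option bool -> R) :
  \sum_i F i = F None + F (Some true) + F (Some false).
Proof.
rewrite (bigD1 None) // (bigD1 (Some true)) // (bigD1 (Some false)) //= big1.
  by rewrite addr0 addrA.
by case=> [[]|].
Qed.

Lemma dcl_fdcl n (a : 'I_n -> sortK N) : dcl (range a) `<=` fdcl T (range a).
Proof.
move=> b bA; apply/(fdcl_tuple NT).
have [J [theta thetaP]] := ft n.+1; have [iso _ dis] := thetaP.
pose G j := ev N (theta j) (vcons b a).
have pG : event_partition G := types_partition NT _ thetaP.
(* The disjunction of the types that [b] takes with positive measure over [a]; it holds of [b]
   everywhere, and what is at stake is that it is functional. *)
pose phi := \big[@FOr L n.+1/FFalse n.+1]_(j | mu N (G j) != 0) theta j.
exists phi; last first.
  apply: (event_eq NT); first by rewrite /sub; set x := ev _ _ _; mu_lra ma [:: x].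
  apply: (partition_sub pG) => j.
  case: (eqVneq (mu N (G j)) 0) => j0.
    by move: j0; set x := G j; set y := ev _ _ _; mu_lra ma [:: x; y].
  have : timp T (theta j) phi by move=> M MT v vj; apply/sat_bigor; exists j.
  move/(ev_timp NT (vcons b a)); rewrite -/(G j) /sub; set x := G j; set y := ev _ _ _.
  by mu_lra ma [:: x; y].
move=> M MT v u u' /sat_bigor[j j0 uj] /sat_bigor[k k0 uk].
apply: contrapT => uu'.
(* If two of the types that [b] takes have distinct realizations over a common
   [v], exchange them on pieces [C] and [D] of equal measure: this changes [b]
   but not its type over [a]. *)
have [C [D [Cj Dk CD C0 CD0]]] : exists C D, [/\ sub C (G j), sub D (G k),
    mu N C = mu N D, 0 < mu N C & mu N (bmeet N C D) = 0].
  have jpos : 0 < mu N (G j) by rewrite lt_def j0 mu_ge0.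
  (* One type may have two realizations over [v]; the two pieces are then the halves of its
     event. *)
  case: (eqVneq j k) => [<-|jk].
    have [|C Cj CE] := @model_sierpinski _ _ _ _ NT (G j) (mu N (G j) / 2).
      by apply/andP; split; lra.
    exists C, (bmeet N (G j) (bneg N C)); move: Cj CE jpos; rewrite /sub.
    by set x := G j; split; move: Cj CE jpos; mu_lra ma [:: x; C].
  have kpos : 0 < mu N (G k) by rewrite lt_def k0 mu_ge0.
  have jk0 := partition_disjoint NT pG jk.
  have [C [D [Cj Dk CD C0]]] := equal_subevents NT jpos kpos jk0.
  exists C, D; split=> //; move: Cj Dk jk0; rewrite /sub.
  by set x := G j; set y := G k; mu_lra ma [:: x; y; C; D].
pose f : 'I_n.+1 -> 'I_n.+2 := vcons ord0 (lift ord0 \o lift ord0).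
have fE (X : Type) (y z : X) (w : 'I_n -> X) : vcons y (vcons z w) \o f = vcons y w.
  rewrite /f vcons_comp vcons0; congr vcons.
  by apply/funext => i; rewrite /= !vconsS.
(* Of three blocks of variables (new element, old element, tuple): the new element has type [l] over
   the tuple and differs from the old one. *)
pose other l : formula L n.+2 :=
  FAnd (ren (theta l) f) (FNot (FEq (TVar L ord0) (TVar L (lift ord0 ord0)))).
have otherP l m (x y : M) : sat (theta l) (vcons x v) -> sat (theta m) (vcons y v) ->
    x <> y -> sub (G l) (ev N (FEx (other m)) (vcons b a)).
  move=> xl ym xy; apply: (ev_timp NT); case: (iso l (FEx (other m))) => // h.
  have hy : sat (other m) (vcons y (vcons x v)).
    apply/sat_and; rewrite sat_ren fE; split=> //=.
    by rewrite vcons0 vconsS vcons0 => /esym.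
  by case: (h M MT _ xl); exists y.
(* [b'] gets type [k] on [C], type [j] on [D], and equals [b] elsewhere. *)
pose E (i : option bool) := match i with
  | Some true => C | Some false => D | None => bneg N (bjoin N C D) end.
pose psi (i : option bool) : formula L n.+2 := match i with
  | Some true => other k | Some false => other j
  | None => FEq (TVar L ord0) (TVar L (lift ord0 ord0)) end.
have dE : disjoint_events E.
  move=> [[]|] [[]|] //= _; move: CD0; rewrite /E;
    by mu_lra ma [:: C; D].
have pE : event_partition E.
  apply: (event_partitionP NT) => //.
  by rewrite sum_option_bool /E; move: CD0 (ma_top ma); mu_lra ma [:: C; D].
have [|b' b'P] := realize (theta := psi) NT (a := vcons b a) dE.
  case=> [[]|] /=.
  - exact: sub_trans ma _ _ _ Cj (otherP _ _ _ _ uj uk uu').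
  - exact: sub_trans ma _ _ _ Dk (otherP _ _ _ _ uk uj (nesym uu')).
  - rewrite (ev_valid NT) => [|M' MT' w]; last first.
      by exists (w ord0); rewrite /= vcons0 vconsS.
    by rewrite /sub; mu_lra ma [:: C; D].
have := b'P (Some true); have := b'P (Some false); have := b'P None.
rewrite /= !(ev_and NT) !(ev_not NT) !(ev_ren NT) !fE !(ev_fun_eq NT) vconsS !vcons0.
move=> bN bF bT.
have bb' : eqtp (vcons b a) (vcons b' a).
  apply: (eqtp_atoms NT thetaP) => l; rewrite pE (pE (ev N _ (vcons b' a))).
  rewrite !sum_option_bool.
  have e1 : mu N (bmeet N (ev N (theta l) (vcons b a)) (bneg N (bjoin N C D))) =
      mu N (bmeet N (ev N (theta l) (vcons b' a)) (bneg N (bjoin N C D))).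
    have := ev_subst1 NT (theta l) b b' a; have := ev_subst1 NT (theta l) b' b a.
    rewrite (eqe_sym NT b b'); move: bN; rewrite /sub.
    set x := eqe _ _; set y := ev _ _ _; set z := ev _ _ _.
    set w := bneg N (bjoin N C D).
    by mu_lra ma [:: x; y; z; w].
  have e2 (c : sortK N) (F : sortB N) m : sub F (ev N (theta m) (vcons c a)) ->
      mu N (bmeet N (ev N (theta l) (vcons c a)) F) = if l == m then mu N F else 0.
    rewrite /sub; case: eqP => [<-|/eqP lm].
      by set x := ev _ _ _; mu_lra ma [:: x; F].
    have := partition_disjoint NT (types_partition NT (vcons c a) thetaP) lm.
    by set x := ev _ _ _; set y := ev _ _ _; mu_lra ma [:: x; y; F].
  have bT' : sub C (ev N (theta k) (vcons b' a)).
    move: bT; rewrite /sub; set x := ev _ _ _; set y := eqe _ _.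
    by mu_lra ma [:: x; y; C].
  have bF' : sub D (ev N (theta j) (vcons b' a)).
    move: bF; rewrite /sub; set x := ev _ _ _; set y := eqe _ _.
    by mu_lra ma [:: x; y; D].
  rewrite /= e1 (e2 _ _ _ Cj) (e2 _ _ _ Dk) (e2 _ _ _ bT') (e2 _ _ _ bF') CD.
  by rewrite addrAC.
have eb : b' = b by apply: (dcl_eqtp NT ft two bA).
suff C00 : mu N C = 0 by rewrite C00 ltxx in C0.
move: bT; rewrite {}eb (eqe_refl NT) /sub; set x := ev _ _ _.
by mu_lra ma [:: x; C].
Qed.

(** Modulo [T] a formula is determined by the set of isolated types that imply it. *)
Lemma fdclB_finite (A : set (sortK N)) : finite_set A -> finite_set (fdclB A).
Proof.
move=> /finite_enum[n [a [aA Aa]]].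
have -> : A = range a.
  by apply/seteqP; split=> [x /Aa[i <-]|_ [i _ <-]]; [exists i|].
rewrite (fdclB_tuple NT); have [I [chi chiP]] := ft n.
have [iso cov _] := chiP.
pose g (S : {set I}) := ev N (\big[@FOr L n/FFalse n]_(i in S) chi i) a.
apply: (@sub_finite_set _ _ (range g)); last exact/finite_image/finite_finset.
move=> _ [phi _ <-]; exists [set i | `[< timp T (chi i) phi >]]%SET => //.
apply: (ev_equiv NT) => M MT v.
  by move=> /sat_bigor[i]; rewrite inE => /asboolP h vi; apply: h.
move=> vphi; have [i vi] := cov M MT v; apply/sat_bigor; exists i => //.
rewrite inE; apply/asboolP; case: (iso i phi) => // h.
by have := h M MT v vi.
Qed.

(** There are finitely many functional formulas up to equivalence, and over the tuple [a] each
    defines at most one element. *)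
Lemma fdcl_finite (A : set (sortK N)) : finite_set A -> finite_set (fdcl T A).
Proof.
move=> /finite_enum[n [a [aA Aa]]].
have -> : A = range a.
  by apply/seteqP; split=> [x /Aa[i <-]|_ [i _ <-]]; [exists i|].
have [I [chi chiP]] := ft n.+1; have [iso cov _] := chiP.
pose rel (S : {set I}) b := exists2 phi : formula L n.+1, functional_formula T phi &
  ev N phi (vcons b a) = btop N /\ S = [set i | `[< timp T (chi i) phi >]]%SET.
case: (sortK_inh N) => k0.
have /choice[g gP] S : exists b, (exists b, rel S b) -> rel S b.
  case: (pselect (exists b, rel S b)) => [[b]|h]; first by exists b.
  by exists k0 => /h.
apply: (@sub_finite_set _ _ (range g)); last exact/finite_image/finite_finset.
move=> b /(fdcl_tuple NT)[phi phif pb].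
exists [set i | `[< timp T (chi i) phi >]]%SET => //.
set S := [set i | _]%SET; have [|psi psif [pg Spsi]] := gP S.
  by exists b, phi.
apply: (eqe_inj NT); rewrite -(functional_eqe NT phif pb).
have -> : ev N phi (vcons (g S) a) = ev N psi (vcons (g S) a).
  have timpS (f f' : formula L n.+1) :
      [set i | `[< timp T (chi i) f >]]%SET = [set i | `[< timp T (chi i) f' >]]%SET ->
      timp T f f'.
    move=> e M MT v vf; have [i vi] := cov M MT v.
    have : i \in [set i | `[< timp T (chi i) f >]]%SET.
      rewrite inE; apply/asboolP; case: (iso i f) => // h.
      by have := h M MT v vi.
    by rewrite e inE => /asboolP h; apply: h vi.
  by apply: (ev_equiv NT); apply: timpS; rewrite -Spsi.
by rewrite pg; mu_lra ma (@nil (sortB N)).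
Qed.

End FiniteTypes.

(** * Infinitely many types *)

Lemma no_injection_set_nat (f : set nat -> nat) : ~ injective f.
Proof.
move=> finj; pose D : set nat := [set k | exists2 S, f S = k & ~ S k].
case: (pselect (D (f D))) => h; last by apply: (h); exists D.
by have [S /finj SD nS] := h; apply: nS; rewrite SD.
Qed.

Section InfiniteTypes.
Variables (R : realType) (L : signature) (T : theory L).
Variables (N : prestructure R L) (NT : models_TR T N).
Hypothesis Tc : complete_theory T.
Hypothesis two : forall M : structure L, models M T -> exists a b : M, a <> b.

Let ma : measure_algebra N := model_measure_algebra NT.

Lemma tuple_witness n (phi : formula L n) :
  (forall M : structure L, models M T -> exists v : 'I_n -> M, sat phi v) ->
  exists a, ev N phi a = btop N.
Proof.
elim: n phi => [|n IH] phi h.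
  exists vnil; apply: (ev_valid NT) => M MT v.
  by have [w] := h M MT; rewrite (eq_ord0_fun w v).
have [|a ea] := IH (FEx phi).
  move=> M MT; have [v hv] := h M MT.
  by exists (v \o lift ord0), (v ord0); rewrite vcons_eta.
have [d] := event_witness NT phi a; rewrite ea => hd.
exists (vcons d a); apply: (event_eq NT) => //.
by rewrite /sub; set x := ev _ _ _; mu_lra ma [:: x].
Qed.

Variables (n : nat) (nft : ~ finite_types T n).

(* The tuple is glued from realizations of the [psi k] along the pieces
   [H k \ H k.+1] of a decreasing sequence of events with null limit. *)
Lemma spread_tuple : exists (a : 'I_n -> sortK N) (psi : nat -> formula L n)
    (H : nat -> sortB N),
  [/\ forall j k, j <> k -> ~ consistent T (FAnd (psi j) (psi k)),
      forall k, sub (bmeet N (H k) (bneg N (H k.+1))) (ev N (psi k) a),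
      (forall k, sub (H k.+1) (H k)) /\ H 0%N = btop N,
      forall k, 0 < mu N (bmeet N (H k) (bneg N (H k.+1))) &
      forall e : R, 0 < e -> exists k, mu N (H k) < e].
Proof.
have [psi [cs inc]] := infinite_antichain nft.
have [H [H0 HS Hhalf Hsmall]] := halving_sequence NT.
have /choice[b bP] k : exists b, ev N (psi k) b = btop N.
  by apply: tuple_witness; apply: consistent_realized Tc (cs k).
have /choice[a aP] i : exists z, forall k,
    sub (bmeet N (H k) (bneg N (H k.+1))) (eqe z (b k i)).
  exact: (countable_glue NT (fun k => b k i) HS Hsmall).
have Hpos k : 0 < mu N (H k).
  elim: k => [|k IH]; first by rewrite H0 (ma_top ma).
  by rewrite Hhalf; lra.
exists a, psi, H; split=> // [j k jk [M MT [v [vj vk]]]|k|k].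
- case: (ltngtP j k) => [jk'|kj|//]; first exact: (inc j k jk' M MT v vj vk).
  exact: (inc k j kj M MT v vk vj).
- have aP' i : sub (bmeet N (H k) (bneg N (H k.+1))) (eqe (b k i) (a i)).
    by rewrite (eqe_sym NT); apply: aP.
  have := ev_subst NT (psi k) aP'.
  rewrite bP /sub; set x := H k; set y := H k.+1; set z := ev _ _ _.
  by mu_lra ma [:: x; y; z].
- move: (Hhalf k) (Hpos k) (HS k); rewrite /sub; set x := H k; set y := H k.+1.
  by mu_lra ma [:: x; y].
Qed.

(** * Subfamilies of the spread events as events and as elements *)

Section Spread.
Variables (a : 'I_n -> sortK N) (psi : nat -> formula L n) (H : nat -> sortB N).
Hypothesis psi_inc : forall j k, j <> k -> ~ consistent T (FAnd (psi j) (psi k)).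
Let G k := bmeet N (H k) (bneg N (H k.+1)).
Hypothesis Ga : forall k, sub (G k) (ev N (psi k) a).
Hypothesis H_sub : forall k, sub (H k.+1) (H k).
Hypothesis H_top : H 0%N = btop N.
Hypothesis G_pos : forall k, 0 < mu N (G k).
Hypothesis H_small : forall e : R, 0 < e -> exists k, mu N (H k) < e.

Lemma psi_disjoint j k : j <> k -> mu N (bmeet N (G k) (ev N (psi j) a)) = 0.
Proof.
move=> /psi_inc/(ev_unsat NT a); rewrite (ev_and NT); move: (Ga k); rewrite /sub.
set x := G k; set y := ev _ _ _; set z := ev _ _ _.
by mu_lra ma [:: x; y; z].
Qed.

Lemma psi_inj : injective (fun k => ev N (psi k) a).
Proof.
move=> j k /= e; apply: contrapT => jk; have := psi_disjoint jk.
rewrite e; move: (Ga k) (G_pos k); rewrite /sub.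
set x := G k; set z := ev _ _ _ => h1 h2 h3.
suff h : mu N x = 0 by rewrite h ltxx in h2.
by move: h1 h3; mu_lra ma [:: x; z].
Qed.

(** The first [m] pieces fill the complement of [H m]. An approximation correct on them therefore
    has error at most [mu (H m)]. *)
Lemma small_outside x m : (forall k, (k < m)%N -> mu N (bmeet N x (G k)) = 0) ->
  mu N x <= mu N (H m).
Proof.
move=> h; suff : mu N (bmeet N x (bneg N (H m))) = 0.
  by set y := H m; mu_lra ma [:: x; y].
elim: m h => [|m IH] h; first by rewrite H_top; mu_lra ma [:: x].
have {}IH := IH (fun k km => h k (ltnW km)).
move: IH (h m (ltnSn m)); rewrite /G; set y := H m; set z := H m.+1.
by mu_lra ma [:: x; y; z].
Qed.

Lemma partial_union (S : set nat) m : exists chi : formula L n, forall k, (k < m)%N ->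
  (S k -> sub (G k) (ev N chi a)) /\ (~ S k -> mu N (bmeet N (G k) (ev N chi a)) = 0).
Proof.
exists (\big[@FOr L n/FFalse n]_(k < m | `[< S k >]) psi k) => k km.
split=> Sk.
  apply: sub_trans ma _ _ _ (Ga k) _; apply: (ev_timp NT) => M MT v vk.
  by apply/sat_bigor; exists (Ordinal km) => //=; apply/asboolP.
have : mu N (ev N (FAnd (psi k)
    (\big[@FOr L n/FFalse n]_(k < m | `[< S k >]) psi k)) a) = 0.
  apply: (ev_unsat NT) => -[M MT [v [vk /sat_bigor[j /asboolP Sj vj]]]].
  apply: (psi_inc (j := k) (k := j)); first by move=> e; rewrite e in Sk.
  by exists M => //; exists v.
rewrite (ev_and NT); move: (Ga k); rewrite /sub.
set x := G k; set y := ev _ _ _; set z := ev _ _ _.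
by mu_lra ma [:: x; y; z].
Qed.

Variables (c d : sortK N).
Hypothesis cd : mu N (eqe c d) = 0.

(** Codes [S] by an element, so that [eqe u c] is the union of the pieces with index in [S], an
    infinite union not otherwise at hand. *)
Lemma subset_element (S : set nat) : exists u, forall k,
  (S k -> sub (G k) (eqe u c)) /\ (~ S k -> sub (G k) (eqe u d)).
Proof.
have [u uP] := countable_glue NT (fun k => if `[< S k >] then c else d) H_sub H_small.
by exists u => k; have := uP k; case: asboolP.
Qed.

Lemma not_both k u : sub (G k) (eqe u c) -> sub (G k) (eqe u d) -> False.
Proof.
move=> h1 h2; suff h : mu N (G k) = 0 by have := G_pos k; rewrite h ltxx.
move: h1 h2 cd (eqe_sub2 NT c u d); rewrite (eqe_sym NT c u) /sub.
set x := G k; set y := eqe _ _; set z := eqe _ _; set w := eqe _ _.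
by mu_lra ma [:: x; y; z; w].
Qed.

Lemma subset_element_inj (S S' : set nat) u :
  (forall k, (S k -> sub (G k) (eqe u c)) /\ (~ S k -> sub (G k) (eqe u d))) ->
  (forall k, (S' k -> sub (G k) (eqe u c)) /\ (~ S' k -> sub (G k) (eqe u d))) ->
  S = S'.
Proof.
move=> uS uS'; apply/seteqP; split=> k Sk; apply: contrapT => Sk'.
  exact: not_both ((uS k).1 Sk) ((uS' k).2 Sk').
exact: not_both ((uS' k).1 Sk) ((uS k).2 Sk').
Qed.

Lemma subset_element_dclB S u :
  (forall k, (S k -> sub (G k) (eqe u c)) /\ (~ S k -> sub (G k) (eqe u d))) ->
  dclB (range a) (eqe u c).
Proof.
move=> uS; apply: (dclB_limit (A := range a)) => e /H_small[m hm].
have [chi chiP] := partial_union S m; exists (ev N chi a).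
  by rewrite (fdclB_tuple NT); exists chi.
apply: le_lt_trans hm; rewrite (ma_dist ma); apply: small_outside => k km.
have [h1 h2] := chiP k km; case: (pselect (S k)) => Sk.
  move: (h1 Sk) ((uS k).1 Sk); rewrite /sub.
  set x := G k; set y := ev _ _ _; set z := eqe _ _.
  by mu_lra ma [:: x; y; z].
move: (h2 Sk) ((uS k).2 Sk) cd (eqe_sub2 NT c u d); rewrite (eqe_sym NT c u) /sub.
set x := G k; set y := ev _ _ _; set z := eqe _ _; set w := eqe _ _; set t := eqe _ _.
by mu_lra ma [:: x; y; z; w; t].
Qed.

Let a' := vcons c (vcons d a).

(** With [c] and [d] as extra parameters, the case distinction on [chi(a)] is a functional
    formula. *)
Lemma fdcl_code (chi : formula L n) : exists u, fdcl T (range a') u /\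
  eqe u c = ev N chi a /\ sub (bneg N (ev N chi a)) (eqe u d).
Proof.
have [u [uc [u1 u2]]] := event_code NT (ev N chi a) cd.
exists u; split=> //.
pose u0 : 'I_n.+3 := ord0.
pose c0 : 'I_n.+3 := lift ord0 ord0.
pose d0 : 'I_n.+3 := lift ord0 (lift ord0 ord0).
pose s : 'I_n -> 'I_n.+3 := lift ord0 \o (lift ord0 \o lift ord0).
apply/(fdcl_tuple NT).
exists (FOr (FAnd (ren chi s) (FEq (TVar L u0) (TVar L c0)))
  (FAnd (FNot (ren chi s)) (FEq (TVar L u0) (TVar L d0)))).
  move=> M MT v x y; rewrite !sat_or !sat_and !sat_not !sat_ren.
  rewrite (_ : vcons x v \o s = vcons y v \o s); last first.
    by apply/funext => i; rewrite /s /= !vconsS.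
  rewrite /= /u0 /c0 /d0 !vconsS !vcons0.
  by move=> [[? ->]|[? ->]] [[? ->]|[? ->]].
apply: (event_eq NT); first by rewrite /sub; set x := ev _ _ _; mu_lra ma [:: x].
rewrite (ev_or NT) !(ev_and NT) (ev_not NT) (ev_ren NT) !(ev_fun_eq NT).
rewrite (_ : vcons u a' \o s = a); last first.
  by apply/funext => i; rewrite /s /a' /= !vconsS.
rewrite /u0 /c0 /d0 /a' !vconsS !vcons0; move: u1 u2; rewrite /sub.
set x := ev _ _ _; set y := eqe _ _; set z := eqe _ _.
by mu_lra ma [:: x; y; z].
Qed.

Lemma subset_element_dcl S u :
  (forall k, (S k -> sub (G k) (eqe u c)) /\ (~ S k -> sub (G k) (eqe u d))) ->
  dcl (range a') u.
Proof.
move=> uS; apply: (dcl_limit (T := T) NT) => e /H_small[m hm].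
have [chi chiP] := partial_union S m; have [w [wA [wc wd]]] := fdcl_code chi.
exists w => //; apply: le_lt_trans hm; rewrite (model_dK NT).
apply: small_outside => k km.
have [h1 h2] := chiP k km; case: (pselect (S k)) => Sk.
  move: (h1 Sk) ((uS k).1 Sk) (eqe_sub2 NT w c u); rewrite -wc (eqe_sym NT c u) /sub.
  set x := G k; set y := eqe _ _; set z := eqe _ _; set t := eqe _ _.
  by mu_lra ma [:: x; y; z; t].
move: (h2 Sk) ((uS k).2 Sk) wd (eqe_sub2 NT w d u); rewrite (eqe_sym NT d u) /sub.
set x := G k; set y := ev _ _ _; set z := eqe _ _; set t := eqe _ _; set q := eqe _ _.
by mu_lra ma [:: x; y; z; t; q].
Qed.

Lemma spread_fdclB_infinite : infinite_set (fdclB (range a)).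
Proof.
move=> fin; apply: infinite_nat.
have -> : [set: nat] = (fun k => ev N (psi k) a) @^-1` fdclB (range a).
  by apply/seteqP; split=> k // _; rewrite /= (fdclB_tuple NT); exists (psi k).
by apply: finite_preimage fin => j k _ _ /psi_inj.
Qed.

Lemma spread_fdcl_infinite : infinite_set (fdcl T (range a')).
Proof.
move=> fin; apply: infinite_nat.
have /choice[u uP] k : exists u, fdcl T (range a') u /\ eqe u c = ev N (psi k) a.
  by have [u [? [? _]]] := fdcl_code (psi k); exists u.
have -> : [set: nat] = u @^-1` fdcl T (range a').
  by apply/seteqP; split=> k // _; case: (uP k).
apply: finite_preimage fin => j k _ _ e; apply: psi_inj => /=.
by rewrite -(uP j).2 -(uP k).2 e.
Qed.

(** Equality would name the union coded by each [S] by a formula. Different subsets have different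
    unions, since the pieces are not null, so codes of formulas would inject [set nat] into
    [nat]. *)
Lemma spread_dclB : fdclB (range a) <> dclB (range a).
Proof.
move=> e.
have /choice[u uP] (S : set nat) := subset_element S.
have /choice[f fP] S : exists phi : formula L n, ev N phi a = eqe (u S) c.
  have := subset_element_dclB (uP S); rewrite -e (fdclB_tuple NT).
  by case=> phi _ <-; exists phi.
apply: (@no_injection_set_nat (fun S => pickle (fcode (f S)))).
move=> S S' /(pcan_inj (@pickleK _)) /fcode_inj ff.
have eqc : eqe (u S) c = eqe (u S') c by rewrite -!fP ff.
apply/seteqP; split=> k Sk; apply: contrapT => Sk'.
  apply: (not_both (u := u S') _ ((uP S' k).2 Sk')).
  by rewrite -eqc; apply: (uP S k).1.
apply: (not_both (u := u S) _ ((uP S k).2 Sk')).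
by rewrite eqc; apply: (uP S' k).1.
Qed.

Lemma spread_dcl : fdcl T (range a') <> dcl (range a').
Proof.
move=> e.
have /choice[u uP] (S : set nat) := subset_element S.
have /choice[f fP] S : exists phi : formula L n.+3, functional_formula T phi /\
    ev N phi (vcons (u S) a') = btop N.
  have := subset_element_dcl (uP S); rewrite -e => /(fdcl_tuple NT)[phi ? ?].
  by exists phi.
apply: (@no_injection_set_nat (fun S => pickle (fcode (f S)))).
move=> S S' /(pcan_inj (@pickleK _)) /fcode_inj ff.
apply: (subset_element_inj (u := u S')) (uP S').
suff -> : u S' = u S by exact: uP S.
apply: (eqe_inj NT); rewrite -(functional_eqe NT (fP S).1 (fP S).2) ff (fP S').2.
by mu_lra ma (@nil (sortB N)).
Qed.

End Spread.

Lemma infinite_types_closures :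
  [/\ exists2 A : set (sortK N), finite_set A & infinite_set (fdclB A),
      exists2 A : set (sortK N), finite_set A & fdclB A <> dclB A,
      exists2 A : set (sortK N), finite_set A & infinite_set (fdcl T A) &
      exists2 A : set (sortK N), finite_set A & fdcl T A <> dcl A].
Proof.
have [a [psi [H [h1 h2 [h3 h4] h5 h6]]]] := spread_tuple.
have [c [d cd]] := distinct_elements NT two.
have fin m (b : 'I_m -> sortK N) : finite_set (range b).
  exact/finite_image/finite_finset.
split.
- by exists (range a) => //; apply: spread_fdclB_infinite h1 h2 h5.
- by exists (range a) => //; apply: spread_dclB h1 h2 h3 h4 h5 h6 _ _ cd.
- exists (range (vcons c (vcons d a))) => //.
  exact: spread_fdcl_infinite h1 h2 h5 _ _ cd.
- exists (range (vcons c (vcons d a))) => //.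
  exact: spread_dcl h1 h2 h3 h4 h5 h6 _ _ cd.
Qed.

End InfiniteTypes.

Lemma finite_set_range (X : Type) (A : set X) : finite_set A ->
  exists n (a : 'I_n -> X), A = range a.
Proof.
move=> /finite_enum[n [a [aA Aa]]]; exists n, a.
by apply/seteqP; split=> [x /Aa[i <-]|_ [i _ <-]]; [exists i|].
Qed.

Theorem theorem4p1 (R : realType) (L : signature) (T : theory L)
    (T_complete : complete_theory T)
    (T_two : forall M : structure L, models M T -> exists a b : M, a <> b)
    (N : prestructure R L) (N_model : models_TR T N) :
  [<-> aleph0_categorical T;
       forall A : set (sortK N), finite_set A -> finite_set (fdclB A);
       forall A : set (sortK N), finite_set A -> finite_set (dclB A);
       forall A : set (sortK N), finite_set A -> fdclB A = dclB A;
       forall A : set (sortK N), finite_set A -> finite_set (fdcl T A);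
       forall A : set (sortK N), finite_set A -> finite_set (dcl A);
       forall A : set (sortK N), finite_set A -> fdcl T A = dcl A].
Proof.
(* Each of conditions 2 to 7 yields finiteness of types by contraposition, conditions 3 and 6
   because [dclB] and [dcl] contain the infinite [fdclB] and [fdcl]. The next condition in the cycle
   is then proved from finite types. *)
have infin n : ~ finite_types T n -> _ :=
  fun nft => infinite_types_closures N_model T_complete T_two nft.
have fdclB_eq : (forall n, finite_types T n) ->
    forall A : set (sortK N), finite_set A -> fdclB A = dclB A.
  move=> ft A /finite_set_range[n [a ->]]; apply/seteqP; split.
    exact: fdclB_dclB.
  exact: dclB_fdclB N_model ft T_two _ _.
have fdcl_eq : (forall n, finite_types T n) ->
    forall A : set (sortK N), finite_set A -> fdcl T A = dcl A.
  move=> ft A /finite_set_range[n [a ->]]; apply/seteqP; split.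
    exact: fdcl_dcl.
  exact: dcl_fdcl N_model ft T_two _ _.
tfae.
- move=> /(categorical_finite_types T_complete) ft A.
  exact: (fdclB_finite N_model ft).
- move=> h; have ft n : finite_types T n.
    by apply: contrapT => /infin[[A fA nA] _ _ _]; apply: nA (h A fA).
  by move=> A fA; rewrite -(fdclB_eq ft A fA); apply: h.
- move=> h; apply: fdclB_eq => n; apply: contrapT => /infin[[A fA nA] _ _ _].
  by apply: nA; apply: sub_finite_set (h A fA); exact: fdclB_dclB.
- move=> h A fA; apply: (fdcl_finite N_model) fA => n.
  by apply: contrapT => /infin[_ [B fB nB] _ _]; apply: nB (h B fB).
- move=> h; have ft n : finite_types T n.
    by apply: contrapT => /infin[_ _ [A fA nA] _]; apply: nA (h A fA).
  by move=> A fA; rewrite -(fdcl_eq ft A fA); apply: h.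
- move=> h; apply: fdcl_eq => n; apply: contrapT => /infin[_ _ [A fA nA] _].
  by apply: nA; apply: sub_finite_set (h A fA); exact: fdcl_dcl.
- move=> h; apply: (finite_types_categorical T_complete) => n.
  by apply: contrapT => /infin[_ _ _ [A fA nA]]; apply: nA (h A fA).
Qed.
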